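(* Let $X$ and $Y$ be metric spaces with bounded geometry, and let $p\in[1,\infty)\setminus\{2\}$. (1) $X$ and $Y$ are bijectively coarsely equivalent if and only if their $\ell^p$ uniform Roe algebras $B^p_u(X)$ and $B^p_u(Y)$ are isometrically isomorphic. (2) $X$ and $Y$ are coarsely equivalent if and only if their $\ell^p$ uniform Roe algebras are stably isometrically isomorphic, i.e. $B^p_u(X)\otimes\overline{M}^p_\infty$ and $B^p_u(Y)\otimes\overline{M}^p_\infty$ are isometrically isomorphic. (3) If $A^p(X)$ and $A^p(Y)$ are $\ell^p$ Roe-type algebras associated to $X$ and $Y$ respectively, and there is an isometric isomorphism between $A^p(X)$ and $A^p(Y)$, then $X$ and $Y$ are coarsely equivalent. The same conclusion holds if $B^p_s(X)$ and $B^p_s(Y)$ are isometrically isomorphic. Conversely, if $X$ and $Y$ are coarsely equivalent, then $UB^p(X)$ and $UB^p(Y)$ are isometrically isomorphic, $B^p(X)$ and $B^p(Y)$ are isometrically isomorphic, and $B^p_s(X)$ and $B^p_s(Y)$ are isometrically isomorphic.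
   Context: A metric space $X$ has bounded geometry if for all $R\ge 0$ there is $N_R\in\mathbb{N}$ such that every ball of radius $R$ in $X$ has at most $N_R$ elements (so $X$ is countable and discrete). A map $f:X\to Y$ is uniformly expansive if for all $R>0$ there is $S>0$ such that $d(x_1,x_2)\le R$ implies $d(f(x_1),f(x_2))\le S$. Two maps $f,g:X\to Y$ are close if there is $C>0$ with $d(f(x),g(x))\le C$ for all $x\in X$. $X$ and $Y$ are coarsely equivalent if there are uniformly expansive maps $f:X\to Y$, $g:Y\to X$ such that $f\circ g$ and $g\circ f$ are close to the identity maps; then $f$ and $g$ are called coarse equivalences. A bijective coarse equivalence is a coarse equivalence that is a bijection; $X$ and $Y$ are bijectively coarsely equivalent if one exists. Isometric isomorphism of algebras means an isometric (complex-linear, multiplicative, bijective) algebra isomorphism. An operator $T\in B(\ell^p(X))$ has matrix entries $T_{xy}=(T\delta_y)(x)$; more generally for a set $S$ an operator $T\in B(\ell^p(X,\ell^p(S)))$ has entries $T_{xy}\in B(\ell^p(S))$, $x,y\in X$. Its propagation is $\sup\{d(x,y):T_{xy}\ne 0\}$. $\mathbb{C}^p_u[X]$ is the algebra of all bounded operators on $\ell^p(X)$ of finite propagation, and $B^p_u(X)$ is its operator norm closure in $B(\ell^p(X))$. $\overline{M}^p_\infty=\overline{\bigcup_{n}M_n(\mathbb{C})}\subset B(\ell^p(\mathbb{N}))$ (norm closure, $M_n(\mathbb{C})$ acting on the first $n$ coordinates). For norm-closed subalgebras $A\subseteq B(\ell^p(I))$, $B\subseteq B(\ell^p(J))$ with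 $I,J$ countable, $A\otimes B\subseteq B(\ell^p(I\times J))$ is the closed linear span of the operators $a\otimes b$ ($a\in A$, $b\in B$), where $(a\otimes b)(\xi\otimes\eta)=a\xi\otimes b\eta$ and $(\xi\otimes\eta)(i,j)=\xi(i)\eta(j)$. $\ell^p$ Roe-type algebras: let $S$ be $\mathbb{N}$ or $\{1,\dots,n\}$ for some $n\in\mathbb{N}$. An operator $T=(T_{xy})\in B(\ell^p(X,\ell^p(S)))$ is locally compact if every $T_{xy}$ is a compact operator on $\ell^p(S)$. A subalgebra $A^p[X]\subseteq B(\ell^p(X,\ell^p(S)))$ is an algebraic $\ell^p$ Roe-type algebra if it consists only of locally compact, finite propagation operators and contains all finite propagation operators $T$ for which there is $N\in\mathbb{N}$ with $\operatorname{rank}T_{xy}\le N$ for all $x,y$. An $\ell^p$ Roe-type algebra $A^p(X)$ is the operator norm closure of some algebraic $\ell^p$ Roe-type algebra. With $\ell^p=\ell^p(\mathbb{N})$: $UB^p(X)$ is the norm closure of $U\mathbb{C}^p[X]$, the algebra of all finite propagation bounded operators $T$ on $\ell^p(X,\ell^p)$ for which there is $N\in\mathbb{N}$ with $\operatorname{rank}T_{xy}\le N$ for all $x,y\in X$. $B^p(X)$ is the norm closure of $\mathbb{C}^p[X]$, the algebra of all finite propagation bounded operators $T$ on $\ell^p(X,\ell^p)$ with $T_{xy}\in\overline{M}^p_\infty$ for all $x,y\in X$. $B^p_s(X)$ is the norm closure of $\mathbb{C}^p_s[X]$, the algebra of all finite propagation bounded operators $T$ on $\ell^p(X,\ell^p)$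 for which there is a finite-dimensional subspace $E_T\subset\ell^p$ such that $T_{xy}\in B(E_T)$ for all $x,y\in X$; here $T_{xy}\in B(E_T)$ means $T_{xy}=PT_{xy}P$ for a bounded idempotent $P=P_T$ on $\ell^p$ with range $E_T$, chosen independently of $x,y$. With this, $B^p_s(X)\cong B^p_u(X)\otimes K(\ell^p(\mathbb{N}))$. *)

(* Defs.v *)
From HB Require Import structures.
From mathcomp Require Import all_boot all_order all_algebra.
From mathcomp Require Import all_classical all_reals all_analysis.
From mathcomp Require Import complex ring.

Set Implicit Arguments.
Unset Strict Implicit.
Unset Printing Implicit Defensive.

Import Order.TTheory GRing.Theory Num.Theory.
Import numFieldNormedType.Exports.

Local Open Scope classical_set_scope.
Local Open Scope ring_scope.
Local Open Scope complex_scope.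

(* Complex normed spaces carry an [R[i]]-valued norm in the library; [rnorm]
   is that norm as a real number. *)
Definition rnorm (R : realType) (V : normedModType R[i]) (v : V) : R :=
  complex.Re `|v|.

Section rnorm_theory.
Variables (R : realType) (V : normedModType R[i]).
Implicit Types (u v : V).

Lemma rnormE v : `|v| = (rnorm v)%:C.
Proof. by rewrite RRe_real// normr_real. Qed.

Lemma rnorm_ge0 v : 0 <= rnorm v.
Proof. by rewrite -ler0c -rnormE. Qed.

Lemma rnormD u v : rnorm (u + v) <= rnorm u + rnorm v.
Proof. rewrite -lecR (rmorphD (real_complex R))/= -!rnormE; exact: ler_normD. Qed.

Lemma rnormZ (c : R[i]) v : rnorm (c *: v) = complex.Re `|c| * rnorm v.
Proof.
apply: complexI; rewrite (rmorphM (real_complex R))/= -!rnormE normrZ; congr (_ * _).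
Qed.

Lemma rnorm0 : rnorm (0 : V) = 0.
Proof. by rewrite /rnorm normr0. Qed.

Lemma rnorm_eq0 v : rnorm v = 0 -> v = 0.
Proof. by move=> v0; apply: normr0_eq0; rewrite rnormE v0. Qed.

End rnorm_theory.

Section lp_sum.
Variables (R : realType) (p : R).
Hypothesis p1 : 1 <= p.

Let p_gt0 : 0 < p. Proof. exact: lt_le_trans p1. Qed.
Let p_ge0 : 0 <= p. Proof. exact: ltW. Qed.
Let p_neq0 : p != 0. Proof. by rewrite gt_eqF. Qed.

Section scaling.
Variable I : choiceType.

Lemma esumZl_le (a : I -> R) (c : R) : 0 <= c -> (forall i, 0 <= a i) ->
  (\esum_(i in [set: I]) (c * a i)%:E <= c%:E * \esum_(i in [set: I]) (a i)%:E)%E.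
Proof.
move=> c0 a0; apply: ge_ereal_sup => _ [A [finA _] <-].
under eq_fsbigr do rewrite EFinM.
rewrite -ge0_mule_fsumr; last by move=> i; rewrite lee_fin.
by apply: lee_wpmul2l; [rewrite lee_fin|apply: esum_ge; exists A].
Qed.

Lemma esumZl (a : I -> R) (c : R) : 0 <= c -> (forall i, 0 <= a i) ->
  (\esum_(i in [set: I]) (c * a i)%:E = c%:E * \esum_(i in [set: I]) (a i)%:E)%E.
Proof.
move=> c0 a0; apply/eqP; rewrite eq_le esumZl_le//=.
have [->|cn0] := eqVneq c 0.
  by rewrite mul0e; apply: esum_ge0 => i _; rewrite mul0r.
have cp : 0 < c by rewrite lt_neqAle eq_sym cn0.
rewrite -lee_pdivlMl//.
apply: le_trans (esumZl_le _ _); last 2 first.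
- by rewrite invr_ge0.
- by move=> i; rewrite mulr_ge0.
by apply: le_esum => i _; rewrite lee_fin mulKf.
Qed.

End scaling.

Variables (I : choiceType) (E : normedModType R[i]).
Implicit Types (u v : I -> E).

Definition lp_sum v : \bar R := \esum_(i in [set: I]) (rnorm (v i) `^ p)%:E.

Definition lp_norm v : R := fine (lp_sum v) `^ p^-1.

Lemma lp_sum_ge0 v : (0 <= lp_sum v)%E.
Proof. by apply: esum_ge0 => i _; rewrite lee_fin powR_ge0. Qed.

Lemma lp_norm_ge0 v : 0 <= lp_norm v. Proof. exact: powR_ge0. Qed.

Lemma lp_sum0 : lp_sum 0 = 0%E.
Proof. by apply: esum1 => i _; rewrite rnorm0 powR0. Qed.

Lemma lp_sumZ c v : lp_sum (c *: v) = ((complex.Re `|c| `^ p)%:E * lp_sum v)%E.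
Proof.
rewrite -esumZl; [|exact: powR_ge0|by move=> i; exact: powR_ge0].
apply: eq_esum => i _; rewrite [(c *: v) i]/(c *: v i) rnormZ powRM//.
  exact: (@rnorm_ge0 R R[i]^o).
exact: rnorm_ge0.
Qed.

Lemma lp_sum_fin v : (lp_sum v < +oo)%E -> lp_sum v \is a fin_num.
Proof. by move=> h; rewrite ge0_fin_numE// lp_sum_ge0. Qed.

Lemma lp_normK v : (lp_sum v < +oo)%E -> lp_sum v = (lp_norm v `^ p)%:E.
Proof.
move=> /lp_sum_fin h; rewrite -powRrM mulVf// powRr1 ?fineK//.
by rewrite fine_ge0// lp_sum_ge0.
Qed.

Lemma lp_norm_coord v i : (lp_sum v < +oo)%E -> rnorm (v i) <= lp_norm v.
Proof.
move=> h; rewrite leNgt; apply/negP => lt.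
have : (lp_sum v < (rnorm (v i) `^ p)%:E)%E.
  rewrite lp_normK// lte_fin; apply: gt0_ltr_powR => //.
    by rewrite nnegrE lp_norm_ge0.
  by rewrite nnegrE rnorm_ge0.
apply/negP; rewrite -leNgt; apply: esum_ge; exists [set i] => //.
by rewrite fsbig_set1.
Qed.

Lemma lp_norm_eq0 v : (lp_sum v < +oo)%E -> lp_norm v = 0 -> v = 0.
Proof.
move=> h v0; apply/funext => i; apply: rnorm_eq0.
apply/eqP; rewrite eq_le rnorm_ge0 andbT -v0; exact: lp_norm_coord.
Qed.

Lemma lp_sum_le v (M : R) : 0 <= M -> (lp_sum v <= (M `^ p)%:E)%E ->
  lp_norm v <= M.
Proof.
move=> M0 h; have hf : (lp_sum v < +oo)%E by rewrite (le_lt_trans h)// ltry.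
rewrite -(powRr1 M0) -(mulfV p_neq0) powRrM /lp_norm ge0_ler_powR ?invr_ge0//.
- by rewrite nnegrE fine_ge0// lp_sum_ge0.
- by rewrite nnegrE powR_ge0.
by rewrite -lee_fin fineK// lp_sum_fin.
Qed.

Lemma lp_normZ c v : (lp_sum v < +oo)%E ->
  lp_norm (c *: v) = complex.Re `|c| * lp_norm v.
Proof.
move=> h; have c0 : 0 <= complex.Re `|c| by exact: (@rnorm_ge0 R R[i]^o).
rewrite /lp_norm lp_sumZ fineM//; last exact: lp_sum_fin.
rewrite powRM ?powR_ge0//; last by rewrite fine_ge0// lp_sum_ge0.
by rewrite /= -powRrM mulfV// powRr1.
Qed.

Lemma lp_sumD_le u v : (lp_sum u < +oo)%E -> (lp_sum v < +oo)%E ->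
  (lp_sum (u + v)%R <= ((lp_norm u + lp_norm v)%R `^ p)%:E)%E.
Proof.
move=> hu hv.
move: (lp_norm u) (lp_norm_ge0 u) (lp_norm_eq0 hu) (lp_normK hu) => a a0 ua aE.
move: (lp_norm v) (lp_norm_ge0 v) (lp_norm_eq0 hv) (lp_normK hv) => b b0 vb bE.
have [az|an0] := eqVneq a 0; first by rewrite (ua az) az !add0r bE.
have [bz|bn0] := eqVneq b 0; first by rewrite (vb bz) bz !addr0 aE.
have ap : 0 < a by rewrite lt_neqAle eq_sym an0 a0.
have bp : 0 < b by rewrite lt_neqAle eq_sym bn0 b0.
have sp : 0 < a + b by rewrite addr_gt0.
have [t [t0 t1 tb ta]] : exists t : R,
    [/\ 0 <= t, t <= 1, t = b / (a + b) & 1 - t = a / (a + b)].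
  exists (b / (a + b)); split=> //.
  - by rewrite divr_ge0// ltW.
  - by rewrite ler_pdivrMr// mul1r lerDr.
  - by rewrite -[X in X - _](divff (lt0r_neq0 sp)) -mulrBl addrK.
pose f i := (a + b) `^ p * ((1 - t) / a `^ p) * rnorm (u i) `^ p.
pose g i := (a + b) `^ p * (t / b `^ p) * rnorm (v i) `^ p.
have f0 : 0 <= (a + b) `^ p * ((1 - t) / a `^ p).
  by rewrite !mulr_ge0 ?invr_ge0 ?powR_ge0 ?subr_ge0.
have g0 : 0 <= (a + b) `^ p * (t / b `^ p).
  by rewrite !mulr_ge0 ?invr_ge0 ?powR_ge0.
have /le_trans : (lp_sum (u + v)%R <= \esum_(i in [set: I]) ((f i)%:E + (g i)%:E))%E.
  apply: le_esum => i _; rewrite -EFinD lee_fin.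
  apply: (@le_trans _ _ ((rnorm (u i) + rnorm (v i)) `^ p)).
    by apply: ge0_ler_powR; rewrite ?nnegrE ?addr_ge0 ?rnorm_ge0 ?rnormD.
  set x := rnorm (u i); set y := rnorm (v i).
  have x0 : 0 <= x := rnorm_ge0 _; have y0 : 0 <= y := rnorm_ge0 _.
  have -> : x + y = (a + b) * ((1 - t) * (x / a) + t * (y / b)).
    rewrite ta tb; field.
    by rewrite an0 bn0 (lt0r_neq0 sp).
  rewrite powRM ?(ltW sp)//; last first.
    by rewrite addr_ge0// mulr_ge0// ?subr_ge0// divr_ge0.
  rewrite /f /g -!mulrA -mulrDr; apply: ler_wpM2l; first exact: powR_ge0.
  have := @convex_powR R p p1 (Itv01 t0 t1) (y / b) (x / a).
  rewrite !inE/= !in_itv/= !divr_ge0// => /(_ isT isT).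
  rewrite !convRE/=.
  rewrite [conv _ _ _]convRE/= /unstable.onem addrC [X in _ <= X -> _]addrC.
  suff pV (z c : R) : 0 <= z -> 0 < c -> (z / c) `^ p = (c `^ p)^-1 * z `^ p.
    by rewrite !pV.
  move=> z0 c0; rewrite powRM ?invr_ge0 ?(ltW c0)// mulrC; congr (_ * _).
  by rewrite -powR_inv1 ?(ltW c0)// -powRrM mulN1r powRN.
apply; rewrite esumD.
- rewrite !esumZl//; try by move=> i; exact: powR_ge0.
  rewrite -/(lp_sum u) -/(lp_sum v) aE bE.
  rewrite -!EFinM -EFinD lee_fin -!mulrA !mulVf ?gt_eqF ?powR_gt0//.
  by rewrite !mulr1 -mulrDr subrK mulr1.
- by move=> i _; rewrite lee_fin mulr_ge0// powR_ge0.
- by move=> i _; rewrite lee_fin mulr_ge0// powR_ge0.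
Qed.

Lemma lp_sumD_lty u v : (lp_sum u < +oo)%E -> (lp_sum v < +oo)%E ->
  (lp_sum (u + v)%R < +oo)%E.
Proof.
by move=> hu hv; rewrite (le_lt_trans (lp_sumD_le hu hv))// ltry.
Qed.

Lemma lp_normD u v : (lp_sum u < +oo)%E -> (lp_sum v < +oo)%E ->
  lp_norm (u + v) <= lp_norm u + lp_norm v.
Proof.
move=> hu hv; apply: lp_sum_le; first by rewrite addr_ge0// lp_norm_ge0.
exact: lp_sumD_le.
Qed.

End lp_sum.

Definition lp_pred (R : realType) (p : R) (p1 : 1 <= p) (I : choiceType)
    (E : normedModType R[i]) : {pred I -> E} :=
  fun v => `[< (lp_sum p v < +oo)%E >].

(* The Banach space l^p(I, E); l^p(I) is [ellp p1 I R[i]^o]. *)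
Record ellp (R : realType) (p : R) (p1 : 1 <= p) (I : choiceType)
  (E : normedModType R[i]) := Ellp {
  ellp_val :> I -> E ;
  ellp_valP : ellp_val \in @lp_pred R p p1 I E }.

Section ellp_normed.
Variables (R : realType) (p : R) (p1 : 1 <= p).
Variables (I : choiceType) (E : normedModType R[i]).

Local Notation pred := (@lp_pred R p p1 I E).
Local Notation T := (ellp p1 I E).

Lemma lp_predE v : (v \in pred) = `[< (lp_sum p v < +oo)%E >].
Proof. by []. Qed.

Lemma ellp_lty (v : T) : (lp_sum p v < +oo)%E.
Proof. by have := ellp_valP v; rewrite lp_predE => /asboolP. Qed.

Fact lp_pred_submod : subsemimod_closed pred.
Proof.
split; first split.
- by rewrite lp_predE; apply/asboolP; rewrite (lp_sum0 p1) ltry.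
- move=> u v; rewrite !lp_predE => /asboolP hu /asboolP hv; apply/asboolP.
  exact: lp_sumD_lty.
- move=> c v; rewrite !lp_predE => /asboolP hv; apply/asboolP.
  by rewrite lp_sumZ (lp_normK p1 hv) -EFinM ltry.
Qed.

HB.instance Definition _ := GRing.isSubmodClosed.Build _ _ pred lp_pred_submod.
HB.instance Definition _ := [isSub for @ellp_val R p p1 I E].
HB.instance Definition _ := [Choice of T by <:].
HB.instance Definition _ := [SubChoice_isSubLmodule of T by <:].

Lemma ellpDE (u v : T) i : (u + v) i = u i + v i. Proof. by []. Qed.

Lemma ellpZE (c : R[i]) (v : T) i : (c *: v) i = c *: v i. Proof. by []. Qed.

Definition ellp_norm (v : T) : R[i] := (lp_norm p v)%:C.

Fact ellp_normD (u v : T) : ellp_norm (u + v) <= ellp_norm u + ellp_norm v.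
Proof.
rewrite -(rmorphD (real_complex R)) lecR.
exact: lp_normD (ellp_lty u) (ellp_lty v).
Qed.

Fact ellp_normZ (c : R[i]) (v : T) : ellp_norm (c *: v) = `|c| * ellp_norm v.
Proof.
rewrite /ellp_norm (lp_normZ p1 c (ellp_lty v)) (rmorphM (real_complex R)).
by congr (_ * _); apply: RRe_real; exact: normr_real.
Qed.

Fact ellp_norm_eq0 (v : T) : ellp_norm v = 0 -> v = 0.
Proof.
move=> /complexI v0; apply/val_inj; exact: lp_norm_eq0 (ellp_lty v) v0.
Qed.

HB.instance Definition _ := Lmodule_isNormed.Build R[i] T
  ellp_normD ellp_normZ ellp_norm_eq0.

Lemma ellp_normE (v : T) : `|v| = (lp_norm p v)%:C. Proof. by []. Qed.

Lemma ellp_rnormE (v : T) : rnorm v = lp_norm p v. Proof. by []. Qed.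

Lemma ellp_coord (v : T) i : rnorm (v i) <= rnorm v.
Proof. exact: lp_norm_coord (ellp_lty v). Qed.

Lemma lp_sum_single (x : I) (e : E) :
  lp_sum p (fun i => if i == x then e else 0) = (rnorm e `^ p)%:E.
Proof.
have p0 : p != 0 by rewrite gt_eqF// (lt_le_trans _ p1).
rewrite -(@esum_set1 R I x (fun=> (rnorm e `^ p)%:E)) ?lee_fin ?powR_ge0//.
rewrite esum_mkcond; apply: eq_esum => i _; rewrite in_set1.
by case: eqP => // _; rewrite rnorm0 powR0.
Qed.

Fact single_subproof (x : I) (e : E) :
  (fun i => if i == x then e else 0) \in pred.
Proof. by rewrite lp_predE; apply/asboolP; rewrite lp_sum_single ltry. Qed.

(* The vector taking the value e at x and 0 elsewhere. *)
Definition single (x : I) (e : E) : T := Ellp (single_subproof x e).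

Lemma rnorm_single (x : I) (e : E) : rnorm (single x e) = rnorm e.
Proof.
have p0 : p != 0 by rewrite gt_eqF// (lt_le_trans _ p1).
rewrite ellp_rnormE /lp_norm lp_sum_single/= -powRrM mulfV// powRr1//.
exact: rnorm_ge0.
Qed.

Lemma single_linear (x : I) : linear (single x).
Proof.
move=> c u v; apply/val_inj/funext => i.
change (single x (c *: u + v) i = c *: single x u i + single x v i); rewrite /=.
by case: ifP => // _; rewrite scaler0 addr0.
Qed.

End ellp_normed.

(* Bounded linear operators, with the operator norm. *)
Section bop.
Variables (R : realType) (E F : normedModType R[i]).

Definition bop_pred : {pred E -> F} := fun f =>
  `[< linear f /\ exists M : R, forall v, rnorm (f v) <= M * rnorm v >].

Record bop := Bop {
  bop_val :> E -> F ;
  bop_valP : bop_val \in bop_pred }.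

Lemma bop_predP f : reflect
  (linear f /\ exists M : R, forall v, rnorm (f v) <= M * rnorm v)
  (f \in bop_pred).
Proof. exact: asboolP. Qed.

Fact bop_pred_submod : subsemimod_closed bop_pred.
Proof.
split; first split.
- apply/bop_predP; split; first by move=> c u v /=; rewrite scaler0 addr0.
  by exists 0 => v; rewrite rnorm0 mul0r.
- move=> f g /bop_predP[lf [M fM]] /bop_predP[lg [N gN]]; apply/bop_predP.
  split=> [c u v|].
    by rewrite !fctE lf lg scalerDr addrACA.
  exists (M + N) => v; rewrite mulrDl.
  by rewrite (le_trans (rnormD _ _))// lerD.
- move=> c f /bop_predP[lf [M fM]]; apply/bop_predP; split=> [a u v|].
    by rewrite !fctE lf scalerDr !scalerA mulrC.
  exists (complex.Re `|c| * M) => v; rewrite fctE rnormZ -mulrA.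
  by rewrite ler_wpM2l//; exact: (@rnorm_ge0 R R[i]^o).
Qed.

HB.instance Definition _ :=
  GRing.isSubmodClosed.Build _ _ bop_pred bop_pred_submod.
HB.instance Definition _ := [isSub for bop_val].
HB.instance Definition _ := [Choice of bop by <:].
HB.instance Definition _ := [SubChoice_isSubLmodule of bop by <:].

Fact bop_linear (T : bop) : linear T.
Proof. by have /bop_predP[] := bop_valP T. Qed.

HB.instance Definition _ (T : bop) :=
  GRing.isLinear.Build R[i] E F _ (bop_val T) (bop_linear T).

Lemma bop_bounded (T : bop) : exists M : R, forall v, rnorm (T v) <= M * rnorm v.
Proof. by have /bop_predP[] := bop_valP T. Qed.

Definition opnorm (T : bop) : R :=
  sup [set rnorm (T v) | v in [set v : E | rnorm v <= 1]].

Lemma opnorm_has_sup (T : bop) :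
  has_sup [set rnorm (T v) | v in [set v : E | rnorm v <= 1]].
Proof.
split; first by exists (rnorm (T 0)), 0 => //=; rewrite rnorm0.
have [M TM] := bop_bounded T; exists `|M| => _ [v /= v1 <-].
rewrite (le_trans (TM v))// (le_trans (ler_norm _))// normrM.
by rewrite (ger0_norm (rnorm_ge0 v)) ler_piMr.
Qed.

Lemma opnorm_ub (T : bop) v : rnorm v <= 1 -> rnorm (T v) <= opnorm T.
Proof.
move=> v1; apply: ub_le_sup; first by have [] := opnorm_has_sup T.
by exists v.
Qed.

Lemma opnorm_le (T : bop) (M : R) :
  (forall v, rnorm v <= 1 -> rnorm (T v) <= M) -> opnorm T <= M.
Proof.
move=> TM; apply: ge_sup; first by have [] := opnorm_has_sup T.
by move=> _ [v /= v1 <-]; exact: TM.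
Qed.

Lemma opnorm_ge0 (T : bop) : 0 <= opnorm T.
Proof.
by rewrite (le_trans (rnorm_ge0 (T 0)))// opnorm_ub// rnorm0.
Qed.

Lemma opnormP (T : bop) v : rnorm (T v) <= opnorm T * rnorm v.
Proof.
have [v0|vn0] := eqVneq (rnorm v) 0.
  by rewrite (rnorm_eq0 v0) linear0 !rnorm0 mulr0.
have vp : 0 < rnorm v by rewrite lt_neqAle eq_sym vn0 rnorm_ge0.
rewrite -ler_pdivrMr//.
have cE : complex.Re `|((rnorm v)^-1)%:C| = (rnorm v)^-1.
  by rewrite ger0_norm ?ler0c ?invr_ge0 ?rnorm_ge0.
have := @opnorm_ub T (((rnorm v)^-1)%:C *: v).
rewrite linearZ !rnormZ cE mulVf//.
by rewrite mulrC; apply.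
Qed.

Definition bop_norm (T : bop) : R[i] := (opnorm T)%:C.

Fact bop_normD (S T : bop) : bop_norm (S + T) <= bop_norm S + bop_norm T.
Proof.
rewrite -(rmorphD (real_complex R)) lecR; apply: opnorm_le => v v1.
by rewrite (le_trans (rnormD _ _))// lerD// opnorm_ub.
Qed.

Fact bop_norm_eq0 (T : bop) : bop_norm T = 0 -> T = 0.
Proof.
move=> /complexI T0; apply/val_inj/funext => v; apply: rnorm_eq0.
apply/eqP; rewrite eq_le rnorm_ge0 andbT.
by rewrite (le_trans (opnormP T v))// T0 mul0r.
Qed.

Fact bop_normZ (c : R[i]) (T : bop) : bop_norm (c *: T) = `|c| * bop_norm T.
Proof.
have cE : `|c| = (complex.Re `|c|)%:C by rewrite RRe_real// normr_real.
have c0 : 0 <= complex.Re `|c| by exact: (@rnorm_ge0 R R[i]^o).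
rewrite /bop_norm cE -(rmorphM (real_complex R)); congr (_ %:C).
apply/eqP; rewrite eq_le; apply/andP; split.
  by apply: opnorm_le => v v1; rewrite rnormZ ler_wpM2l// opnorm_ub.
have [->|cn0] := eqVneq (complex.Re `|c|) 0; first by rewrite mul0r opnorm_ge0.
have cp : 0 < complex.Re `|c| by rewrite lt_neqAle eq_sym cn0.
rewrite -ler_pdivlMl//; apply: opnorm_le => v v1.
rewrite ler_pdivlMl// -rnormZ.
exact: (@opnorm_ub (c *: T)).
Qed.

HB.instance Definition _ := Lmodule_isNormed.Build R[i] bop
  bop_normD bop_normZ bop_norm_eq0.

Lemma bop_normE (T : bop) : `|T| = (opnorm T)%:C. Proof. by []. Qed.

(* The library closure is therefore the operator-norm closure. *)
Lemma bop_closureP (A : set bop) (T : bop) : closure A T <->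
  forall e : R, 0 < e -> exists2 S, A S & opnorm (T - S) < e.
Proof.
split=> [clA e e0|H B /nbhs_ballP[e /= e0 eB]].
  have e0C : 0 < e%:C by rewrite ltcR.
  have [S [AS]] := clA _ (nbhsx_ballx T _ e0C).
  by rewrite -ball_normE/= bop_normE ltcR; exists S.
have eR : e = (complex.Re e)%:C by rewrite RRe_real// gtr0_real.
have [|S AS TS] := H (complex.Re e); first by rewrite -ltcR -eR.
exists S; split=> //; apply: eB.
by rewrite -ball_normE/= bop_normE eR ltcR.
Qed.

End bop.

Section composition.
Variables (R : realType) (E F G : normedModType R[i]).

Fact bcomp_subproof (S : bop F G) (T : bop E F) :
  (fun v => S (T v)) \in @bop_pred R E G.
Proof.
apply/bop_predP; split; first by move=> c u v; rewrite !linearP.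
exists (opnorm S * opnorm T) => v; rewrite -mulrA.
by rewrite (le_trans (opnormP S _))// ler_wpM2l ?opnorm_ge0 ?opnormP.
Qed.

Definition bcomp (S : bop F G) (T : bop E F) : bop E G :=
  Bop (bcomp_subproof S T).

End composition.

Section entries.
Variables (R : realType) (p : R) (p1 : 1 <= p).
Variables (I : choiceType) (E : normedModType R[i]).

Fact entry_subproof (T : bop (ellp p1 I E) (ellp p1 I E)) (x y : I) :
  (fun e => T (single p1 y e) x) \in @bop_pred R E E.
Proof.
apply/bop_predP; split; first by move=> c u v; rewrite single_linear linearP.
exists (opnorm T) => v; rewrite -(rnorm_single p1 y v).
by rewrite (le_trans (ellp_coord _ _))// opnormP.
Qed.

Definition entry (T : bop (ellp p1 I E) (ellp p1 I E)) (x y : I) : bop E E :=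
  Bop (entry_subproof T x y).

End entries.

(* On l^p(I) an entry is an operator on C, namely multiplication by the scalar
   (T delta_y)(x). *)
Lemma entry_scalar (R : realType) (p : R) (p1 : 1 <= p) (I : choiceType)
    (T : bop (ellp p1 I R[i]^o) (ellp p1 I R[i]^o)) (x y : I) (c : R[i]) :
  entry T x y c = c * T (single p1 y (1 : R[i]^o)) x.
Proof.
have cE : (c : R[i]^o) = c *: (1 : R[i]^o) by rewrite /GRing.scale/= mulr1.
by rewrite [in LHS]cE linearZ.
Qed.

Section tensor_vectors.
Variables (R : realType) (p : R) (p1 : 1 <= p) (I J : choiceType).

Fact vtensor_subproof (u : ellp p1 I R[i]^o) (v : ellp p1 J R[i]^o) :
  (fun k => u k.1 * v k.2) \in @lp_pred R p p1 (I * J)%type R[i]^o.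
Proof.
rewrite lp_predE; apply/asboolP; rewrite /lp_sum.
have -> : [set: I * J] = [set: I] `*`` (fun=> [set: J]).
  by apply/seteqP; split.
have uvE i j : rnorm (u i * v j : R[i]^o) `^ p =
    rnorm (u i) `^ p * rnorm (v j) `^ p.
  by rewrite -powRM ?rnorm_ge0//; congr (_ `^ p); exact: rnormZ.
rewrite -(@esum_esum R I J setT (fun=> setT)
  (fun i j => (rnorm (u i * v j : R[i]^o) `^ p)%:E)); last first.
  by move=> i j _ _; rewrite lee_fin powR_ge0.
rewrite (@eq_esum _ _ _ _
    (fun i => (lp_norm p v `^ p * rnorm (u i) `^ p)%:E)); last first.
  move=> i _; under eq_esum do rewrite uvE.
  rewrite esumZl; [|exact: powR_ge0|by move=> j; exact: powR_ge0].
  by rewrite -/(lp_sum p v) (lp_normK p1 (ellp_lty v)) mulrC EFinM.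
rewrite esumZl; [|exact: powR_ge0|by move=> j; exact: powR_ge0].
by rewrite -/(lp_sum p u) (lp_normK p1 (ellp_lty u)) -EFinM ltry.
Qed.

Definition vtensor (u : ellp p1 I R[i]^o) (v : ellp p1 J R[i]^o) :
  ellp p1 (I * J)%type R[i]^o := Ellp (vtensor_subproof u v).

End tensor_vectors.

Section coarse_geometry.
Variable R : realType.
Implicit Types X Y : metricType R.

Definition bounded_geometry X : Prop :=
  forall r : R, 0 <= r -> exists N : nat,
    forall x : X, ([set y | mdist x y <= r] #<= `I_N)%card.

Definition uniformly_expansive X Y (f : X -> Y) : Prop :=
  forall r : R, 0 < r -> exists2 s : R, 0 < s &
    forall x1 x2, mdist x1 x2 <= r -> mdist (f x1) (f x2) <= s.

Definition close_maps (X : Type) Y (f g : X -> Y) : Prop :=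
  exists2 c : R, 0 < c & forall x, mdist (f x) (g x) <= c.

Definition coarse_equivalence X Y (f : X -> Y) : Prop :=
  uniformly_expansive f /\ exists g : Y -> X,
    [/\ uniformly_expansive g, close_maps (f \o g) id &
        close_maps (g \o f) id].

Definition coarsely_equivalent X Y : Prop :=
  exists f : X -> Y, coarse_equivalence f.

Definition bijectively_coarsely_equivalent X Y : Prop :=
  exists f : X -> Y, coarse_equivalence f /\ bijective f.

End coarse_geometry.

Section operator_algebras.
Variable R : realType.
Implicit Types E F : normedModType R[i].

Definition is_subalgebra E (A : set (bop E E)) : Prop :=
  [/\ A 0, forall (c : R[i]) S T, A S -> A T -> A (c *: S + T) &
      forall S T, A S -> A T -> A (bcomp S T)].

(* phi is only constrained on A. *)
Definition isometrically_isomorphic E F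
    (A : set (bop E E)) (B : set (bop F F)) : Prop :=
  exists phi : bop E E -> bop F F,
    [/\ set_bij A B phi,
        forall (c : R[i]) S T, A S -> A T ->
          phi (c *: S + T) = c *: phi S + phi T,
        forall S T, A S -> A T -> phi (bcomp S T) = bcomp (phi S) (phi T) &
        forall S, A S -> `|phi S| = `|S|].

Definition span_fam (V : lmodType R[i]) n (e : 'I_n -> V) : set V :=
  [set \sum_i c i *: e i | c in [set: 'I_n -> R[i]]].

Definition lin_span (V : lmodType R[i]) (A : set V) : set V :=
  [set v | exists n (e : 'I_n -> V), (forall i, A (e i)) /\ span_fam e v].

Definition finite_dimensional (V : lmodType R[i]) (A : set V) : Prop :=
  exists n (e : 'I_n -> V), A = span_fam e.

Definition rank_le E F (T : bop E F) (N : nat) : Prop :=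
  exists e : 'I_N -> F, range T `<=` span_fam e.

Definition compact_operator E F (T : bop E F) : Prop :=
  precompact (T @` [set v | `|v| <= 1]).

End operator_algebras.

Section roe_algebras.
Variables (R : realType) (p : R) (p1 : 1 <= p).
Local Notation ell I := (ellp p1 I R[i]^o).
Local Notation B E := (bop E E).

(* M_n(C), acting on the first n coordinates. *)
Definition corner_matrices (n : nat) : set (B (ell nat)) :=
  [set T : B (ell nat) | exists M : 'M[R[i]]_n, forall v : ell nat,
    (forall i : 'I_n, T v i = \sum_(j < n) M i j * v j) /\
    (forall i : nat, (n <= i)%N -> T v i = 0)].

Definition Mbar_infty : set (B (ell nat)) :=
  closure (\bigcup_n corner_matrices n).

(* T = a (x) b, as an operator on l^p(I x J). *)
Definition is_op_tensor (I J : choiceType) (a : B (ell I)) (b : B (ell J))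
    (T : B (ell (I * J)%type)) : Prop :=
  forall (u : ell I) (v : ell J), T (vtensor u v) = vtensor (a u) (b v).

Definition alg_tensor (I J : choiceType) (A : set (B (ell I)))
    (A' : set (B (ell J))) : set (B (ell (I * J)%type)) :=
  closure (lin_span [set T | exists a b, [/\ A a, A' b & is_op_tensor a b T]]).

Section over_a_space.
Variable X : metricType R.

Definition propagation (E : normedModType R[i]) (T : B (ellp p1 X E)) : \bar R :=
  ereal_sup [set (mdist xy.1 xy.2)%:E |
    xy in [set xy : X * X | entry T xy.1 xy.2 != 0]].

Definition finite_propagation (E : normedModType R[i]) (T : B (ellp p1 X E)) :=
  (propagation T < +oo)%E.

Definition Cu : set (B (ell X)) := [set T | finite_propagation T].
Definition Bu : set (B (ell X)) := closure Cu.

(* [None] stands for S = N and [Some n] for S = {1, .., n.+1}: the finite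
   fibres are nonempty. *)
Definition fibre (s : option nat) : choiceType :=
  if s is Some n then 'I_n.+1 else nat.

Definition locally_compact_op (E : normedModType R[i]) (T : B (ellp p1 X E)) :=
  forall x y, compact_operator (entry T x y).

Definition algebraic_roe_type (s : option nat)
    (A : set (B (ellp p1 X (ell (fibre s))))) : Prop :=
  [/\ is_subalgebra A,
      forall T, A T -> locally_compact_op T /\ finite_propagation T &
      forall T, finite_propagation T ->
        (exists N, forall x y, rank_le (entry T x y) N) -> A T].

Definition roe_type (s : option nat)
    (A : set (B (ellp p1 X (ell (fibre s))))) : Prop :=
  exists2 A0, algebraic_roe_type A0 & A = closure A0.

Definition UC : set (B (ellp p1 X (ell nat))) :=
  [set T | finite_propagation T /\
           exists N, forall x y, rank_le (entry T x y) N].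
Definition UB : set (B (ellp p1 X (ell nat))) := closure UC.

Definition CX : set (B (ellp p1 X (ell nat))) :=
  [set T | finite_propagation T /\ forall x y, Mbar_infty (entry T x y)].
Definition BX : set (B (ellp p1 X (ell nat))) := closure CX.

Definition Cs : set (B (ellp p1 X (ell nat))) :=
  [set T | finite_propagation T /\
    exists (ET : set (ell nat)) (P : B (ell nat)),
      [/\ finite_dimensional ET, bcomp P P = P, range P = ET &
          forall x y, entry T x y = bcomp P (bcomp (entry T x y) P)]].
Definition Bs : set (B (ellp p1 X (ell nat))) := closure Cs.

End over_a_space.
End roe_algebras.

Arguments Mbar_infty {R p} p1 _.
Arguments Cu {R p} p1 X _.
Arguments Bu {R p} p1 X _.
Arguments UC {R p} p1 X _.
Arguments UB {R p} p1 X _.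
Arguments CX {R p} p1 X _.
Arguments BX {R p} p1 X _.
Arguments Cs {R p} p1 X _.
Arguments Bs {R p} p1 X _.

(* Main.v *)
Require Import Defs.
From mathcomp Require Import all_boot all_order all_algebra.
From mathcomp Require Import all_classical all_reals all_analysis.
From mathcomp Require Import complex ring.

Set Implicit Arguments.
Unset Strict Implicit.
Unset Printing Implicit Defensive.

Import Order.TTheory GRing.Theory Num.Theory.
Import numFieldNormedType.Exports.
Local Open Scope classical_set_scope.
Local Open Scope ring_scope.
Local Open Scope complex_scope.

(* Rigidity.  Rank one corners are preserved by an isometric isomorphism phi, so
   the image of a matrix unit e_oo has the form v (x) w; then
   U xi = phi (xi (x) e_o) v is an isometry intertwining T and phi T.  For p <> 2 the
   equality case of Clarkson's inequalities forces U to preserve disjointness of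
   supports (Lamperti), hence U sends each basis vector to a unimodular multiple of
   a basis vector, and phi preserves the moduli of matrix entries along a
   bijection of the index sets.  Testing this bijection on partial
   translations gives expansiveness; testing it on operators that move points
   inside the fibres gives closeness of the compositions to the identities.
   Converse.  A coarse equivalence f is replaced by two maps X -> Y <- Y with the
   same image and uniformly finite fibres; enumerating the fibres yields a bijection
   X x nat -> Y x nat that involves only finitely many maps on the second factor,
   and conjugation by the corresponding permutation operator preserves each algebra. *)

(** * Operators on l^p spaces *)

(** Of the spatial form of [phi] only the moduli of coefficients are kept. The geometric part
    therefore forgets [phi] and works with [coef_match]: a bijection of index sets along which every
    operator has a partner with equal moduli. Uniform estimates arise because one operator tests
    infinitely many pairs of points at once. Bounded geometry covers all pairs at distance at most r
    by finitely many partial translations, so finitely many operators suffice for each r. The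
    obstacle is stabilisation: the bijection acts on X x S and may scatter one fibre. Compactness or
    decay in the fibre direction leaves finitely many relevant points per fibre, so a worst one can
    be selected in each, and one operator tests all the selections together. The algebras differ in
    which fibre moves they contain; [roe_like] records exactly what is used. In the converse,
    finiteness of the list of maps on the second factor matters because uniform rank bounds, entries
    in [Mbar_infty] and a common finite-dimensional corner all survive finite sums of products with
    these maps. *)

Section normed_basics.
Variable R : realType.
Implicit Types E F G : normedModType R[i].

Lemma rnormN E (v : E) : rnorm (- v) = rnorm v.
Proof. by rewrite /rnorm normrN. Qed.

Lemma rnormM (a b : R[i]) : rnorm (a * b : R[i]^o) = rnorm (a : R[i]^o) * rnorm (b : R[i]^o).
Proof. exact: (@rnormZ R R[i]^o). Qed.

Lemma rnorm1 : rnorm (1 : R[i]^o) = 1.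
Proof. by rewrite /rnorm normr1. Qed.

Lemma rnorm_gt0 E (v : E) : v != 0 -> 0 < rnorm v.
Proof.
move=> v0; rewrite lt_neqAle rnorm_ge0 andbT eq_sym.
by apply: contra_neq v0; exact: rnorm_eq0.
Qed.

Lemma rnorm_small_eq0 E (v : E) : (forall e : R, 0 < e -> rnorm v <= e) -> v = 0.
Proof.
move=> h; apply: rnorm_eq0; apply/eqP; rewrite eq_le rnorm_ge0 andbT.
by apply/ler_addgt0Pr => e e0; rewrite add0r h.
Qed.

Lemma bop_ext E F (S T : bop E F) : (forall v, S v = T v) -> S = T.
Proof. by move=> h; apply/val_inj/funext. Qed.

Lemma bopB E F (T : bop E F) u v : T (u - v) = T u - T v.
Proof. exact: linearB. Qed.
Lemma bopD E F (T : bop E F) u v : T (u + v) = T u + T v.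
Proof. exact: linearD. Qed.
Lemma bopZ E F (T : bop E F) c v : T (c *: v) = c *: T v.
Proof. exact: linearZ. Qed.
Lemma bop0 E F (T : bop E F) : T 0 = 0.
Proof. exact: linear0. Qed.

Lemma bop_sumr E F (T : bop E F) (J : Type) (s : seq J) (f : J -> E) :
  T (\sum_(j <- s) f j) = \sum_(j <- s) T (f j).
Proof.
elim: s => [|j s ih]; first by rewrite !big_nil bop0.
by rewrite !big_cons bopD ih.
Qed.

Lemma opnormD E F (S T : bop E F) : opnorm (S + T) <= opnorm S + opnorm T.
Proof. exact: (@rnormD R (bop E F)). Qed.

Lemma opnormZ E F c (T : bop E F) : opnorm (c *: T) = rnorm (c : R[i]^o) * opnorm T.
Proof. exact: (@rnormZ R (bop E F)). Qed.

Lemma opnorm_le_bound E F (T : bop E F) (M : R) : 0 <= M ->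
  (forall v, rnorm (T v) <= M * rnorm v) -> opnorm T <= M.
Proof.
move=> M0 h; apply: opnorm_le => v v1.
by rewrite (le_trans (h v))// ler_piMr.
Qed.

Lemma opnorm_bcomp E F G (S : bop F G) (T : bop E F) :
  opnorm (bcomp S T) <= opnorm S * opnorm T.
Proof.
apply: opnorm_le_bound; first by rewrite mulr_ge0// opnorm_ge0.
move=> v; rewrite -mulrA (le_trans (opnormP S _))//.
by rewrite ler_wpM2l ?opnorm_ge0 ?opnormP.
Qed.

Lemma bcompDl E F G (S S' : bop F G) (T : bop E F) :
  bcomp (S + S') T = bcomp S T + bcomp S' T.
Proof. by apply: bop_ext. Qed.

Lemma bcompBl E F G (S S' : bop F G) (T : bop E F) :
  bcomp (S - S') T = bcomp S T - bcomp S' T.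
Proof. by apply: bop_ext. Qed.

Lemma bcompDr E F G (S : bop F G) (T T' : bop E F) :
  bcomp S (T + T') = bcomp S T + bcomp S T'.
Proof. by apply: bop_ext => v; exact: bopD. Qed.

Lemma bcompBr E F G (S : bop F G) (T T' : bop E F) :
  bcomp S (T - T') = bcomp S T - bcomp S T'.
Proof. by apply: bop_ext => v; exact: bopB. Qed.

Lemma bcompZl E F G c (S : bop F G) (T : bop E F) :
  bcomp (c *: S) T = c *: bcomp S T.
Proof. by apply: bop_ext. Qed.

Lemma bcompZr E F G c (S : bop F G) (T : bop E F) :
  bcomp S (c *: T) = c *: bcomp S T.
Proof. by apply: bop_ext => v; exact: bopZ. Qed.

Lemma bcomp0l E F G (T : bop E F) : bcomp (0 : bop F G) T = 0.
Proof. by apply: bop_ext. Qed.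

Lemma bcomp0r E F G (S : bop F G) : bcomp S (0 : bop E F) = 0.
Proof. by apply: bop_ext => v; exact: bop0. Qed.

Lemma bcomp_sumr E F G (S : bop F G) (J : Type) (s : seq J) (T : J -> bop E F) :
  bcomp S (\sum_(j <- s) T j) = \sum_(j <- s) bcomp S (T j).
Proof.
elim: s => [|j s ih]; first by rewrite !big_nil bcomp0r.
by rewrite !big_cons bcompDr ih.
Qed.

Lemma bcomp_suml E F G (T : bop E F) (J : Type) (s : seq J) (S : J -> bop F G) :
  bcomp (\sum_(j <- s) S j) T = \sum_(j <- s) bcomp (S j) T.
Proof.
elim: s => [|j s ih]; first by rewrite !big_nil bcomp0l.
by rewrite !big_cons bcompDl ih.
Qed.

Lemma bop_sumE E F (J : Type) (s : seq J) (T : J -> bop E F) v :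
  (\sum_(j <- s) T j : bop E F) v = \sum_(j <- s) T j v.
Proof.
elim: s => [|j s ih]; first by rewrite !big_nil.
by rewrite !big_cons -ih.
Qed.

Lemma bopDE E F (S T : bop E F) v : (S + T) v = S v + T v.
Proof. by []. Qed.
Lemma bopNE E F (T : bop E F) v : (- T) v = - T v.
Proof. by []. Qed.
Lemma bopZE E F (T : bop E F) c v : (c *: T) v = c *: T v.
Proof. by []. Qed.

Fact mkbop_subproof E F (f : E -> F) (lf : linear f) (M : R)
  (fM : forall v, rnorm (f v) <= M * rnorm v) : f \in @bop_pred R E F.
Proof. by apply/bop_predP; split=> //; exists M. Qed.

Definition mkbop E F (f : E -> F) (lf : linear f) (M : R)
  (fM : forall v, rnorm (f v) <= M * rnorm v) : bop E F :=
  Bop (mkbop_subproof lf fM).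

Lemma opnorm_mkbop E F (f : E -> F) (lf : linear f) (M : R)
  (fM : forall v, rnorm (f v) <= M * rnorm v) : 0 <= M -> opnorm (mkbop lf fM) <= M.
Proof. by move=> M0; apply: opnorm_le_bound. Qed.

End normed_basics.

Section lp_basics.
Variables (R : realType) (p : R) (p1 : 1 <= p).

Lemma lp_exp_gt0 : 0 < p. Proof. exact: lt_le_trans p1. Qed.
Lemma lp_exp_neq0 : p != 0. Proof. by rewrite gt_eqF// lp_exp_gt0. Qed.

Section one_space.
Variables (I : choiceType) (E : normedModType R[i]).
Implicit Types u v : ellp p1 I E.

Lemma ellp_ext u v : (forall i, u i = v i) -> u = v.
Proof. by move=> h; apply/val_inj/funext. Qed.

Lemma ellpNE v i : (- v) i = - v i. Proof. by []. Qed.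

Lemma ellp_sumE (J : Type) (s : seq J) (f : J -> ellp p1 I E) i :
  (\sum_(j <- s) f j) i = \sum_(j <- s) f j i.
Proof.
elim: s => [|j s ih]; first by rewrite !big_nil.
by rewrite !big_cons -ih.
Qed.

Lemma ellp_mkP (f : I -> E) : (@lp_sum R p I E f < +oo)%E -> f \in @lp_pred R p p1 I E.
Proof. by move=> h; rewrite lp_predE; apply/asboolP. Qed.

Definition mkellp (f : I -> E) (h : (@lp_sum R p I E f < +oo)%E) : ellp p1 I E :=
  Ellp (ellp_mkP h).

Lemma ellp_sumK v : lp_sum p (v : I -> E) = (rnorm v `^ p)%:E.
Proof. exact: lp_normK (ellp_lty v). Qed.

Lemma singleE (i : I) (e : E) (j : I) : single p1 i e j = if j == i then e else 0.
Proof. by []. Qed.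

Lemma singleZ c (i : I) (e : E) : single p1 i (c *: e) = c *: single p1 i e.
Proof. by apply: ellp_ext => j; rewrite ellpZE !singleE; case: ifP; rewrite ?scaler0. Qed.

Definition disjoint_supp u v := forall i, u i = 0 \/ v i = 0.

Lemma lp_sum_disjoint u v : disjoint_supp u v ->
  (lp_sum p (u + v)%R = lp_sum p u + lp_sum p v)%E.
Proof.
move=> uv; rewrite /lp_sum -esumD; last 2 first.
- by move=> i _; rewrite lee_fin powR_ge0.
- by move=> i _; rewrite lee_fin powR_ge0.
apply: eq_esum => i _; rewrite ellpDE.
by have [->|->] := uv i; rewrite rnorm0 powR0 ?lp_exp_neq0// ?add0r ?add0e ?addr0 ?adde0.
Qed.

Lemma rnorm_disjoint u v : disjoint_supp u v ->
  rnorm (u + v) `^ p = rnorm u `^ p + rnorm v `^ p.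
Proof.
by move=> /lp_sum_disjoint; rewrite !ellp_sumK -EFinD => -[].
Qed.

(** A finite partial sum of the p-th powers exceeds the p-th power of the norm minus e^p. The
    truncation and the remainder have disjoint supports, so their p-th powers add and the remainder
    is below e. *)
Lemma ellp_approx v (e : R) : 0 < e ->
  exists s : seq I, uniq s /\ rnorm (v - \sum_(i <- s) single p1 i (v i)) < e.
Proof.
move=> e0; have ep : 0 < e `^ p by rewrite powR_gt0.
have : (lp_sum p v - (e `^ p)%:E < lp_sum p v)%E.
  by rewrite ellp_sumK -EFinD lte_fin ltrBlDr ltrDl.
move=> /ereal_sup_gt[_ [F [finF _] <-]] ltF.
pose s := finmap.enum_fset (fset_set F).
have sE i : (i \in s) = (i \in F) by exact: in_fset_set.
have us : uniq s by exact: finmap.fset_uniq.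
exists s; split=> //.
set w := \sum_(i <- _) _.
have wE i : w i = if i \in s then v i else 0.
  rewrite /w ellp_sumE; case: ifPn => iF; last first.
    rewrite big_seq big1// => j jF; rewrite singleE; case: eqP => // ij.
    by rewrite ij jF in iF.
  rewrite (bigD1_seq i)// singleE eqxx big1 => [|j ji]; first exact: addr0.
  by rewrite singleE eq_sym (negbTE ji).
have disj : disjoint_supp (v - w) w.
  by move=> i; rewrite ellpDE [(- w) i]/(- w i) !wE; case: ifP => _; [left; rewrite subrr|right].
have := rnorm_disjoint disj; rewrite subrK => nE.
have wF : (\sum_(i \in F) (rnorm (v i) `^ p)%:E <= lp_sum p w)%E.
  apply: esum_ge; exists F; first by split.
  apply: lee_fsum => // i Fi; rewrite wE sE mem_set//.
have : (rnorm v `^ p - e `^ p < rnorm w `^ p)%R.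
  have := lt_le_trans ltF wF.
  by rewrite (ellp_sumK v) (ellp_sumK w) -EFinB lte_fin.
move=> h; rewrite ltNge; apply/negP => le_e.
have : e `^ p <= rnorm (v - w) `^ p.
  by apply: ge0_ler_powR => //; rewrite ?nnegrE ?rnorm_ge0 ?(ltW lp_exp_gt0) ?(ltW e0).
by rewrite leNgt -(ltrD2r (rnorm w `^ p)) -nE -ltrBlDl h.
Qed.

(** Truncations of [v] are killed by [T], so [T v] equals [T] of an arbitrarily small remainder; no
    infinite sum of vectors is formed. *)
Lemma bop_single_eq0 (F : normedModType R[i]) (T : bop (ellp p1 I E) F) v :
  (forall i, T (single p1 i (v i)) = 0) -> T v = 0.
Proof.
move=> T0; apply: rnorm_small_eq0 => e e0.
have T1 : 0 < opnorm T + 1 by rewrite ltr_wpDl// opnorm_ge0.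
have [s [_ hs]] := ellp_approx v (divr_gt0 e0 T1).
have -> : T v = T (v - \sum_(i <- s) single p1 i (v i)).
  rewrite bopB linear_sum/= big1 ?subr0// => i _.
rewrite (le_trans (opnormP _ _))//.
move: hs; rewrite ltr_pdivlMr// => /ltW; apply: le_trans.
rewrite mulrC ler_wpM2l ?rnorm_ge0// lerDl//.
Qed.

Lemma bop_single_ext (F : normedModType R[i]) (S T : bop (ellp p1 I E) F) :
  (forall i e, S (single p1 i e) = T (single p1 i e)) -> S = T.
Proof.
move=> ST; apply: bop_ext => v; apply/eqP; rewrite -subr_eq0; apply/eqP.
apply: (@bop_single_eq0 _ (S - T)) => i.
by change (S (single p1 i (v i)) - T (single p1 i (v i)) = 0); rewrite ST subrr.
Qed.

End one_space.
End lp_basics.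

(** * Partial injections and permutations as operators *)

Section partial_injections.
Variables (R : realType) (p : R) (p1 : 1 <= p).

(** The map points backwards, from output index to input index, so that the operator is v |-> v o h,
    with value 0 where [h] is undefined. Injectivity makes this a contraction. *)
Definition partial_inj (I J : Type) (h : J -> option I) : Prop :=
  forall j j' i, h j = Some i -> h j' = Some i -> j = j'.

Section pinj.
Variables (I J : choiceType) (E : normedModType R[i]).
Variables (h : J -> option I).

Definition pinj_fun (v : I -> E) (j : J) : E := oapp v 0 (h j).

Lemma lp_sum_pinj (hinj : partial_inj h) (v : I -> E) :
  (lp_sum p (pinj_fun v) <= lp_sum p v)%E.
Proof.
(* With value 0 at [None], summing over [option I] turns the partial map into an injective
   reindexing on the set where it is defined. *)
pose G (o : option I) : \bar R := (rnorm (oapp v 0 o) `^ p)%:E.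
have G0 o : (0 <= G o)%E by rewrite lee_fin powR_ge0.
have -> : lp_sum p (pinj_fun v) = \esum_(j in [set j | h j != None]) G (h j).
  rewrite /lp_sum [RHS]esum_mkcond; apply: eq_esum => j _.
  rewrite /pinj_fun /G; case: ifPn => // /negP hj.
  suff -> : h j = None by rewrite rnorm0 powR0// (lp_exp_neq0 p1).
  by apply/eqP; apply: contra_notT hj => hj; rewrite inE.
rewrite -(@esum_image _ _ _ [set j | h j != None] h G); last first.
  move=> j j'; rewrite !inE /=; case hj : (h j) => [i|]// _.
  by case hj' : (h j') => [i'|]// _ [ii']; apply: hinj hj _; rewrite hj' ii'.
have -> : lp_sum p v = \esum_(o in [set Some i | i in [set: I]]) G o.
  by rewrite esum_image// => i j _ _ [].
rewrite esum_mkcond [leRHS]esum_mkcond; apply: le_esum => o _.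
case: ifPn => [|_]; last by case: ifP.
rewrite inE => -[j hj <-]; rewrite ifT// inE.
by move: hj => /=; case: (h j) => // i _; exists i.
Qed.

Lemma pinj_fun_lty (hinj : partial_inj h) (v : ellp p1 I E) :
  (lp_sum p (pinj_fun v) < +oo)%E.
Proof. exact: le_lt_trans (lp_sum_pinj hinj v) (ellp_lty v). Qed.

Definition pinj_vec (hinj : partial_inj h) (v : ellp p1 I E) : ellp p1 J E :=
  mkellp p1 (pinj_fun_lty hinj v).

Lemma pinj_linear (hinj : partial_inj h) : linear (pinj_vec hinj).
Proof.
move=> c u v; apply: ellp_ext => j; rewrite ellpDE ellpZE /= /pinj_fun.
by case: (h j) => [i|]//=; rewrite scaler0 addr0.
Qed.

Lemma pinj_bounded (hinj : partial_inj h) (v : ellp p1 I E) :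
  rnorm (pinj_vec hinj v) <= 1 * rnorm v.
Proof.
rewrite mul1r [leLHS]ellp_rnormE; apply: lp_sum_le => //; first exact: rnorm_ge0.
by rewrite -ellp_sumK; exact: lp_sum_pinj.
Qed.

Definition pinj (hinj : partial_inj h) : bop (ellp p1 I E) (ellp p1 J E) :=
  mkbop (pinj_linear hinj) (pinj_bounded hinj).

Lemma pinjE (hinj : partial_inj h) (v : ellp p1 I E) j :
  pinj hinj v j = oapp v 0 (h j).
Proof. by []. Qed.

Lemma pinj_single (hinj : partial_inj h) i (e : E) j :
  pinj hinj (single p1 i e) j = if h j == Some i then e else 0.
Proof. by rewrite pinjE; case: (h j). Qed.

Lemma pinj_le (hinj : partial_inj h) (v : ellp p1 I E) :
  rnorm (pinj hinj v) <= rnorm v.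
Proof. by rewrite -[leRHS]mul1r; exact: pinj_bounded. Qed.

End pinj.

Section permutations.
Variables (I J : choiceType) (E : normedModType R[i]).
Variables (s : I -> J) (s' : J -> I) (sK : cancel s s') (sK' : cancel s' s).

Lemma partial_inj_some : partial_inj (fun j => Some (s' j)).
Proof. by move=> j j' i [<-] [/(can_inj sK')]. Qed.

Definition perm_op : bop (ellp p1 I E) (ellp p1 J E) := pinj E partial_inj_some.

Lemma perm_opE v j : perm_op v j = v (s' j). Proof. by []. Qed.

Lemma perm_op_single i (e : E) : perm_op (single p1 i e) = single p1 (s i) e.
Proof.
apply: ellp_ext => j; rewrite perm_opE !singleE.
by congr (if _ then _ else _); apply/eqP/eqP => [<-|->].
Qed.

End permutations.

Lemma perm_opK (I J : choiceType) (E : normedModType R[i])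
  (s : I -> J) (s' : J -> I) (sK : cancel s s') (sK' : cancel s' s) :
  cancel (perm_op E sK') (perm_op E sK).
Proof. by move=> v; apply: ellp_ext => i; rewrite !perm_opE sK. Qed.

End partial_injections.

(** * The isometry between l^p(X, l^p(S)) and l^p(X x S) *)

Section curry.
Variables (R : realType) (p : R) (p1 : 1 <= p) (X S : choiceType).
Variable (E : normedModType R[i]).
Local Notation V := (ellp p1 X (ellp p1 S E)).
Local Notation W := (ellp p1 (X * S)%type E).

Lemma lp_sum_curry (v : V) :
  lp_sum p (fun k : X * S => v k.1 k.2) = lp_sum p (v : X -> ellp p1 S E).
Proof.
rewrite /lp_sum.
have -> : [set: X * S] = [set: X] `*`` (fun=> [set: S]).
  by apply/seteqP; split.
rewrite -(@esum_esum R X S setT (fun=> setT)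
  (fun i j => (rnorm (v i j : E) `^ p)%:E)); last first.
  by move=> i j _ _; rewrite lee_fin powR_ge0.
by apply: eq_esum => i _; rewrite -ellp_sumK.
Qed.

Lemma lp_sum_slice (w : W) x : (lp_sum p (fun s => w (x, s)) < +oo)%E.
Proof.
apply: le_lt_trans (ellp_lty w).
pose h (s : S) : option (X * S) := Some (x, s).
have hi : partial_inj h by move=> s s' _ [<-] [].
exact: (@lp_sum_pinj R p p1 _ _ E h hi w).
Qed.

Lemma lp_sum_uncurry (w : W) :
  lp_sum p (fun x => mkellp p1 (lp_sum_slice w x) : ellp p1 S E) = lp_sum p (w : X * S -> E).
Proof.
rewrite {2}/lp_sum.
have -> : [set: X * S] = [set: X] `*`` (fun=> [set: S]).
  by apply/seteqP; split.
rewrite (_ : \esum_(i in _) _ = \esum_(i in [set: X] `*`` (fun=> [set: S]))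
   (fun x s => (rnorm (w (x, s)) `^ p)%:E) i.1 i.2); last first.
  by apply: eq_esum => -[].
rewrite -(@esum_esum R X S setT (fun=> setT)
  (fun x s => (rnorm (w (x, s)) `^ p)%:E)); last first.
  by move=> i j _ _; rewrite lee_fin powR_ge0.
by apply: eq_esum => i _; rewrite -ellp_sumK.
Qed.

Lemma uncurry_lty (v : V) : (lp_sum p (fun k : X * S => v k.1 k.2) < +oo)%E.
Proof. by rewrite lp_sum_curry ellp_lty. Qed.

Lemma curry_lty (w : W) :
  (lp_sum p (fun x => mkellp p1 (lp_sum_slice w x)) < +oo)%E.
Proof. by rewrite lp_sum_uncurry ellp_lty. Qed.

Definition uncurry_vec (v : V) : W := mkellp p1 (uncurry_lty v).
Definition curry_vec (w : W) : V := mkellp p1 (curry_lty w).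

Lemma uncurry_linear : linear uncurry_vec.
Proof. by move=> c u v; apply: ellp_ext. Qed.

Lemma curry_linear : linear curry_vec.
Proof. by move=> c u v; apply: ellp_ext => x; apply: ellp_ext. Qed.

Lemma uncurry_norm (v : V) : rnorm (uncurry_vec v) = rnorm v.
Proof. by rewrite !ellp_rnormE /lp_norm lp_sum_curry. Qed.

Lemma curry_norm (w : W) : rnorm (curry_vec w) = rnorm w.
Proof. by rewrite !ellp_rnormE /lp_norm lp_sum_uncurry. Qed.

Lemma uncurry_bounded (v : V) : rnorm (uncurry_vec v) <= 1 * rnorm v.
Proof. by rewrite mul1r uncurry_norm. Qed.
Lemma curry_bounded (w : W) : rnorm (curry_vec w) <= 1 * rnorm w.
Proof. by rewrite mul1r curry_norm. Qed.

Definition uncurry_op : bop V W := mkbop uncurry_linear uncurry_bounded.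
Definition curry_op : bop W V := mkbop curry_linear curry_bounded.

Lemma uncurry_opE v k : uncurry_op v k = v k.1 k.2. Proof. by []. Qed.
Lemma curry_opE w x s : curry_op w x s = w (x, s). Proof. by []. Qed.

Lemma uncurry_opK : cancel uncurry_op curry_op.
Proof. by move=> v; apply: ellp_ext => x; apply: ellp_ext. Qed.
Lemma curry_opK : cancel curry_op uncurry_op.
Proof. by move=> w; apply: ellp_ext => -[]. Qed.

Lemma uncurry_single x s (e : E) :
  uncurry_op (single p1 x (single p1 s e)) = single p1 (x, s) e.
Proof.
apply: ellp_ext => -[x' s']; rewrite uncurry_opE !singleE /= xpair_eqE.
by case: eqP.
Qed.

End curry.

Section pointwise.
Variables (R : realType) (p : R) (p1 : 1 <= p) (X : choiceType).
Variables (E F : normedModType R[i]) (b : bop E F).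

Lemma pointwise_le (v : ellp p1 X E) :
  (lp_sum p (fun x => b (v x)) <= ((opnorm b * rnorm v) `^ p)%:E)%E.
Proof.
rewrite powRM ?opnorm_ge0 ?rnorm_ge0// EFinM -ellp_sumK /lp_sum.
rewrite -(esumZl); [|exact: powR_ge0|by move=> i; exact: powR_ge0].
apply: le_esum => i _; rewrite lee_fin -powRM ?opnorm_ge0 ?rnorm_ge0//.
by apply: ge0_ler_powR; rewrite ?nnegrE ?mulr_ge0 ?opnorm_ge0 ?rnorm_ge0 ?opnormP// (le_trans _ p1).
Qed.

Lemma pointwise_lty (v : ellp p1 X E) : (lp_sum p (fun x => b (v x)) < +oo)%E.
Proof. exact: le_lt_trans (pointwise_le v) (ltry _). Qed.

Definition pointwise_vec (v : ellp p1 X E) : ellp p1 X F := mkellp p1 (pointwise_lty v).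

Lemma pointwise_linear : linear pointwise_vec.
Proof. by move=> c u v; apply: ellp_ext => x; exact: linearP. Qed.

Lemma pointwise_bounded v : rnorm (pointwise_vec v) <= opnorm b * rnorm v.
Proof.
rewrite [leLHS]ellp_rnormE; apply: lp_sum_le (pointwise_le v) => //.
by rewrite mulr_ge0 ?opnorm_ge0 ?rnorm_ge0.
Qed.

Definition pointwise_op : bop (ellp p1 X E) (ellp p1 X F) :=
  mkbop pointwise_linear pointwise_bounded.

Lemma pointwise_opE v x : pointwise_op v x = b (v x). Proof. by []. Qed.

Lemma pointwise_single x e : pointwise_op (single p1 x e) = single p1 x (b e).
Proof.
by apply: ellp_ext => y; rewrite pointwise_opE !singleE; case: eqP => _ //; rewrite bop0.
Qed.

Lemma opnorm_pointwise : opnorm pointwise_op <= opnorm b.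
Proof. exact: opnorm_mkbop (opnorm_ge0 _). Qed.

End pointwise.

(** * Norm closures and conjugation by invertible isometries *)

Section operator_sets.
Variable R : realType.
Implicit Types E F G : normedModType R[i].

Definition norm_closed E F (A : set (bop E F)) : Prop :=
  forall T, (forall e : R, 0 < e -> exists2 S, A S & opnorm (T - S) < e) -> A T.

Lemma closure_norm_closed E F (A : set (bop E F)) : norm_closed (closure A).
Proof. by move=> T /bop_closureP; exact: closed_closure. Qed.

Lemma subset_bop_closure E F (A : set (bop E F)) T : A T -> closure A T.
Proof. exact: subset_closure. Qed.

Lemma norm_closed_closure E F (A B : set (bop E F)) :
  norm_closed B -> (forall T, A T -> B T) -> forall T, closure A T -> B T.
Proof.
move=> cB AB T /bop_closureP h; apply: cB => e /h[S AS lt]; exists S => //; exact: AB.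
Qed.

Lemma closure_subalgebra E (A : set (bop E E)) :
  is_subalgebra A -> is_subalgebra (closure A).
Proof.
move=> [A0 Alin Acomp]; split.
- exact: subset_bop_closure.
- move=> c S T /bop_closureP hS /bop_closureP hT; apply/bop_closureP => e e0.
  have e2 : 0 < e / 2 by rewrite divr_gt0.
  have c1 : 0 < rnorm (c : R[i]^o) + 1 by rewrite ltr_wpDl// rnorm_ge0.
  have [S' AS' hS'] := hS (e / 2 / (rnorm (c : R[i]^o) + 1)) (divr_gt0 e2 c1).
  have [T' AT' hT'] := hT (e / 2) e2.
  exists (c *: S' + T'); first exact: Alin.
  rewrite opprD addrACA -scalerBr (le_lt_trans (opnormD _ _))// (splitr e).
  rewrite ltr_leD//; last exact: ltW.
  rewrite opnormZ; move: hS'; rewrite ltr_pdivlMr//; apply: le_lt_trans.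
  by rewrite mulrC ler_wpM2l ?opnorm_ge0// lerDl.
- move=> S T /bop_closureP hS /bop_closureP hT; apply/bop_closureP => e e0.
  have e2 : 0 < e / 2 by rewrite divr_gt0.
  have T1 : 0 < opnorm T + 1 by rewrite ltr_wpDl// opnorm_ge0.
  have [S' AS' hS'] := hS (e / 2 / (opnorm T + 1)) (divr_gt0 e2 T1).
  have S1 : 0 < opnorm S' + 1 by rewrite ltr_wpDl// opnorm_ge0.
  (* [T'] is chosen after [S'], since in (S - S') T + S' (T - T') the second error is multiplied by
     the norm of [S']. Adding 1 to the norms keeps the divisors positive. *)
  have [T' AT' hT'] := hT (e / 2 / (opnorm S' + 1)) (divr_gt0 e2 S1).
  exists (bcomp S' T'); first exact: Acomp.
  have -> : bcomp S T - bcomp S' T' = bcomp (S - S') T + bcomp S' (T - T').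
    by rewrite bcompBl bcompBr addrA subrK.
  rewrite (le_lt_trans (opnormD _ _))// (splitr e) ltr_leD//.
    apply: le_lt_trans (opnorm_bcomp _ _) _.
    move: hS'; rewrite ltr_pdivlMr//; apply: le_lt_trans.
    by rewrite ler_wpM2l ?opnorm_ge0// lerDl.
  apply: le_trans (opnorm_bcomp _ _) _.
  move: hT'; rewrite ltr_pdivlMr// => /ltW; apply: le_trans.
  by rewrite mulrC ler_wpM2l ?opnorm_ge0// lerDl.
Qed.

Definition isometric E F (U : bop E F) : Prop := forall v, rnorm (U v) = rnorm v.

Definition conj_op E F (U : bop E F) (U' : bop F E) (T : bop E E) : bop F F :=
  bcomp U (bcomp T U').

Lemma conj_opE E F (U : bop E F) (U' : bop F E) (T : bop E E) v :
  conj_op U U' T v = U (T (U' v)).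
Proof. by []. Qed.

Lemma contraction_isometric E F (U : bop E F) (U' : bop F E) :
  (forall v, rnorm (U v) <= rnorm v) -> (forall v, rnorm (U' v) <= rnorm v) ->
  cancel U U' -> isometric U.
Proof.
move=> c c' UK v; apply/eqP; rewrite eq_le c/=.
by rewrite -{1}(UK v) c'.
Qed.

Section conjugation.
Variables (E F : normedModType R[i]) (U : bop E F) (U' : bop F E).
Hypotheses (UK : cancel U U') (UK' : cancel U' U) (iU : isometric U).

Let iU' : isometric U'.
Proof. by move=> v; rewrite -iU UK'. Qed.

Lemma conj_opB S T : conj_op U U' (S - T) = conj_op U U' S - conj_op U U' T.
Proof. by rewrite /conj_op bcompBl bcompBr. Qed.

Lemma conj_opP c S T :
  conj_op U U' (c *: S + T) = c *: conj_op U U' S + conj_op U U' T.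
Proof. by rewrite /conj_op bcompDl bcompDr bcompZl bcompZr. Qed.

Lemma conj_opM S T :
  conj_op U U' (bcomp S T) = bcomp (conj_op U U' S) (conj_op U U' T).
Proof. by apply: bop_ext => v; rewrite /= UK. Qed.

Lemma conj_opK : cancel (conj_op U U') (conj_op U' U).
Proof. by move=> T; apply: bop_ext => v; rewrite /= !UK. Qed.

Lemma opnorm_conj T : opnorm (conj_op U U' T) = opnorm T.
Proof.
apply/eqP; rewrite eq_le; apply/andP; split; apply: opnorm_le => v v1.
  by rewrite conj_opE iU opnorm_ub// iU'.
have -> : rnorm (T v) = rnorm (conj_op U U' T (U v)) by rewrite conj_opE iU UK.
by rewrite opnorm_ub// iU.
Qed.

Lemma isometrically_isomorphic_conj (A : set (bop E E)) (B : set (bop F F)) :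
  (forall T, A T -> B (conj_op U U' T)) ->
  (forall S, B S -> A (conj_op U' U S)) -> isometrically_isomorphic A B.
Proof.
move=> AB BA; exists (conj_op U U'); split.
- split; first by move=> T AT; exact: AB.
    by move=> S T _ _ /(can_inj conj_opK).
  move=> S BS; exists (conj_op U' U S); first exact: BA.
  by apply: bop_ext => v; rewrite !conj_opE !UK'.
- by move=> c S T _ _; rewrite conj_opP.
- by move=> S T _ _; exact: conj_opM.
- by move=> S _; rewrite !bop_normE opnorm_conj.
Qed.

Lemma conj_closure (A : set (bop E E)) (B : set (bop F F)) :
  (forall T, A T -> B (conj_op U U' T)) ->
  forall T, closure A T -> closure B (conj_op U U' T).
Proof.
move=> AB T /bop_closureP h; apply/bop_closureP => e e0.
have [S AS lt] := h e e0.
by exists (conj_op U U' S); [exact: AB|rewrite -conj_opB opnorm_conj].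
Qed.

End conjugation.

Lemma isometric_inverse E F (U : bop E F) (U' : bop F E) :
  cancel U' U -> isometric U -> isometric U'.
Proof. by move=> UK' iU v; rewrite -iU UK'. Qed.

Lemma isometrically_isomorphic_conj_closure E F (U : bop E F) (U' : bop F E)
    (A : set (bop E E)) (B : set (bop F F)) :
  cancel U U' -> cancel U' U -> isometric U ->
  (forall T, A T -> B (conj_op U U' T)) ->
  (forall S, B S -> A (conj_op U' U S)) ->
  isometrically_isomorphic (closure A) (closure B).
Proof.
move=> UK UK' iU AB BA.
apply: (isometrically_isomorphic_conj UK UK' iU); first exact: (conj_closure UK UK' iU).
exact: (conj_closure UK' UK (isometric_inverse UK' iU)).
Qed.

Lemma isometrically_isomorphic_trans E F G (A : set (bop E E))
    (B : set (bop F F)) (C : set (bop G G)) :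
  isometrically_isomorphic A B -> isometrically_isomorphic B C ->
  isometrically_isomorphic A C.
Proof.
move=> [f [[fAB fI fS] fL fM fN]] [g [[gBC gI gS] gL gM gN]].
have fB T : A T -> B (f T) by exact: fAB.
exists (g \o f); split=> /=.
- split.
  + by move=> T AT; apply: gBC; exact: fB.
  + move=> S T /set_mem AS /set_mem AT /= e.
    have fST : f S = f T by apply: gI => //; apply/mem_set; exact: fB.
    by apply: fI => //; exact/mem_set.
  + move=> c /gS[b Bb <-]; have [a Aa <-] := fS _ Bb; by exists a.
- by move=> c S T AS AT; rewrite fL// gL//; exact: fB.
- by move=> S T AS AT; rewrite fM// gM//; exact: fB.
- by move=> S AS; rewrite gN ?fN//; exact: fB.
Qed.

End operator_sets.

Section op_coefficients.
Variables (R : realType) (p : R) (p1 : 1 <= p).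
Local Notation ell I := (ellp p1 I R[i]^o).

Lemma rnorm_entry (X : choiceType) (E : normedModType R[i])
  (T : bop (ellp p1 X E) (ellp p1 X E)) x y e :
  rnorm (entry T x y e) <= opnorm T * rnorm e.
Proof.
by rewrite (le_trans (ellp_coord _ _))// -(rnorm_single p1 y e) opnormP.
Qed.

Definition coef (I J : choiceType) (T : bop (ell I) (ell J)) (j : J) (i : I) : R[i] :=
  T (single p1 i (1 : R[i]^o)) j.

Lemma scaler1 (c : R[i]) : (c : R[i]^o) = c *: (1 : R[i]^o).
Proof. by rewrite /GRing.scale/= mulr1. Qed.

Lemma single_scale1 (I : choiceType) (i : I) (c : R[i]) :
  single p1 i (c : R[i]^o) = c *: single p1 i (1 : R[i]^o).
Proof. by rewrite -singleZ -scaler1. Qed.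

Lemma bop_coef (I J : choiceType) (T : bop (ell I) (ell J)) i (c : R[i]^o) j :
  T (single p1 i c) j = c * coef T j i.
Proof. by rewrite single_scale1 bopZ. Qed.

Lemma coef_ext (I J : choiceType) (S T : bop (ell I) (ell J)) :
  (forall j i, coef S j i = coef T j i) -> S = T.
Proof.
move=> h; apply: bop_single_ext => i e; apply: ellp_ext => j.
by rewrite !bop_coef h.
Qed.

Lemma opcoefD (I J : choiceType) (S T : bop (ell I) (ell J)) i j :
  coef (S + T) j i = coef S j i + coef T j i.
Proof. by rewrite /coef bopDE ellpDE. Qed.

Lemma opcoefB (I J : choiceType) (S T : bop (ell I) (ell J)) i j :
  coef (S - T) j i = coef S j i - coef T j i.
Proof. by rewrite opcoefD /coef bopNE ellpNE. Qed.

Lemma opcoefZ (I J : choiceType) c (T : bop (ell I) (ell J)) i j :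
  coef (c *: T) j i = c * coef T j i.
Proof. by rewrite /coef bopZE ellpZE. Qed.

Lemma opcoef_sum (I J : choiceType) (K : Type) (s : seq K)
  (T : K -> bop (ell I) (ell J)) i j :
  coef (\sum_(k <- s) T k) j i = \sum_(k <- s) coef (T k) j i.
Proof. by rewrite /coef bop_sumE ellp_sumE. Qed.

Lemma coef_le (I J : choiceType) (T : bop (ell I) (ell J)) j i :
  rnorm (coef T j i : R[i]^o) <= opnorm T.
Proof.
rewrite (le_trans (ellp_coord _ _))// (le_trans (opnormP _ _))//.
by rewrite rnorm_single rnorm1 mulr1.
Qed.

Lemma coef_pinj (I J : choiceType) (h : J -> option I) (hi : partial_inj h) j i :
  coef (pinj p1 R[i]^o hi) j i = (h j == Some i)%:R.
Proof. by rewrite /coef pinj_single; case: ifP. Qed.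

Lemma entry_coef (X : choiceType) (T : bop (ell X) (ell X)) x y :
  (entry T x y != 0) = (coef T x y != 0).
Proof.
congr (~~ _); apply/eqP/eqP => [h|h].
  by have := congr1 (fun S : bop _ _ => S (1 : R[i]^o)) h.
by apply: bop_ext => e; rewrite /= bop_coef h mulr0.
Qed.

End op_coefficients.

(** * Elementary tensors of operators *)

Section tensor_operators.
Variables (R : realType) (p : R) (p1 : 1 <= p) (I J : choiceType).
Local Notation ell I := (ellp p1 I R[i]^o).

Lemma vtensorE (u : ell I) (v : ell J) k : vtensor u v k = u k.1 * v k.2.
Proof. by []. Qed.

Lemma vtensor_single (i : I) (j : J) (a b : R[i]) :
  vtensor (single p1 i (a : R[i]^o)) (single p1 j (b : R[i]^o)) =
  single p1 (i, j) (a * b : R[i]^o).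
Proof.
apply: ellp_ext => -[i' j']; rewrite vtensorE !singleE xpair_eqE /=.
by case: eqP; case: eqP => //=; rewrite ?mul0r ?mulr0.
Qed.

Definition swap_op : bop (ell (I * J)%type) (ell (J * I)%type) :=
  perm_op p1 _ (@swap_pairK J I).

Definition swap_op' : bop (ell (J * I)%type) (ell (I * J)%type) :=
  perm_op p1 _ (@swap_pairK I J).

Lemma swap_opE w k : swap_op w k = w (k.2, k.1). Proof. by []. Qed.

Definition tens_r (b : bop (ell J) (ell J)) : bop (ell (I * J)%type) (ell (I * J)%type) :=
  bcomp (uncurry_op p1 I J _) (bcomp (pointwise_op p1 I b) (curry_op p1 I J _)).

Definition tens_l (a : bop (ell I) (ell I)) : bop (ell (I * J)%type) (ell (I * J)%type) :=
  bcomp swap_op' (bcomp (bcomp (uncurry_op p1 J I _)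
    (bcomp (pointwise_op p1 J a) (curry_op p1 J I _))) swap_op).

(** The tensor is obtained as (a ⊗ 1)(1 ⊗ b). Each factor acts fibrewise after currying, which gives
    both its existence as a bounded operator and the product bound on the norm. *)
Definition tens (a : bop (ell I) (ell I)) (b : bop (ell J) (ell J)) :=
  bcomp (tens_l a) (tens_r b).

Lemma tensP a b : is_op_tensor a b (tens a b).
Proof.
move=> u v.
have -> : tens a b (vtensor u v) = tens_l a (vtensor u (b v)).
  congr (tens_l a _); apply: ellp_ext => -[i j].
  change (b (curry_op p1 I J _ (vtensor u v) i) j = u i * b v j).
  have -> : curry_op p1 I J _ (vtensor u v) i = u i *: v by apply: ellp_ext.
  by rewrite bopZ.
apply: ellp_ext => -[i j].
change (a (curry_op p1 J I _ (swap_op (vtensor u (b v))) j) i = a u i * b v j).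
have -> : curry_op p1 J I _ (swap_op (vtensor u (b v))) j = b v j *: u.
  by apply: ellp_ext => i'; rewrite curry_opE swap_opE vtensorE mulrC.
by rewrite bopZ mulrC.
Qed.

Lemma is_op_tensor_coef a b (T : bop (ell (I * J)%type) (ell (I * J)%type))
    (i : I) (j : J) (i' : I) (j' : J) : is_op_tensor a b T ->
  coef T (i, j) (i', j') = coef a i i' * coef b j j'.
Proof. by move=> h; rewrite /coef -[1 in LHS]mulr1 -vtensor_single h. Qed.

Lemma is_op_tensor_unique a b (T : bop (ell (I * J)%type) (ell (I * J)%type)) : is_op_tensor a b T -> T = tens a b.
Proof.
move=> h; apply: coef_ext => -[i j] [i' j'].
by rewrite (is_op_tensor_coef _ _ _ _ h) (is_op_tensor_coef _ _ _ _ (tensP a b)).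
Qed.

Lemma tens_coef a b (i : I) (j : J) (i' : I) (j' : J) :
  coef (tens a b) (i, j) (i', j') = coef a i i' * coef b j j'.
Proof. exact: is_op_tensor_coef (tensP a b). Qed.

Lemma opnorm_tens_r b : opnorm (tens_r b) <= opnorm b.
Proof.
apply: opnorm_le_bound; first exact: opnorm_ge0.
move=> v.
have -> : rnorm (tens_r b v) = rnorm (pointwise_op p1 I b (curry_op p1 I J _ v)).
  exact: uncurry_norm.
rewrite (le_trans (opnormP _ _))//.
have -> : rnorm (curry_op p1 I J _ v) = rnorm v by exact: curry_norm.
by rewrite ler_wpM2r ?rnorm_ge0 ?opnorm_pointwise.
Qed.

Lemma opnorm_tens_l a : opnorm (tens_l a) <= opnorm a.
Proof.
apply: opnorm_le_bound; first exact: opnorm_ge0.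
move=> v; set w := swap_op v.
have -> : tens_l a v = swap_op' (uncurry_op p1 J I _
  (pointwise_op p1 J a (curry_op p1 J I _ w))) by [].
rewrite (le_trans (pinj_le _ _))//.
have -> : rnorm (uncurry_op p1 J I _ (pointwise_op p1 J a (curry_op p1 J I _ w))) =
  rnorm (pointwise_op p1 J a (curry_op p1 J I _ w)) by exact: uncurry_norm.
rewrite (le_trans (opnormP _ _))//.
have -> : rnorm (curry_op p1 J I _ w) = rnorm w by exact: curry_norm.
by rewrite ler_pM ?opnorm_ge0 ?rnorm_ge0 ?opnorm_pointwise//; exact: pinj_le.
Qed.

Lemma opnorm_tens a b : opnorm (tens a b) <= opnorm a * opnorm b.
Proof.
apply: le_trans (opnorm_bcomp _ _) _.
apply: ler_pM; [exact: opnorm_ge0|exact: opnorm_ge0|exact: opnorm_tens_l|].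
exact: opnorm_tens_r.
Qed.

Lemma tensBl a a' b : tens (a - a') b = tens a b - tens a' b.
Proof.
apply: coef_ext => -[i j] [i' j'].
by rewrite opcoefB !tens_coef opcoefB mulrBl.
Qed.

Lemma tensBr a b b' : tens a (b - b') = tens a b - tens a b'.
Proof.
apply: coef_ext => -[i j] [i' j'].
by rewrite opcoefB !tens_coef opcoefB mulrBr.
Qed.

Lemma tensM a b a' b' : bcomp (tens a b) (tens a' b') = tens (bcomp a a') (bcomp b b').
Proof.
apply: is_op_tensor_unique => u v.
change (tens a b (tens a' b' (vtensor u v)) = vtensor (a (a' u)) (b (b' v))).
by rewrite tensP tensP.
Qed.

End tensor_operators.

(** * Isometries of l^p for p <> 2 *)

Section power_inequalities.
Variable R : realType.
Implicit Types (q s t A B : R).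

Lemma powR_midpoint q s t : 1 <= q -> 0 <= s -> 0 <= t ->
  ((s + t) / 2) `^ q <= (s `^ q + t `^ q) / 2.
Proof.
move=> q1 s0 t0.
have h0 : (0 : R) <= 2^-1 by rewrite invr_ge0.
have h1 : (2^-1 : R) <= 1 by rewrite invf_le1// ler1n.
have := @convex_powR R q q1 (Itv01 h0 h1) s t.
rewrite !inE/= !in_itv/= s0 t0 => /(_ isT isT).
rewrite !convRE/= [conv _ _ _]convRE/= /unstable.onem.
have -> : 1 - 2^-1 = 2^-1 :> R by rewrite [X in X - _](splitr 1) !mul1r addrK.
by rewrite -!mulrDr mulrC [X in _ <= X -> _]mulrC.
Qed.

Lemma powR_split q A : 0 < A -> A `^ q = A * A `^ (q - 1).
Proof.
move=> A0; rewrite -[X in X * _](powRr1 (ltW A0)) -powRD ?(gt_eqF A0) ?implybT//.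
by rewrite addrC subrK.
Qed.

(** Write (A + B)^q as A (A + B)^(q-1) + B (A + B)^(q-1) and use strict monotonicity of the power q
    - 1. *)
Lemma powR_superadditive q A B : 1 < q -> 0 < A -> 0 < B ->
  A `^ q + B `^ q < (A + B) `^ q.
Proof.
move=> q1 A0 B0; have AB0 : 0 < A + B by rewrite addr_gt0.
rewrite (powR_split q A0) (powR_split q B0) (powR_split q AB0) mulrDl; apply: ltrD.
  rewrite ltr_pM2l//; apply: gt0_ltr_powR; rewrite ?subr_gt0 ?nnegrE ?(ltW A0) ?(ltW AB0)//.
  by rewrite ltrDl.
rewrite ltr_pM2l//; apply: gt0_ltr_powR; rewrite ?subr_gt0 ?nnegrE ?(ltW B0) ?(ltW AB0)//.
by rewrite ltrDr.
Qed.

(** Superadditivity at the exponent 1/q, applied to A^q and B^q. *)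
Lemma powR_subadditive q A B : 0 < q -> q < 1 -> 0 < A -> 0 < B ->
  (A + B) `^ q < A `^ q + B `^ q.
Proof.
move=> q0 q1 A0 B0.
have ri : 1 < q^-1 by rewrite invf_gt1.
have Aq : 0 < A `^ q by rewrite powR_gt0.
have Bq : 0 < B `^ q by rewrite powR_gt0.
have := powR_superadditive ri Aq Bq.
rewrite -!powRrM mulfV ?gt_eqF// !powRr1 ?(ltW A0) ?(ltW B0)// => h.
have := gt0_ltr_powR q0 (x := A + B) (y := (A `^ q + B `^ q) `^ q^-1).
rewrite !nnegrE addr_ge0 ?(ltW A0) ?(ltW B0)// powR_ge0 => /(_ isT isT h).
by rewrite -powRrM mulVf ?gt_eqF// powRr1// addr_ge0// ltW.
Qed.

(** Meant for q = p/2 with s, t, A, B the squared moduli of a + b, a - b, a, b; the linear relation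
    is the parallelogram law. Midpoint convexity bounds the left side below by 2 (A + B)^q, and
    superadditivity is strict unless A or B vanishes. *)
Lemma powR_clarkson_ge q s t A B : 1 < q -> 0 <= s -> 0 <= t -> 0 <= A -> 0 <= B ->
  s + t = 2 * (A + B) ->
  2 * (A `^ q + B `^ q) <= s `^ q + t `^ q /\
  (s `^ q + t `^ q = 2 * (A `^ q + B `^ q) -> A = 0 \/ B = 0).
Proof.
move=> q1 s0 t0 A0 B0 e.
have := powR_midpoint (ltW q1) s0 t0.
rewrite e [2 * _]mulrC mulfK// ler_pdivlMr// => mid.
have q0 : q != 0 by rewrite gt_eqF// (lt_trans _ q1).
have [A00|An] := eqVneq A 0.
  by split; [move: mid; rewrite A00 powR0// !add0r mulrC|left].
have [B00|Bn] := eqVneq B 0.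
  by split; [move: mid; rewrite B00 powR0// !addr0 mulrC|right].
have Ap : 0 < A by rewrite lt_neqAle eq_sym An.
have Bp : 0 < B by rewrite lt_neqAle eq_sym Bn.
have lt : 2 * (A `^ q + B `^ q) < s `^ q + t `^ q.
  apply: lt_le_trans mid; rewrite mulrC ltr_pM2r//; exact: powR_superadditive.
by split; [exact: ltW|move=> h; rewrite h ltxx in lt].
Qed.

(** For q < 1 everything reverses: midpoint convexity at 1/q, applied to s^q and t^q, becomes
    midpoint concavity at q. *)
Lemma powR_clarkson_le q s t A B : 0 < q -> q < 1 -> 0 <= s -> 0 <= t -> 0 <= A -> 0 <= B ->
  s + t = 2 * (A + B) ->
  s `^ q + t `^ q <= 2 * (A `^ q + B `^ q) /\
  (s `^ q + t `^ q = 2 * (A `^ q + B `^ q) -> A = 0 \/ B = 0).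
Proof.
move=> q0 q1 s0 t0 A0 B0 e.
have ri : 1 < q^-1 by rewrite invf_gt1.
have := powR_midpoint (ltW ri) (powR_ge0 s q) (powR_ge0 t q).
rewrite -!powRrM mulfV ?gt_eqF// !powRr1// e [2 * _]mulrC mulfK// => mid0.
have mid : s `^ q + t `^ q <= (A + B) `^ q * 2.
  rewrite -ler_pdivrMr//.
  have st : 0 <= (s `^ q + t `^ q) / 2 by rewrite divr_ge0// addr_ge0// powR_ge0.
  have := ge0_ler_powR (ltW q0) (x := ((s `^ q + t `^ q) / 2) `^ q^-1) (y := A + B).
  rewrite !nnegrE powR_ge0 addr_ge0// => /(_ isT isT mid0).
  by rewrite -powRrM mulVf ?gt_eqF// powRr1.
have qn : q != 0 by rewrite gt_eqF.
have [A00|An] := eqVneq A 0.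
  by split; [move: mid; rewrite A00 powR0// !add0r mulrC|left].
have [B00|Bn] := eqVneq B 0.
  by split; [move: mid; rewrite B00 powR0// !addr0 mulrC|right].
have Ap : 0 < A by rewrite lt_neqAle eq_sym An.
have Bp : 0 < B by rewrite lt_neqAle eq_sym Bn.
have lt : s `^ q + t `^ q < 2 * (A `^ q + B `^ q).
  apply: le_lt_trans mid _; rewrite mulrC ltr_pM2l//; exact: powR_subadditive.
by split; [exact: ltW|move=> h; rewrite h ltxx in lt].
Qed.

Lemma rnorm_sqr (a : R[i]) :
  rnorm (a : R[i]^o) ^+ 2 = complex.Re a ^+ 2 + complex.Im a ^+ 2.
Proof.
by case: a => x y; rewrite /rnorm /= sqr_sqrtr// addr_ge0 ?sqr_ge0.
Qed.

Lemma rnorm_parallelogram (a b : R[i]) :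
  rnorm (a + b : R[i]^o) ^+ 2 + rnorm (a - b : R[i]^o) ^+ 2 =
  2 * (rnorm (a : R[i]^o) ^+ 2 + rnorm (b : R[i]^o) ^+ 2).
Proof. by rewrite !rnorm_sqr; case: a => a1 a2; case: b => b1 b2 /=; ring. Qed.

Lemma powR_half (p x : R) : 0 <= x -> x `^ p = (x ^+ 2) `^ (p / 2).
Proof. by move=> x0; rewrite -powR_mulrn// -powRrM mulrCA mulfV// mulr1. Qed.

(** The defect in the scalar Clarkson inequality. For fixed p other than 2 it has a constant sign
    and vanishes only if a b = 0. *)
Definition clarkson_gap (p : R) (a b : R[i]) : R :=
  (rnorm (a + b : R[i]^o) `^ p + rnorm (a - b : R[i]^o) `^ p) -
  2 * (rnorm (a : R[i]^o) `^ p + rnorm (b : R[i]^o) `^ p).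

Lemma clarkson_scalar (p : R) : 1 <= p -> p != 2 ->
  (forall a b : R[i], 0 <= clarkson_gap p a b) \/
  (forall a b : R[i], clarkson_gap p a b <= 0).
Proof.
move=> p1 p2; have [lt|gt|e] := ltgtP p 2; last by rewrite e eqxx in p2.
  right=> a b; rewrite subr_le0 !(@powR_half p) ?rnorm_ge0//.
  apply: (powR_clarkson_le _ _ _ _ _ _ (rnorm_parallelogram a b)).1; rewrite ?sqr_ge0//.
    by rewrite divr_gt0// (lt_le_trans _ p1).
  by rewrite ltr_pdivrMr// mul1r.
left=> a b; rewrite subr_ge0 !(@powR_half p) ?rnorm_ge0//.
apply: (powR_clarkson_ge _ _ _ _ _ (rnorm_parallelogram a b)).1; rewrite ?sqr_ge0//.
by rewrite ltr_pdivlMr// mul1r.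
Qed.

Lemma clarkson_gap_eq0 (p : R) (a b : R[i]) : 1 <= p -> p != 2 ->
  clarkson_gap p a b = 0 -> a = 0 \/ b = 0.
Proof.
move=> p1 p2 /eqP; rewrite subr_eq0 => /eqP.
have sq0 (c : R[i]) : rnorm (c : R[i]^o) ^+ 2 = 0 -> c = 0.
  by move=> /eqP; rewrite sqrf_eq0 => /eqP /rnorm_eq0.
have [lt|gt|e] := ltgtP p 2; last by rewrite e eqxx in p2.
  rewrite !(@powR_half p) ?rnorm_ge0// => e.
  have [||||||_ /(_ e)[/sq0|/sq0]] := @powR_clarkson_le (p / 2) _ _ _ _ _ _ _ _ _ _
    (rnorm_parallelogram a b); rewrite ?sqr_ge0//; [|..|by left|by right].
    by rewrite divr_gt0// (lt_le_trans _ p1).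
  by rewrite ltr_pdivrMr// mul1r.
rewrite !(@powR_half p) ?rnorm_ge0// => e.
have [|||||_ /(_ e)[/sq0|/sq0]] := @powR_clarkson_ge (p / 2) _ _ _ _ _ _ _ _ _
  (rnorm_parallelogram a b); rewrite ?sqr_ge0//; [|by left|by right].
by rewrite ltr_pdivlMr// mul1r.
Qed.

End power_inequalities.

Section lamperti.
Variables (R : realType) (p : R) (p1 : 1 <= p) (p2 : p != 2).

Lemma esum_eq_term (I : choiceType) (f g : I -> R) (M : R) :
  (forall i, 0 <= f i <= g i) -> \esum_(i in [set: I]) (f i)%:E = M%:E ->
  \esum_(i in [set: I]) (g i)%:E = M%:E -> forall i, f i = g i.
Proof.
move=> fg fM gM i; apply/eqP; rewrite eq_le; have /andP[f0 ->] := fg i.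
rewrite -subr_le0 -lee_fin.
have <- : \esum_(i in [set: I]) (g i - f i)%:E = (0 : R)%:E.
  have : \esum_(i in [set: I]) (g i)%:E =
      (\esum_(i in [set: I]) (f i)%:E + \esum_(i in [set: I]) (g i - f i)%:E)%E.
    rewrite -esumD; first by apply: eq_esum => j _; rewrite -EFinD addrC subrK.
      by move=> j _; rewrite lee_fin; case/andP: (fg j).
    by move=> j _; rewrite lee_fin subr_ge0; case/andP: (fg j).
  rewrite fM gM => /(congr1 (fun x => (x - M%:E)%E)).
  by rewrite subee// addeAC subee// add0e => <-.
apply: esum_ge; exists [set i] => //; by rewrite fsbig_set1.
Qed.

Local Notation ell I := (ellp p1 I R[i]^o).

Lemma esum_rnorm_powR (I : choiceType) (u : ell I) :
  \esum_(i in [set: I]) (rnorm (u i) `^ p)%:E = (rnorm u `^ p)%:E.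
Proof. exact: ellp_sumK. Qed.

(** The two norm identities say that the Clarkson gaps of the coordinates sum to 0. As all gaps have
    the same sign, each one vanishes, so at each coordinate [u] or [v] is 0. *)
Lemma disjoint_of_norm (I : choiceType) (u v : ell I) :
  rnorm (u + v) `^ p = rnorm u `^ p + rnorm v `^ p ->
  rnorm (u - v) `^ p = rnorm u `^ p + rnorm v `^ p -> disjoint_supp u v.
Proof.
move=> plus minus.
pose f i := rnorm ((u + v) i) `^ p + rnorm ((u - v) i) `^ p.
pose g i := 2 * (rnorm (u i) `^ p + rnorm (v i) `^ p).
pose M := 2 * (rnorm u `^ p + rnorm v `^ p).
have fM : \esum_(i in [set: I]) (f i)%:E = M%:E.
  transitivity (\esum_(i in [set: I]) ((rnorm ((u + v) i) `^ p)%:E +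
      (rnorm ((u - v) i) `^ p)%:E)%E); first exact: eq_esum.
  rewrite esumD; try by move=> i _; rewrite lee_fin powR_ge0.
  have e1 := esum_rnorm_powR (u + v); have e2 := esum_rnorm_powR (u - v).
  rewrite plus in e1; rewrite minus in e2.
  by rewrite e1 e2 -EFinD /M mulr_natl mulr2n.
have gM : \esum_(i in [set: I]) (g i)%:E = M%:E.
  rewrite esumZl//; last by move=> i; rewrite addr_ge0// powR_ge0.
  rewrite /M EFinM; congr (_ * _)%E.
  transitivity (\esum_(i in [set: I]) ((rnorm (u i) `^ p)%:E +
      (rnorm (v i) `^ p)%:E)%E); first exact: eq_esum.
  rewrite esumD; try by move=> i _; rewrite lee_fin powR_ge0.
  have e1 := esum_rnorm_powR u; have e2 := esum_rnorm_powR v.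
  by rewrite e1 e2 -EFinD.
suff fg i : f i = g i.
  move=> i; apply: (clarkson_gap_eq0 p1 p2).
  by apply/eqP; rewrite subr_eq0; apply/eqP; exact: (fg i).
have f0 j : 0 <= f j by rewrite addr_ge0 ?powR_ge0.
have g0 j : 0 <= g j by rewrite mulr_ge0// addr_ge0 ?powR_ge0.
have [h|h] := clarkson_scalar p1 p2.
  apply/esym; apply: (esum_eq_term _ gM fM) => j; rewrite g0 /=.
  by have := h (u j) (v j); rewrite subr_ge0.
apply: (esum_eq_term _ fM gM) => j; rewrite f0 /=.
by have := h (u j) (v j); rewrite subr_le0.
Qed.

Lemma isometric_disjoint (I J : choiceType) (U : ell I -> ell J) :
  linear U -> (forall v, rnorm (U v) = rnorm v) ->
  forall u v, disjoint_supp u v -> disjoint_supp (U u) (U v).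
Proof.
move=> lU iU u v uv.
have UD a b : U (a + b) = U a + U b by rewrite -[a in LHS]scale1r lU scale1r.
have UB a b : U (a - b) = U a - U b.
  by rewrite addrC -scaleN1r lU scaleN1r addrC.
apply: disjoint_of_norm; rewrite -?UD -?UB !iU; first exact: rnorm_disjoint.
rewrite -(rnormN v); apply: rnorm_disjoint => i; rewrite ellpNE.
by have [->|->] := uv i; [left|right; rewrite oppr0].
Qed.

End lamperti.

(** * Rank one operators and matrix units *)

Section rank_one.
Variables (R : realType) (p : R) (p1 : 1 <= p) (I : choiceType).
Local Notation ell I := (ellp p1 I R[i]^o).
Variable F : normedModType R[i].

Lemma rk1_linear (xi : F) (j : I) : linear (fun v : ell I => v j *: xi).
Proof. by move=> c u v; rewrite ellpDE ellpZE scalerDl scalerA. Qed.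

Lemma rk1_bounded (xi : F) (j : I) (v : ell I) :
  rnorm (v j *: xi) <= rnorm xi * rnorm v.
Proof.
by rewrite rnormZ mulrC ler_wpM2l ?rnorm_ge0//; exact: (ellp_coord v j).
Qed.

(** The operator usually written xi ⊗ delta_j^*; for xi = delta_i it is the matrix unit at (i,
    j). *)
Definition rk1 (xi : F) (j : I) : bop (ell I) F :=
  mkbop (@rk1_linear xi j) (@rk1_bounded xi j).

Lemma rk1E xi j v : rk1 xi j v = v j *: xi. Proof. by []. Qed.

Lemma rk1_single xi j : rk1 xi j (single p1 j (1 : R[i]^o)) = xi.
Proof. by rewrite rk1E singleE eqxx scale1r. Qed.

Lemma opnorm_rk1 xi j : opnorm (rk1 xi j) = rnorm xi.
Proof.
apply/eqP; rewrite eq_le opnorm_mkbop ?rnorm_ge0//=.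
rewrite -[X in rnorm X](rk1_single xi j) opnorm_ub//.
by rewrite rnorm_single rnorm1.
Qed.

Lemma rk1P c xi eta j : rk1 (c *: xi + eta) j = c *: rk1 xi j + rk1 eta j.
Proof.
apply: bop_ext => v; rewrite bopDE bopZE !rk1E scalerDr !scalerA.
by rewrite mulrC.
Qed.

Lemma rk1B xi eta j : rk1 (xi - eta) j = rk1 xi j - rk1 eta j.
Proof. by rewrite addrC -scaleN1r rk1P scaleN1r addrC. Qed.

End rank_one.

Section rank_one_algebra.
Variables (R : realType) (p : R) (p1 : 1 <= p).
Local Notation ell I := (ellp p1 I R[i]^o).

Lemma bcomp_rk1 (I : choiceType) (F G : normedModType R[i]) (T : bop F G) xi (j : I) :
  bcomp T (rk1 p1 xi j) = rk1 p1 (T xi) j.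
Proof. by apply: bop_ext => v; rewrite /= bopZ. Qed.

Definition delta (I : choiceType) (i : I) : ell I := single p1 i (1 : R[i]^o).

Lemma deltaE (I : choiceType) (i j : I) : delta i j = if j == i then 1 else 0.
Proof. by []. Qed.

Lemma scale_one (c : R[i]) : c *: (1 : R[i]^o) = c :> R[i]^o.
Proof. exact: mulr1. Qed.

Lemma rnorm_delta (I : choiceType) (i : I) : rnorm (delta i) = 1.
Proof. by rewrite rnorm_single rnorm1. Qed.

Definition matrix_unit_algebra (I : choiceType) (A : set (bop (ell I) (ell I))) : Prop :=
  [/\ is_subalgebra A, norm_closed A & forall i j, A (rk1 p1 (delta i) j)].

Lemma subalgebra_sum (E : normedModType R[i]) (A : set (bop E E)) (J : eqType)
    (s : seq J) (c : J -> R[i]) (T : J -> bop E E) :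
  is_subalgebra A -> (forall j, j \in s -> A (T j)) -> A (\sum_(j <- s) c j *: T j).
Proof.
move=> [A0 Alin _]; elim: s => [|j s ih] h; first by rewrite big_nil.
rewrite big_cons; apply: Alin; first by apply: h; rewrite mem_head.
by apply: ih => k ks; apply: h; rewrite inE ks orbT.
Qed.

(** Truncating xi gives finite combinations of matrix units in one column, and on a single column
    the operator norm is the norm of the vector. *)
Lemma rk1_mem (I : choiceType) (A : set (bop (ell I) (ell I))) xi j :
  matrix_unit_algebra A -> A (rk1 p1 xi j).
Proof.
move=> [sA cA uA]; apply: cA => e e0.
have [s [_ lt]] := ellp_approx xi e0.
exists (\sum_(i <- s) xi i *: rk1 p1 (delta i) j).
  by apply: subalgebra_sum => // i _; exact: uA.
suff <- : rk1 p1 (\sum_(i <- s) single p1 i (xi i)) j =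
    \sum_(i <- s) xi i *: rk1 p1 (delta i) j by rewrite -rk1B opnorm_rk1.
apply: bop_ext => v; rewrite bop_sumE rk1E scaler_sumr; apply: eq_bigr => i _.
by rewrite bopZE rk1E single_scale1 !scalerA mulrC.
Qed.

End rank_one_algebra.

(** * Isometric isomorphisms are implemented by weighted permutations *)

Section rigidity.
Variables (R : realType) (p : R) (p1 : 1 <= p) (p2 : p != 2) (I J : choiceType).
Local Notation ell I := (ellp p1 I R[i]^o).
Variables (A : set (bop (ell I) (ell I))) (B : set (bop (ell J) (ell J))).
Hypotheses (algA : matrix_unit_algebra A) (algB : matrix_unit_algebra B).
Variable phi : bop (ell I) (ell I) -> bop (ell J) (ell J).
Hypotheses (phi_bij : set_bij A B phi)
  (phiP : forall (c : R[i]) S T, A S -> A T -> phi (c *: S + T) = c *: phi S + phi T)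
  (phiM : forall S T, A S -> A T -> phi (bcomp S T) = bcomp (phi S) (phi T))
  (phiN : forall S, A S -> `|phi S| = `|S|).

Let A0 : A 0. Proof. by case: algA => -[]. Qed.
Let Acomp S T : A S -> A T -> A (bcomp S T).
Proof. by case: algA => -[_ _ +] _ _; exact. Qed.
Let Alin c S T : A S -> A T -> A (c *: S + T).
Proof. by case: algA => -[_ + _] _ _; exact. Qed.
Let Ark xi i : A (rk1 p1 xi i). Proof. exact: rk1_mem. Qed.
Let Brk xi j : B (rk1 p1 xi j). Proof. exact: rk1_mem. Qed.
Let phi_opnorm S : A S -> opnorm (phi S) = opnorm S.
Proof. by move=> /phiN; rewrite !bop_normE => /complexI. Qed.
Let phi0 : phi 0 = 0.
Proof. by have := phiP (-1) A0 A0; rewrite scaler0 addr0 scaleN1r addNr. Qed.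
Let phiZ c S : A S -> phi (c *: S) = c *: phi S.
Proof. by move=> AS; rewrite -[c *: S]addr0 phiP// phi0 addr0. Qed.
Let phi_surj S : B S -> exists2 T, A T & phi T = S.
Proof. by case: phi_bij => _ _; exact. Qed.

Section base_point.
Variable o : I.
Let e := phi (rk1 p1 (delta p1 o) o).

Let e_ne0 : exists z, e z != 0.
Proof.
apply: contrapT => /forallNP h.
have : opnorm e = 1 by rewrite (phi_opnorm (Ark _ _)) opnorm_rk1 rnorm_delta.
suff -> : e = 0.
  have -> : opnorm (0 : bop (ell J) (ell J)) = 0 by exact: (@rnorm0 R (bop _ _)).
  by move=> /eqP; rewrite eq_sym oner_eq0.
by apply: bop_ext => z; apply/eqP/negPn/negP; exact: h.
Qed.

Let e_idem : bcomp e e = e.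
Proof. by rewrite -(phiM (Ark _ _) (Ark _ _)) bcomp_rk1 rk1E deltaE eqxx scale1r. Qed.

(* The corner e B e is one-dimensional because that of the matrix unit is;
   applied to the rank one operators of B this forces e to have rank one. *)
Let e_minimal S : B S -> exists c : R[i], bcomp e (bcomp S e) = c *: e.
Proof.
move=> /phi_surj[T AT <-]; exists (T (delta p1 o) o).
rewrite -(phiM AT (Ark _ _)) -(phiM (Ark _ _) (Acomp AT (Ark _ _))).
rewrite -(phiZ _ (Ark _ _)); congr phi.
apply: bop_ext => v; rewrite bopZE.
change (rk1 p1 (delta p1 o) o (T (v o *: delta p1 o)) =
  T (delta p1 o) o *: (v o *: delta p1 o)).
by rewrite bopZ rk1E ellpZE [RHS]scalerA [in RHS]mulrC.
Qed.

Let range_e : exists v, [/\ e v = v, rnorm v = 1 & forall z, exists c : R[i], e z = c *: v].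
Proof.
have [z0 z0n] := e_ne0.
have [j0 j0n] : exists j, e z0 j != 0.
  apply: contrapT => /forallNP h; move/eqP: z0n; apply; apply: ellp_ext => j.
  by apply/eqP/negPn/negP; exact: h.
have n0 : 0 < rnorm (e z0) by exact: rnorm_gt0.
have [n [m [nm mE]]] : exists n m : R[i], n * m = 1 /\ m = ((rnorm (e z0))^-1)%:C.
  exists (rnorm (e z0))%:C, ((rnorm (e z0))^-1)%:C; split=> //.
  by rewrite -(rmorphM (real_complex R)) mulfV// gt_eqF.
exists (m *: e z0); split.
- rewrite bopZ; congr (_ *: _).
  exact: (congr1 (fun S : bop _ _ => S z0) e_idem).
- rewrite rnormZ.
  have -> : complex.Re `|m| = (rnorm (e z0))^-1.
    by rewrite mE ger0_norm ?ler0c ?invr_ge0 ?rnorm_ge0.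
  by rewrite mulVf// gt_eqF.
(* Compressing [rk1 z j0] by [e] and evaluating at [z0] gives (e z0)_j0 . e z = c . e z0; the
   coordinate [j0] was chosen so that the factor on the left is nonzero. *)
- move=> z; have [c hc] := e_minimal (Brk z j0).
  pose a : R[i] := e z0 j0; have an : a != 0 by [].
  have h : a *: e z = c *: e z0.
    have := congr1 (fun S : bop _ _ => S z0) hc; rewrite bopZE => <-.
    by rewrite /= bopZ.
  exists (a^-1 * c * n).
  by rewrite scalerA -(mulrA _ n m) nm mulr1 -scalerA -h scalerA mulVf// scale1r.
Qed.

Let intertwiner : exists U : ell I -> ell J,
  [/\ linear U, forall v, rnorm (U v) = rnorm v &
      forall T, A T -> forall xi, U (T xi) = phi T (U xi)].
Proof.
have [v [ev nv rv]] := range_e.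
exists (fun xi => phi (rk1 p1 xi o) v); split.
- by move=> c u w; rewrite rk1P (phiP _ (Ark _ _) (Ark _ _)).
- move=> xi; rewrite -(opnorm_rk1 p1 xi o) -(phi_opnorm (Ark _ _)).
  (* The image of [rk1 xi o] factors through [e], which has norm 1 and range the line of the unit
     vector [v]; hence its norm is attained at [v], and U is isometric. *)
  have h : bcomp (phi (rk1 p1 xi o)) e = phi (rk1 p1 xi o).
    by rewrite -(phiM (Ark _ _) (Ark _ _)) bcomp_rk1 rk1E deltaE eqxx scale1r.
  move: (phi _) h => T h.
  apply/eqP; rewrite eq_le opnorm_ub ?nv//=; apply: opnorm_le => z z1.
  have -> : T z = T (e z) by rewrite -[in LHS]h.
  have [c ec] := rv z; rewrite ec bopZ rnormZ.
  have c1 : complex.Re `|c| <= 1.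
    have : rnorm (e z) <= 1.
      by rewrite (le_trans (opnormP _ _))// (phi_opnorm (Ark _ _)) opnorm_rk1 rnorm_delta mul1r.
    by rewrite ec rnormZ nv mulr1.
  by rewrite -[leRHS]mul1r ler_wpM2r ?rnorm_ge0.
- by move=> T AT xi; rewrite -bcomp_rk1 (phiM AT (Ark _ _)).
Qed.

Let spatial : exists (s : I -> J) (U : ell I -> ell J),
  [/\ bijective s, linear U,
      forall T, A T -> forall xi, U (T xi) = phi T (U xi) &
      forall xi i, rnorm (U xi (s i) : R[i]^o) = rnorm (xi i : R[i]^o) /\
        exists2 c : R[i], c != 0 & U (delta p1 i) = c *: delta p1 (s i)].
Proof.
have [U [lU iU UT]] := intertwiner.
have UZ c x : U (c *: x) = c *: U x.
  have U0 : U 0 = 0 by apply: rnorm_eq0; rewrite iU rnorm0.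
  by rewrite -[c *: x]addr0 lU U0 addr0.
have UD a b : U (a + b) = U a + U b by rewrite -[a in LHS]scale1r lU scale1r.
have Udisj := isometric_disjoint p2 lU iU.
have split_at (xi : ell I) i : disjoint_supp (xi i *: delta p1 i) (xi - xi i *: delta p1 i).
  move=> k; rewrite ellpZE ellpDE ellpNE ellpZE deltaE.
  case: eqP => [->|_]; last by left; rewrite scaler0.
  by right; rewrite scale_one subrr.
have splitE (xi : ell I) i : xi = xi i *: delta p1 i + (xi - xi i *: delta p1 i).
  by rewrite addrC subrK.
have ne0 (K : choiceType) (x : ell K) : x <> 0 -> exists k, x k != 0.
  move=> x0; apply: contrapT => /forallNP h; apply: x0; apply: ellp_ext => k.
  by apply/eqP/negPn/negP; exact: h.
(* Surjectivity of [phi] makes every basis vector occur. If [phi g] is the matrix unit at (j, j),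
   then U (g xi) is a multiple of delta_j. Split g xi into a nonzero i-th component and the rest:
   the two images are disjoint with sum supported at j, so each is supported at j. *)
have hit j : exists i, exists2 c : R[i], c != 0 & U (delta p1 i) = c *: delta p1 j.
  have [g Ag gE] := phi_surj (Brk (delta p1 j) j).
  have [xi gxi] : exists xi, g xi != 0.
    apply: contrapT => /forallNP h.
    have g0 : g = 0 by apply: bop_ext => z; apply/eqP/negPn/negP; exact: h.
    have := congr1 (fun S : bop (ell J) (ell J) => S (delta p1 j) j) gE.
    by rewrite g0 phi0 rk1_single deltaE eqxx => /eqP; rewrite eq_sym oner_eq0.
  have := UT _ Ag xi; rewrite gE rk1E; set a := g xi; set d := U xi j => Ua.
  have [i ai] : exists i, a i != 0 by apply: ne0; apply/eqP.
  have dis := Udisj _ _ (split_at a i).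
  have Ui k : k != j -> U (delta p1 i) k = 0.
    move=> kj; have := congr1 (fun x : ell J => x k) Ua.
    rewrite {1}(splitE a i) UD ellpDE ellpZE deltaE (negbTE kj) scaler0.
    have [|->] := dis k.
      by rewrite UZ ellpZE => /eqP; rewrite scaler_eq0 (negbTE ai) /= => /eqP.
    by rewrite addr0 UZ ellpZE => /eqP; rewrite scaler_eq0 (negbTE ai) /= => /eqP.
  have UiE : U (delta p1 i) = U (delta p1 i) j *: delta p1 j.
    apply: ellp_ext => k; rewrite ellpZE deltaE; case: eqP => [->|/eqP kj].
      by rewrite scale_one.
    by rewrite scaler0 Ui.
  exists i, (U (delta p1 i) j) => //; apply/eqP => Uj0.
  have := iU (delta p1 i); rewrite UiE Uj0 scale0r rnorm0 rnorm_delta => /eqP.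
  by rewrite eq_sym oner_eq0.
have uniq_hit i i' j : U (delta p1 i) j != 0 -> U (delta p1 i') j != 0 -> i = i'.
  move=> Ui Ui'; apply: contrapT => ii'.
  have : disjoint_supp (delta p1 i) (delta p1 i').
    move=> k; rewrite !deltaE; case: eqP => [->|_]; last by left.
    by case: eqP => // _; right.
  by move=> /Udisj /(_ j)[] /eqP; apply/negP.
(* A coordinate j at which U delta_i is nonzero is also the whole support of some U delta_i';
   disjointness forces i' = i, so U delta_i has one nonzero coordinate. *)
have sex i : exists j, exists2 c : R[i], c != 0 & U (delta p1 i) = c *: delta p1 j.
  have [j Uj] : exists j, U (delta p1 i) j != 0.
    apply: ne0 => U0; have := iU (delta p1 i); rewrite U0 rnorm0 rnorm_delta => /eqP.
    by rewrite eq_sym oner_eq0.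
  have [i' [c c0 Ui']] := hit j; exists j, c => //; rewrite -Ui'.
  congr (U (delta p1 _)); apply: (uniq_hit _ _ j) => //.
  by rewrite Ui' ellpZE deltaE eqxx scale_one.
have [s sP] := choice sex; have [s' s'P] := choice hit.
have at_j i j (c : R[i]) : c != 0 -> U (delta p1 i) = c *: delta p1 j ->
    U (delta p1 i) j != 0.
  by move=> c0 ->; rewrite ellpZE deltaE eqxx scale_one.
exists s, U; split=> //.
  exists s' => [i|j].
    have [c c0 Ui] := sP i; have [c' c'0 Ui'] := s'P (s i).
    by apply: (uniq_hit _ _ (s i)); [exact: at_j Ui'|exact: at_j Ui].
  have [c c0 Uj] := s'P j; have [c' c'0 Uj'] := sP (s' j).
  have := at_j _ _ _ c'0 Uj'; rewrite Uj ellpZE deltaE.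
  by case: (s (s' j) =P j) => [//|_]; rewrite scaler0 eqxx.
move=> xi i; split; last exact: sP.
have [c c0 Ui] := sP i.
have Uc : rnorm (c : R[i]^o) = 1.
  have := iU (delta p1 i); rewrite Ui rnormZ !rnorm_delta mulr1; exact.
have U'0 : U (xi - xi i *: delta p1 i) (s i) = 0.
  have : disjoint_supp (delta p1 i) (xi - xi i *: delta p1 i).
    move=> k; rewrite ellpDE ellpNE ellpZE deltaE.
    case: eqP => [->|_]; last by left.
    by right; rewrite scale_one subrr.
  move=> /Udisj /(_ (s i))[]//.
  by rewrite Ui ellpZE deltaE eqxx scale_one => cz; rewrite cz eqxx in c0.
rewrite {1}(splitE xi i) UD ellpDE U'0 addr0 UZ Ui !ellpZE deltaE eqxx scale_one.
by rewrite [LHS]rnormM Uc mulr1.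
Qed.

Lemma isometric_iso_coef_pointed : exists s : I -> J, bijective s /\
  forall T, A T -> forall i i', rnorm (coef (phi T) (s i) (s i') : R[i]^o) =
                                rnorm (coef T i i' : R[i]^o).
Proof.
have [s [U [bs lU UT Us]]] := spatial.
exists s; split=> // T AT i i'.
have [Ui [c c0 Uc]] := Us (T (delta p1 i')) i'.
have c1 : rnorm (c : R[i]^o) = 1.
  have := (Us (delta p1 i') i').1.
  by rewrite Uc ellpZE !deltaE !eqxx scale_one rnorm1.
rewrite -(Us (T (delta p1 i')) i).1 UT// Uc bopZ ellpZE [RHS]rnormM c1 mul1r//.
Qed.

End base_point.
End rigidity.

Section matching.
Variables (R : realType) (p : R) (p1 : 1 <= p).
Local Notation ell I := (ellp p1 I R[i]^o).

(** All that the geometric arguments retain from an isometric isomorphism: partners are chosen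
    operator by operator, with neither linearity nor multiplicativity. *)
Definition coef_match (I J : choiceType) (A : set (bop (ell I) (ell I)))
    (B : set (bop (ell J) (ell J))) (s : I -> J) : Prop :=
  forall T, A T -> exists2 S, B S &
    forall i i', rnorm (coef S (s i) (s i') : R[i]^o) = rnorm (coef T i i' : R[i]^o).

Lemma isometric_iso_match (p2 : p != 2) (I J : choiceType)
    (A : set (bop (ell I) (ell I))) (B : set (bop (ell J) (ell J))) :
  matrix_unit_algebra A -> matrix_unit_algebra B -> isometrically_isomorphic A B ->
  exists (s : I -> J) (s' : J -> I),
    [/\ cancel s s', cancel s' s, coef_match A B s & coef_match B A s'].
Proof.
move=> algA algB [phi [bij phiP phiM phiN]].
(* The corner argument needs a base index. If [I] is empty, the only operator is 0, so [B] contains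
   only [phi 0 = 0], and a matrix unit would contradict this if [J] had a point. *)
have [[i0 _]|noI] := pselect (exists o : I, True).
  have [s [[s' sK s'K] sE]] :=
    isometric_iso_coef_pointed p2 algA algB bij phiP phiM phiN i0.
  exists s, s'; split=> //.
    by move=> T AT; exists (phi T); [case: bij => + _ _; exact|exact: sE].
  move=> S BS; have [T AT <-] : exists2 T, A T & phi T = S by case: bij => _ _; exact.
  by exists T => // j j'; rewrite -sE// !s'K.
have nI (i : I) : False by apply: noI; exists i.
have all0 (T : bop (ell I) (ell I)) : T = 0 by apply: bop_single_ext => i; case: (nI i).
have nJ (j : J) : False.
  have [T AT TE] : exists2 T, A T & phi T = rk1 p1 (delta p1 j) j.
    by case: bij => _ _; apply; exact: rk1_mem.
  have AO : A 0 by case: algA => -[].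
  have phi0 : phi 0 = 0.
    by have := phiP (-1) _ _ AO AO; rewrite scaler0 addr0 scaleN1r addNr.
  have := congr1 (fun S : bop (ell J) (ell J) => S (delta p1 j) j) TE.
  rewrite (all0 T) phi0 rk1_single deltaE eqxx => /eqP.
  by rewrite eq_sym oner_eq0.
exists (fun i => False_rect J (nI i)), (fun j => False_rect I (nJ j)); split.
- by move=> i; case: (nI i).
- by move=> j; case: (nJ j).
- move=> T AT; exists 0; first by case: algB => -[].
  by move=> i; case: (nI i).
- move=> T AT; exists 0; first by case: algA => -[].
  by move=> j; case: (nJ j).
Qed.

End matching.

(** * Coarse geometry from matrix coefficients *)

Section coarse_maps.
Variable R : realType.

Lemma bounded_geometry_seq (X : metricType R) (r : R) : bounded_geometry X -> 0 <= r ->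
  exists (N : nat) (L : X -> seq X), forall x,
    [/\ uniq (L x), (size (L x) <= N)%N & forall y, (y \in L x) = (mdist x y <= r)].
Proof.
move=> bX r0; have [N hN] := bX r r0; exists N.
exists (fun x => finmap.enum_fset (fset_set [set y | mdist x y <= r])) => x; split.
- exact: finmap.fset_uniq.
- exact: geq_card_fset_set.
- move=> y; have fin : finite_set [set y | mdist x y <= r].
    by apply/finite_set_leP; exists N.
  transitivity (y \in [set y | mdist x y <= r]); first exact: in_fset_set.
  by apply/idP/idP; rewrite inE.
Qed.

Lemma uniform_bound (n : nat) (P : nat -> R -> Prop) :
  (forall k r s, P k r -> r <= s -> P k s) -> (forall k, exists r, P k r) ->
  exists r, forall k, (k < n)%N -> P k r.
Proof.
move=> mono ex; elim: n => [|n [r hr]]; first by exists 0.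
have [s hs] := ex n; exists (Num.max r s) => k; rewrite ltnS leq_eqVlt => /orP[/eqP->|kn].
  by apply: mono hs _; rewrite le_max lexx orbT.
by apply: mono (hr _ kn) _; rewrite le_max lexx.
Qed.

(** The pair (k, l) records the rank of x' in the ball around x and the rank of x in the ball around
    x'. The second rank recovers x from x', hence injectivity; both ranks are below the size bound
    of the balls. *)
Lemma bounded_geometry_partial_inj (X : metricType R) (r : R) :
  bounded_geometry X -> 0 <= r ->
  exists (N : nat) (h : nat -> nat -> X -> option X),
    [/\ forall k l, partial_inj (h k l),
        forall k l x x', h k l x = Some x' -> mdist x x' <= r &
        forall x x', mdist x x' <= r -> exists k l, [/\ (k < N)%N, (l < N)%N & h k l x = Some x']].
Proof.
move=> bX r0; have [N [L hL]] := bounded_geometry_seq bX r0; exists N.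
pose h k l x := if (k < size (L x))%N && (l < size (L (nth x (L x) k)))%N &&
  (nth x (L (nth x (L x) k)) l == x) then Some (nth x (L x) k) else None.
exists h; split.
- move=> k l x1 x2 x'; rewrite /h.
  case: ifP => // /andP[/andP[_ l1] /eqP e1] [x1'].
  case: ifP => // /andP[/andP[_ l2] /eqP e2] [x2'].
  move: l1 l2 e1 e2; rewrite x1' x2' => l1 l2 <- <-; exact: set_nth_default.
- move=> k l x x'; rewrite /h; case: ifP => // /andP[/andP[kL _] _] [<-].
  by have [_ _ <-] := hL x; exact: mem_nth.
- move=> x x' d; have [_ sN mem] := hL x; have [_ sN' mem'] := hL x'.
  have xL : x' \in L x by rewrite mem.
  have xL' : x \in L x' by rewrite mem' metric_sym.
  exists (index x' (L x)), (index x (L x')); split.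
  + by rewrite (leq_trans _ sN)// index_mem.
  + by rewrite (leq_trans _ sN')// index_mem.
  + by rewrite /h index_mem xL/= (nth_index _ xL) index_mem xL' (nth_index _ xL') eqxx.
Qed.

Lemma finite_argmax (T : choiceType) (K : set T) (f : T -> R) : finite_set K ->
  K !=set0 -> exists2 t, K t & forall t', K t' -> f t' <= f t.
Proof.
move=> /finite_seqP[s ->]; elim: s => [[t]//|a s ih _].
have [[t ts]|none] := pselect ([set` s] !=set0).
  have [m ms mP] := ih (ex_intro _ t ts).
  have [le|gt] := lerP (f m) (f a).
    exists a => /=; first by rewrite mem_head.
    move=> t'; rewrite /= inE => /orP[/eqP->//|t's].
    by rewrite (le_trans _ le)// mP.
  exists m => /=; first by rewrite inE [m \in s]ms orbT.
  move=> t'; rewrite /= inE => /orP[/eqP->|t's]; [exact: ltW|exact: mP].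
exists a => /=; first by rewrite mem_head.
move=> t'; rewrite /= inE => /orP[/eqP->//|t's].
by exfalso; apply: none; exists t'.
Qed.

Lemma coarse_equivalence_intro (X Y : metricType R) (f : X -> Y) (g : Y -> X) :
  uniformly_expansive f -> uniformly_expansive g -> close_maps (f \o g) id ->
  close_maps (g \o f) id -> coarse_equivalence f.
Proof. by move=> uf ug fg gf; split=> //; exists g. Qed.

End coarse_maps.

Section coarse_from_match.
Variables (R : realType) (p : R) (p1 : 1 <= p).
Local Notation ell I := (ellp p1 I R[i]^o).
(** The threshold 1 is met by the 0-1 matrices of partial translations, while an operator at norm
    distance less than 1 from one of finite propagation meets it only within that propagation. *)
Local Notation large T i j := (1 <= rnorm (coef T i j : R[i]^o)).

Definition has_translations (X : metricType R) (I : choiceType)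
    (A : set (bop (ell I) (ell I))) (s : X -> I) : Prop :=
  forall r (h : X -> option X), partial_inj h ->
    (forall x x', h x = Some x' -> mdist x x' <= r) ->
    exists2 T, A T & forall x x', h x = Some x' -> large T (s x) (s x').

Definition coarsely_controlled (X : metricType R) (I : choiceType)
    (A : set (bop (ell I) (ell I))) (pi : I -> X) : Prop :=
  forall T, A T -> exists r : R, forall i j, large T i j -> mdist (pi i) (pi j) <= r.

(** The finiteness clause stands for compactness of the entries. Moves are requested only towards
    large diagonal coefficients of a given operator, because in the stabilised algebras this bounds
    the levels of [t] uniformly, and only such moves are shown to be available there. *)
Definition has_fibre_moves (X : metricType R) (I : choiceType)
    (A : set (bop (ell I) (ell I))) (pi : I -> X) (s : X -> I) : Prop :=
  forall T, A T ->
    (forall x, finite_set [set i | pi i = x /\ large T i i]) /\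
    forall t : X -> I, (forall x, pi (t x) = x) ->
      (forall x, t x = s x \/ large T (t x) (t x)) ->
      exists2 D, A D & forall x, large D (t x) (s x).

(** Each translation yields one operator and hence one bound for all pairs it contains. Finitely
    many translations cover the pairs at distance at most r, and the largest bound serves. *)
Lemma uniformly_expansive_match (X Y : metricType R) (I J : choiceType)
    (A : set (bop (ell I) (ell I))) (B : set (bop (ell J) (ell J)))
    (s : X -> I) (pi : J -> Y) (sg : I -> J) :
  bounded_geometry X -> has_translations A s -> coarsely_controlled B pi ->
  coef_match A B sg -> uniformly_expansive (pi \o sg \o s).
Proof.
move=> bX tA cB m r r0.
have [N [h [hi hd hN]]] := bounded_geometry_partial_inj bX (ltW r0).
pose P k l (u : R) := forall x x', h k l x = Some x' ->
  mdist (pi (sg (s x))) (pi (sg (s x'))) <= u.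
have Pkl k l : exists u, P k l u.
  have [T AT hT] := tA r (h k l) (hi k l) (hd k l).
  have [S BS hS] := m T AT; have [u hu] := cB S BS.
  by exists u => x x' /hT e; apply: hu; rewrite hS.
have Pk k : exists u, forall l, (l < N)%N -> P k l u.
  apply: uniform_bound => //.
  by move=> l u v Pu uv x x' /Pu h'; exact: le_trans h' uv.
have [u hu] : exists u, forall k, (k < N)%N -> forall l, (l < N)%N -> P k l u.
  apply: (uniform_bound N) => //.
  by move=> k u v Pu uv l lN x x' /(Pu l lN) h'; exact: le_trans h' uv.
exists (`|u| + 1); first by rewrite ltr_wpDl.
move=> x x' /hN[k [l [kN lN hkl]]] /=.
by rewrite (le_trans (hu k kN l lN _ _ hkl))// (le_trans (ler_norm u))// lerDl.
Qed.

(** The points x landing over a given y must be shown close to g y, uniformly in y. Their indices sg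
    (s x) all lie in the finite set over y where one operator S has large diagonal coefficients. Let
    t y be the element of that set whose image under [pi \o sg'] is farthest from g y. A single
    operator joining s' y to t y for all y simultaneously, carried back to A, bounds this worst
    distance. *)
Lemma close_match (X Y : metricType R) (I J : choiceType)
    (A : set (bop (ell I) (ell I))) (B : set (bop (ell J) (ell J)))
    (s : X -> I) (pi : I -> X) (s' : Y -> J) (pi' : J -> Y)
    (sg : I -> J) (sg' : J -> I) :
  (forall x, pi (s x) = x) -> (forall y, pi' (s' y) = y) ->
  has_translations A s -> coarsely_controlled A pi -> has_fibre_moves B pi' s' ->
  cancel sg sg' -> coef_match A B sg -> coef_match B A sg' ->
  close_maps ((pi \o sg' \o s') \o (pi' \o sg \o s)) id.
Proof.
move=> piK pi'K tA cA fB sgK mAB mBA.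
have [T AT hT] : exists2 T, A T & forall x, large T (s x) (s x).
  have [||T AT hT] := tA 0 Some.
  - by move=> x x' z [->] [->].
  - by move=> x _ [<-]; rewrite mdistxx.
  by exists T => // x; exact: hT.
have [S BS hS] := mAB T AT; have [finS moveS] := fB S BS.
pose K y := [set j | pi' j = y /\ large S j j].
pose g y := pi (sg' (s' y)).
have ex y : exists j, [/\ pi' j = y, j = s' y \/ large S j j &
    forall k, K y k -> mdist (g y) (pi (sg' k)) <= mdist (g y) (pi (sg' j))].
  have [Ky|none] := pselect (K y !=set0).
    have [j [yj lj] jmax] := finite_argmax (fun j => mdist (g y) (pi (sg' j))) (finS y) Ky.
    by exists j; split=> //; right.
  (* Fibres without large diagonal coefficients receive the trivial move, and maximality is vacuous
     there. *)
  exists (s' y); split=> //; first by left.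
  by move=> j Kj; exfalso; apply: none; exists j.
have [t tP] := choice ex.
have [||D BD hD] := moveS t.
- by move=> y; case: (tP y).
- by move=> y; case: (tP y).
have [T' AT' hT'] := mBA D BD; have [r hr] := cA T' AT'.
exists (`|r| + 1) => [|x]; first by rewrite ltr_wpDl.
set y := pi' (sg (s x)).
have Kx : K y (sg (s x)) by split=> //; rewrite hS.
have [_ _ /(_ _ Kx)] := tP y; rewrite sgK piK => h.
rewrite /= -/y -/(g y) (le_trans h)// metric_sym.
have : mdist (pi (sg' (t y))) (pi (sg' (s' y))) <= r by apply: hr; rewrite hT'.
by move=> /le_trans; apply; rewrite (le_trans (ler_norm r))// lerDl.
Qed.

(* pi is the projection of the set of matrix indices onto the space, s a section. *)
Definition roe_like (X : metricType R) (I : choiceType)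
    (A : set (bop (ell I) (ell I))) (pi : I -> X) (s : X -> I) : Prop :=
  [/\ matrix_unit_algebra A, has_translations A s, coarsely_controlled A pi,
      has_fibre_moves A pi s & forall x, pi (s x) = x].

Lemma roe_like_rigid (p2 : p != 2) (X Y : metricType R) (I J : choiceType)
    (A : set (bop (ell I) (ell I))) (B : set (bop (ell J) (ell J)))
    (s : X -> I) (pi : I -> X) (s' : Y -> J) (pi' : J -> Y) :
  bounded_geometry X -> bounded_geometry Y ->
  roe_like A pi s -> roe_like B pi' s' -> isometrically_isomorphic A B ->
  coarsely_equivalent X Y.
Proof.
move=> bX bY [uA tA cA fA sA] [uB tB cB fB sB] iso.
have [sg [sg' [sgK sgK' mAB mBA]]] := isometric_iso_match p2 uA uB iso.
exists (pi' \o sg \o s); apply: (@coarse_equivalence_intro _ _ _ _ (pi \o sg' \o s')).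
- exact: uniformly_expansive_match bX tA cB mAB.
- exact: uniformly_expansive_match bY tB cA mBA.
- exact: close_match sB sA tB cB fA sgK' mBA mAB.
- exact: close_match sA sB tA cA fB sgK mAB mBA.
Qed.

Lemma uniform_roe_like_rigid (p2 : p != 2) (X Y : metricType R)
    (A : set (bop (ell X) (ell X))) (B : set (bop (ell Y) (ell Y))) :
  bounded_geometry X -> bounded_geometry Y ->
  matrix_unit_algebra A -> has_translations A id -> coarsely_controlled A id ->
  matrix_unit_algebra B -> has_translations B id -> coarsely_controlled B id ->
  isometrically_isomorphic A B -> bijectively_coarsely_equivalent X Y.
Proof.
move=> bX bY uA tA cA uB tB cB iso.
have [sg [sg' [sgK sgK' mAB mBA]]] := isometric_iso_match p2 uA uB iso.
exists sg; split; last by exists sg'.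
have close0 (Z : metricType R) (h : Z -> Z) : h =1 id -> close_maps h id.
  by move=> hE; exists 1 => // z; rewrite hE mdistxx.
apply: (@coarse_equivalence_intro _ _ _ _ sg'); last 2 first.
- exact: close0.
- exact: close0.
- exact: (uniformly_expansive_match bX tA cB mAB).
- exact: (uniformly_expansive_match bY tB cA mBA).
Qed.

End coarse_from_match.

(** * Roe algebras *)

Section supports.
Variables (R : realType) (p : R) (p1 : 1 <= p).
Local Notation ell I := (ellp p1 I R[i]^o).

Lemma eval_linear (X : choiceType) (E : normedModType R[i]) (x : X) :
  linear (fun v : ellp p1 X E => v x).
Proof. by []. Qed.

Lemma eval_bounded (X : choiceType) (E : normedModType R[i]) (x : X) (v : ellp p1 X E) :
  rnorm (v x) <= 1 * rnorm v.
Proof. by rewrite mul1r ellp_coord. Qed.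

Definition eval_op (X : choiceType) (E : normedModType R[i]) (x : X) : bop (ellp p1 X E) E :=
  mkbop (@eval_linear X E x) (@eval_bounded X E x).

(** An entry of a product is an infinite sum; it vanishes because the bounded map v |-> (S v) x
    kills every component of T (single y e). *)
Lemma entry_bcomp_eq0 (X : choiceType) (E : normedModType R[i])
    (S T : bop (ellp p1 X E) (ellp p1 X E)) x y :
  (forall z, entry S x z = 0 \/ entry T z y = 0) -> entry (bcomp S T) x y = 0.
Proof.
move=> h; apply: bop_ext => e.
apply: (@bop_single_eq0 _ _ p1 _ _ _ (bcomp (eval_op E x) S) (T (single p1 y e))) => z.
change (entry S x z (entry T z y e) = 0).
by have [->|->] := h z; rewrite ?bop0.
Qed.

Lemma coef_bcomp_ne0 (I : choiceType) (S T : bop (ell I) (ell I)) i k :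
  coef (bcomp S T) i k != 0 -> exists j, coef S i j != 0 /\ coef T j k != 0.
Proof.
rewrite -entry_coef => ne; apply: contrapT => /forallNP h; move/eqP: ne; apply.
apply: entry_bcomp_eq0 => j; have := h j; rewrite -!entry_coef => /not_andP.
by case=> /negP; rewrite negbK => /eqP; [left|right].
Qed.

Section propagation.
Variables (X : metricType R) (E : normedModType R[i]).
Implicit Types S T : bop (ellp p1 X E) (ellp p1 X E).

Lemma finite_propagationP T : finite_propagation T <->
  exists r : R, forall x y, entry T x y != 0 -> mdist x y <= r.
Proof.
rewrite /finite_propagation /propagation; set D := [set _ | _ in _].
split=> [h|[r hr]]; last first.
  apply: (@le_lt_trans _ _ r%:E); last exact: ltry.
  by apply: ge_ereal_sup => _ [[x y] /= ne <-]; rewrite lee_fin hr.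
(* The supremum is [-oo] only if no entry is nonzero, and then any bound serves. *)
case s : (ereal_sup D) h => [r| |]// _; [exists r|exists 0] => x y ne.
- by rewrite -lee_fin -s; apply: ereal_sup_ubound; exists (x, y).
- have : ((mdist x y)%:E <= ereal_sup D)%E by apply: ereal_sup_ubound; exists (x, y).
  by rewrite s leeNy_eq.
Qed.

Lemma finite_propagation0 : finite_propagation (0 : bop (ellp p1 X E) (ellp p1 X E)).
Proof.
apply/finite_propagationP; exists 0 => x y /eqP[]; exact: bop_ext.
Qed.

Lemma entryP c S T x y : entry (c *: S + T) x y = c *: entry S x y + entry T x y.
Proof. by apply: bop_ext. Qed.

Lemma finite_propagation_lin c S T : finite_propagation S -> finite_propagation T ->
  finite_propagation (c *: S + T).
Proof.
move=> /finite_propagationP[r hr] /finite_propagationP[s hs].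
apply/finite_propagationP; exists (Num.max r s) => x y; rewrite entryP le_max => ne.
have [S0|Sn] := eqVneq (entry S x y) 0; last by rewrite hr.
by rewrite hs ?orbT//; apply: contra_neq ne => ->; rewrite S0 scaler0 addr0.
Qed.

Lemma finite_propagation_comp S T : finite_propagation S -> finite_propagation T ->
  finite_propagation (bcomp S T).
Proof.
move=> /finite_propagationP[r hr] /finite_propagationP[s hs].
apply/finite_propagationP; exists (r + s) => x y ne.
have [z [Sz Tz]] : exists z, entry S x z != 0 /\ entry T z y != 0.
  apply: contrapT => /forallNP h; move/eqP: ne; apply; apply: entry_bcomp_eq0 => z.
  by have := h z => /not_andP[] /negP; rewrite negbK => /eqP; [left|right].
by rewrite (le_trans (metric_triangle x z y))// lerD ?hr ?hs.
Qed.

Lemma large_coef_approx (Y : choiceType) (T S : bop (ell Y) (ell Y)) (e : R) i j :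
  opnorm (T - S) < e -> e <= rnorm (coef T i j : R[i]^o) -> coef S i j != 0.
Proof.
move=> lt le; apply/eqP => S0; have := coef_le (T - S) i j.
by rewrite opcoefB S0 subr0 => h; have := le_lt_trans (le_trans le h) lt; rewrite ltxx.
Qed.

End propagation.

Section uniform_roe.
Variable X : metricType R.

Lemma CuP (T : bop (ell X) (ell X)) : Cu p1 X T <->
  exists r : R, forall x y, coef T x y != 0 -> mdist x y <= r.
Proof.
rewrite /Cu/=; split=> [/finite_propagationP[r hr]|[r hr]].
  by exists r => x y; rewrite -entry_coef; exact: hr.
by apply/finite_propagationP; exists r => x y; rewrite entry_coef; exact: hr.
Qed.

Lemma Cu_subalgebra : is_subalgebra (Cu p1 X).
Proof.
split; first exact: finite_propagation0.
  exact: finite_propagation_lin.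
exact: finite_propagation_comp.
Qed.

Lemma coef_rk1 (I : choiceType) (i j k l : I) :
  coef (rk1 p1 (delta p1 i) j) k l = ((k == i) && (l == j))%:R.
Proof.
rewrite /coef rk1E ellpZE deltaE singleE eq_sym.
by case: (l == j); case: (k == i); rewrite ?scaler0 ?scale0r ?scale_one.
Qed.

Lemma Cu_rk1 (x y : X) : Cu p1 X (rk1 p1 (delta p1 x) y).
Proof.
apply/CuP; exists (mdist x y) => x' y'; rewrite coef_rk1.
by case: (x' =P x) => [->|_]; case: (y' =P y) => [->|_]; rewrite //= eqxx.
Qed.

Lemma Cu_pinj r (h : X -> option X) (hi : partial_inj h) :
  (forall x x', h x = Some x' -> mdist x x' <= r) -> Cu p1 X (pinj p1 R[i]^o hi).
Proof.
move=> hr; apply/CuP; exists r => x x'; rewrite coef_pinj.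
by case: (h x =P Some x') => [/hr//|]; rewrite eqxx.
Qed.

Lemma Bu_matrix_unit_algebra : matrix_unit_algebra (Bu p1 X).
Proof.
split; first exact: closure_subalgebra Cu_subalgebra.
  exact: closure_norm_closed.
by move=> x y; apply: subset_bop_closure; exact: Cu_rk1.
Qed.

Lemma Bu_has_translations : has_translations (Bu p1 X) id.
Proof.
move=> r h hi hr; exists (pinj p1 R[i]^o hi).
  by apply: subset_bop_closure; exact: Cu_pinj hr.
by move=> x x' hx; rewrite coef_pinj hx eqxx rnorm1.
Qed.

Lemma Bu_coarsely_controlled : coarsely_controlled (Bu p1 X) id.
Proof.
move=> T /bop_closureP /(_ 1 ltr01)[S /CuP[r hr] lt]; exists r => x y le.
by apply: hr; exact: large_coef_approx lt le.
Qed.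

End uniform_roe.
End supports.

Section fibre_maps.
Variables (X : Type) (S : eqType) (f0 : S).

(** Read backwards by [pinj], this gives the operator sending delta_(x, f0) to delta_(x, t x):
    propagation 0, with a prescribed level in each fibre. *)
Definition move_map (t : X -> S) (k : X * S) : option (X * S) :=
  if k.2 == t k.1 then Some (k.1, f0) else None.

Lemma move_map_inj t : partial_inj (move_map t).
Proof.
move=> [x m] [x' m'] [y n]; rewrite /move_map/=.
by case: (m =P t x) => // -> [-> _]; case: (m' =P t x') => // -> [->].
Qed.

(** The operator of [h] tensored with the matrix unit at (f0, f0). *)
Definition lift_map (h : X -> option X) (k : X * S) : option (X * S) :=
  if k.2 == f0 then omap (fun x => (x, f0)) (h k.1) else None.

Lemma lift_map_inj h : partial_inj h -> partial_inj (lift_map h).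
Proof.
move=> hi [x m] [x' m'] [y n]; rewrite /lift_map/=.
case: (m =P f0) => // ->; case e : (h x) => [z|]//= [zy _].
case: (m' =P f0) => // ->; case e' : (h x') => [z'|]//= [z'y _].
by congr (_, _); apply: hi e _; rewrite e' z'y zy.
Qed.

End fibre_maps.

(** * Stable algebras lying between corner operators and tight operators *)

Section tight_operators.
Variables (R : realType) (p : R) (p1 : 1 <= p) (X : metricType R).
Local Notation ell I := (ellp p1 I R[i]^o).
Local Notation op := (bop (ell (X * nat)%type) (ell (X * nat)%type)).

(** A norm-closed condition shared by both stabilised algebras. It bounds row levels, which is what
    diagonal coefficients require; columns need not decay when p = 1, as the idempotent with first
    row (1, 1, 1, ...) and other rows 0 shows. *)
Definition tight (T : op) : Prop := forall e : R, 0 < e -> exists (r : R) (N : nat),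
  forall k l, e <= rnorm (coef T k l : R[i]^o) -> mdist k.1 l.1 <= r /\ (k.2 < N)%N.

Definition corner_op (T : op) : Prop := exists (r : R) (N : nat),
  forall k l, coef T k l != 0 -> [/\ mdist k.1 l.1 <= r, (k.2 < N)%N & (l.2 < N)%N].

Lemma tight0 : tight 0.
Proof.
move=> e e0; exists 0, 0%N => k l; have -> : coef (0 : op) k l = 0 by [].
by rewrite rnorm0 leNgt e0.
Qed.

Lemma tight_lin c S T : tight S -> tight T -> tight (c *: S + T).
Proof.
move=> tS tT e e0.
have e2 : 0 < e / 2 by rewrite divr_gt0.
have c1 : 0 < rnorm (c : R[i]^o) + 1 by rewrite ltr_wpDl// rnorm_ge0.
have [r [N hS]] := tS (e / 2 / (rnorm (c : R[i]^o) + 1)) (divr_gt0 e2 c1).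
have [r' [N' hT]] := tT (e / 2) e2.
exists (Num.max r r'), (maxn N N') => k l; rewrite opcoefD opcoefZ => le.
have [leS|ltS] := leP (e / 2 / (rnorm (c : R[i]^o) + 1)) (rnorm (coef S k l : R[i]^o)).
  by have [d n] := hS _ _ leS; rewrite le_max d leq_max n.
have [leT|ltT] := leP (e / 2) (rnorm (coef T k l : R[i]^o)).
  by have [d n] := hT _ _ leT; rewrite le_max d leq_max n !orbT.
exfalso; move: le; apply/negP; rewrite -ltNge (le_lt_trans (@rnormD R R[i]^o _ _))//.
rewrite (splitr e) ler_ltD// rnormM.
move: ltS; rewrite ltr_pdivlMr// => /ltW; apply: le_trans.
by rewrite mulrC ler_wpM2l ?rnorm_ge0// lerDl.
Qed.

Lemma tight_norm_closed : norm_closed tight.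
Proof.
move=> T h e e0; have e2 : 0 < e / 2 by rewrite divr_gt0.
have [S tS lt] := h _ e2; have [r [N hS]] := tS _ e2.
exists r, N => k l le; apply: hS; rewrite leNgt; apply/negP => ltS.
have := le_lt_trans (coef_le (T - S) k l) lt; rewrite opcoefB => lt'.
have : rnorm (coef T k l : R[i]^o) <=
    rnorm (coef T k l - coef S k l : R[i]^o) + rnorm (coef S k l : R[i]^o).
  by rewrite -[in leLHS](subrK (coef S k l) (coef T k l)); exact: (@rnormD R R[i]^o).
by rewrite leNgt (lt_le_trans _ le)// (splitr e) ltrD.
Qed.

Lemma tight_coarsely_controlled (A : set op) :
  (forall T, A T -> tight T) -> coarsely_controlled A fst.
Proof.
move=> tA T /tA /(_ 1 ltr01)[r [N h]]; exists r => k l /h[]//.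
Qed.

Local Notation move_map := (@move_map X nat 0%N).
Local Notation lift_map := (@lift_map X nat 0%N).

Lemma corner_op_move t N : (forall x, (t x < N)%N) ->
  corner_op (pinj p1 R[i]^o (@move_map_inj X nat 0%N t)).
Proof.
move=> tN; exists 0, N.+1 => -[x m] [x' m']; rewrite coef_pinj /move_map /=.
case: (m =P t x) => [->|_]; last by rewrite eqxx.
case: (_ =P Some (x', m')) => [[<- <-] _|_]; last by rewrite eqxx.
by split; rewrite ?mdistxx// ltnW// ltnS.
Qed.

Lemma corner_op_lift r h (hi : partial_inj h) :
  (forall x x', h x = Some x' -> mdist x x' <= r) ->
  corner_op (pinj p1 R[i]^o (@lift_map_inj X nat 0%N h hi)).
Proof.
move=> hr; exists r, 1%N => -[x m] [x' m']; rewrite coef_pinj /lift_map /=.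
case: (m =P 0%N) => [->|_]; last by rewrite eqxx.
case e : (h x) => [y|]; last by rewrite eqxx.
case: (_ =P Some (x', m')) => [[<- <-] _|_]; last by rewrite eqxx.
by split=> //; exact: hr.
Qed.

Lemma corner_op_rk1 k l : corner_op (rk1 p1 (delta p1 k) l).
Proof.
exists (mdist k.1 l.1), (maxn k.2 l.2).+1 => k' l'; rewrite coef_rk1.
case: (k' =P k) => [->|_]; case: (l' =P l) => [->|_]; rewrite ?eqxx//= => _.
by split=> //; rewrite ltnS leq_max leqnn ?orbT.
Qed.

(** The lower bound supplies matrix units, translations at level 0 and fibre moves of bounded level.
    The upper bound supplies coarse control and confines large diagonal coefficients to levels below
    some N, so the requested moves do have bounded level. *)
Lemma corner_roe_like (A : set op) : is_subalgebra A -> norm_closed A ->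
  (forall T, A T -> tight T) -> (forall T, corner_op T -> A T) ->
  roe_like A fst (fun x => (x, 0%N)).
Proof.
move=> sA cA tA kA; split=> //.
- by split=> // k l; apply: kA; exact: corner_op_rk1.
- move=> r h hi hr; exists (pinj p1 R[i]^o (@lift_map_inj X nat 0%N h hi)).
    by apply: kA; exact: corner_op_lift hr.
  by move=> x x' hx; rewrite coef_pinj /lift_map /= hx /= eqxx rnorm1.
- exact: tight_coarsely_controlled.
- move=> T AT; have [r [N h]] := tA T AT 1 ltr01; split.
    move=> x; apply: (@sub_finite_set _ _ ((fun n => (x, n)) @` `I_N)).
      by move=> [y n] /= [-> /h[_ /= nN]]; exists n.
    exact/finite_image/finite_II.
  move=> t tx tP.
  pose t2 x := (t x).2.
  have tE x : t x = (x, t2 x) by rewrite /t2 -{2}(tx x) -surjective_pairing.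
  exists (pinj p1 R[i]^o (@move_map_inj X nat 0%N t2)).
    apply: kA; apply: (@corner_op_move _ N.+1) => x; rewrite /t2.
    by have [->//|/h[_ /= lt]] := tP x; rewrite ltnS ltnW.
  by move=> x; rewrite coef_pinj /move_map tE /= eqxx eqxx rnorm1.
Qed.

End tight_operators.

Section linear_spans.
Variables (R : realType) (V : lmodType R[i]).
Implicit Types A P : set V.

Lemma lin_span_mem A v : A v -> lin_span A v.
Proof.
move=> Av; exists 1%N, (fun=> v); split=> //; exists (fun=> 1) => //.
by rewrite big_ord1 scale1r.
Qed.

Lemma lin_span0 A : lin_span A 0.
Proof.
exists 0%N, (fun=> 0); split=> [[]//|]; exists (fun=> 0) => //.
by rewrite big_ord0.
Qed.

Lemma lin_span_lin A c u v : lin_span A u -> lin_span A v -> lin_span A (c *: u + v).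
Proof.
move=> [n [e [Ae [a _ <-]]]] [m [f [Af [b _ <-]]]].
exists (n + m)%N, (fun i => match fintype.split i with inl j => e j | inr j => f j end).
split=> [i|]; first by case: (fintype.split i).
exists (fun i => match fintype.split i with inl j => c * a j | inr j => b j end) => //.
rewrite big_split_ord /=; congr (_ + _).
  rewrite scaler_sumr; apply: eq_bigr => i _.
  by rewrite (unsplitK (inl i : 'I_n + 'I_m)) scalerA.
by apply: eq_bigr => i _; rewrite (unsplitK (inr i : 'I_n + 'I_m)).
Qed.

Lemma lin_span_ind A P : P 0 -> (forall c u v, P u -> P v -> P (c *: u + v)) ->
  (forall v, A v -> P v) -> forall v, lin_span A v -> P v.
Proof.
move=> P0 Plin AP v [n [e [Ae [a _ <-]]]].
elim: (index_enum _) => [|i s ih]; first by rewrite big_nil.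
by rewrite big_cons; apply: Plin => //; exact: AP.
Qed.

End linear_spans.

Section finite_functionals.
Variables (R : realType) (p : R) (p1 : 1 <= p) (I : choiceType).
Local Notation ell I := (ellp p1 I R[i]^o).

Lemma bop_finite_support (F : normedModType R[i]) (f : bop (ell I) F) (s : seq I) v :
  uniq s -> (forall j, j \notin s -> f (delta p1 j) = 0) ->
  f v = \sum_(j <- s) v j *: f (delta p1 j).
Proof.
move=> us h.
have -> : \sum_(j <- s) v j *: f (delta p1 j) = f (\sum_(j <- s) v j *: delta p1 j).
  by rewrite bop_sumr; apply: eq_bigr => j _; rewrite bopZ.
apply/eqP; rewrite -subr_eq0 -bopB; apply/eqP; apply: bop_single_eq0 => i.
rewrite single_scale1 bopZ ellpDE ellpNE ellp_sumE.
have [si|sn] := boolP (i \in s); last by rewrite h// scaler0.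
suff -> : \sum_(j <- s) (v j *: delta p1 j) i = v i by rewrite subrr scale0r.
rewrite (bigD1_seq i)// big1 => [|j ji].
  by rewrite ellpZE deltaE eqxx scale_one; exact: addr0.
by rewrite ellpZE deltaE eq_sym (negbTE ji) scaler0.
Qed.

End finite_functionals.

Section corner_matrices.
Variables (R : realType) (p : R) (p1 : 1 <= p).
Local Notation ell I := (ellp p1 I R[i]^o).

Lemma corner_matricesP n (T : bop (ell nat) (ell nat)) :
  corner_matrices n T <-> forall i j, coef T i j != 0 -> (i < n)%N /\ (j < n)%N.
Proof.
split=> [[M hM] i j ne|h].
  have [Tlt Tge] := hM (delta p1 j).
  have ni : (i < n)%N.
    by rewrite ltnNge; apply: contra ne => /Tge e; apply/eqP.
  split=> //; rewrite ltnNge; apply: contra ne => nj; apply/eqP.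
  have -> : coef T i j = T (delta p1 j) (Ordinal ni) by [].
  rewrite Tlt big1// => k _.
  rewrite deltaE; case: eqP => [kj|_]; last by rewrite mulr0.
  by have := ltn_ord k; rewrite kj ltnNge nj.
exists (\matrix_(i, j) coef T i j) => v; split.
  move=> i.
  have -> : T v i = \sum_(j <- iota 0 n) v j * coef T i j.
    apply: (bop_finite_support (f := bcomp (eval_op p1 _ (i : nat)) T)).
      exact: iota_uniq.
    move=> j; rewrite mem_iota add0n /= -leqNgt => nj; apply/eqP; apply: contraLR nj.
    by move=> /h[_]; rewrite ltnNge.
  have -> : iota 0 n = index_iota 0 n by rewrite /index_iota subn0.
  by rewrite big_mkord; apply: eq_bigr => j _; rewrite mxE mulrC.
move=> i ni.
have -> : T v i = \sum_(j <- [::]) v j * coef T i j.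
  apply: (bop_finite_support (f := bcomp (eval_op p1 _ (i : nat)) T)) => // j _.
  by apply/eqP/negPn/negP => /h[]; rewrite ltnNge ni.
by rewrite big_nil.
Qed.

Definition finite_matrix (T : bop (ell nat) (ell nat)) : Prop :=
  exists n, forall i j, coef T i j != 0 -> (i < n)%N /\ (j < n)%N.

Lemma Mbar_inftyE : Mbar_infty p1 = closure finite_matrix.
Proof.
congr closure; apply/seteqP; split => T.
  by move=> [n _ /corner_matricesP h]; exists n.
by move=> [n h]; exists n => //; apply/corner_matricesP.
Qed.

Lemma finite_matrix_subalgebra : is_subalgebra finite_matrix.
Proof.
split.
- by exists 0%N => i j /eqP[].
- move=> c S T [n hn] [m hm]; exists (maxn n m) => i j; rewrite opcoefD opcoefZ => ne.
  have [S0|Sn] := eqVneq (coef S i j) 0.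
    have [|im jm] := hm i j; last by rewrite !leq_max im jm !orbT.
    by apply: contra_neq ne => ->; rewrite S0 mulr0 addr0.
  by have [im jm] := hn i j Sn; rewrite !leq_max im jm.
- move=> S T [n hn] [m hm]; exists (maxn n m) => i k /coef_bcomp_ne0[j [/hn[ni _] /hm[_ mk]]].
  by rewrite !leq_max ni mk orbT.
Qed.

Lemma finite_matrix_rk1 i j : finite_matrix (rk1 p1 (delta p1 i) j).
Proof.
exists (maxn i j).+1 => k l; rewrite coef_rk1.
case: (k =P i) => [->|_]; case: (l =P j) => [->|_]; rewrite ?eqxx//= => _.
by rewrite !ltnS !leq_max !leqnn orbT.
Qed.

Lemma Mbar_infty_subalgebra : is_subalgebra (Mbar_infty p1).
Proof. by rewrite Mbar_inftyE; apply: closure_subalgebra finite_matrix_subalgebra. Qed.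

Lemma finite_matrix_Mbar T : finite_matrix T -> Mbar_infty p1 T.
Proof. by rewrite Mbar_inftyE; exact: subset_bop_closure. Qed.

End corner_matrices.

(** * The stabilised uniform Roe algebra *)

Section stable_uniform_roe.
Variables (R : realType) (p : R) (p1 : 1 <= p) (X : metricType R).
Local Notation ell I := (ellp p1 I R[i]^o).
Local Notation op := (bop (ell (X * nat)%type) (ell (X * nat)%type)).
Local Notation tens := (@tens R p p1 X nat).

Definition tensors : set op := [set T | exists a b,
  [/\ Bu p1 X a, Mbar_infty p1 b & is_op_tensor a b T]].

Lemma tensors_tens a b : Bu p1 X a -> Mbar_infty p1 b -> tensors (tens a b).
Proof. by move=> Ba Mb; exists a, b; split=> //; exact: tensP. Qed.

Lemma span_tensors_comp S T : lin_span tensors S -> lin_span tensors T ->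
  lin_span tensors (bcomp S T).
Proof.
move=> hS hT; move: S hS.
apply: lin_span_ind.
- by rewrite bcomp0l; exact: lin_span0.
- by move=> c u v hu hv; rewrite bcompDl bcompZl; exact: lin_span_lin.
move=> S [a [b [Ba Mb /is_op_tensor_unique ->]]]; move: T hT.
apply: lin_span_ind.
- by rewrite bcomp0r; exact: lin_span0.
- by move=> c u v hu hv; rewrite bcompDr bcompZr; exact: lin_span_lin.
move=> T [a' [b' [Ba' Mb' /is_op_tensor_unique ->]]].
rewrite tensM; apply: lin_span_mem; apply: tensors_tens.
  by have [[_ _ h] _ _] := Bu_matrix_unit_algebra p1 X; exact: h.
by have [_ _ h] := Mbar_infty_subalgebra p1; exact: h.
Qed.

Lemma alg_tensor_subalgebra : is_subalgebra (alg_tensor (Bu p1 X) (Mbar_infty p1)).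
Proof.
apply: closure_subalgebra; split.
- exact: lin_span0.
- exact: lin_span_lin.
- exact: span_tensors_comp.
Qed.

(** Coefficients of the tensor are products, so a product of modulus at least e forces each factor
    to be at least e over the norm of the other. The first factor then bounds the distance, the
    second the level. *)
Lemma tight_tens a b : Bu p1 X a -> Mbar_infty p1 b -> tight (tens a b).
Proof.
move=> /bop_closureP ha; rewrite Mbar_inftyE => /bop_closureP hb e e0.
have a1 : 0 < opnorm a + 1 by rewrite ltr_wpDl// opnorm_ge0.
have b1 : 0 < opnorm b + 1 by rewrite ltr_wpDl// opnorm_ge0.
have [a' /CuP[r hr] lta] := ha _ (divr_gt0 e0 b1).
have [b' [N hN] ltb] := hb _ (divr_gt0 e0 a1).
exists r, N => -[x m] [x' m']; rewrite tens_coef rnormM => le.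
split.
  apply: hr; apply: large_coef_approx lta _; rewrite ler_pdivrMr//.
  apply: le_trans le _; rewrite ler_wpM2l ?rnorm_ge0// (le_trans (coef_le _ _ _))//.
  by rewrite lerDl.
apply: (fun h => (hN _ m' h).1); apply: large_coef_approx ltb _.
rewrite ler_pdivrMr// mulrC; apply: le_trans le _.
by rewrite ler_wpM2r ?rnorm_ge0// (le_trans (coef_le _ _ _))// lerDl.
Qed.

Lemma tight_alg_tensor T : alg_tensor (Bu p1 X) (Mbar_infty p1) T -> tight T.
Proof.
move: T; apply: norm_closed_closure; first exact: tight_norm_closed.
apply: lin_span_ind; [exact: tight0|exact: tight_lin|].
by move=> T [a [b [Ba Mb /is_op_tensor_unique ->]]]; exact: tight_tens.
Qed.

Lemma slice_inj (m : nat) : partial_inj (fun x : X => Some (x, m)).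
Proof. by move=> x x' [y n] [-> _] [->]. Qed.

Definition insert_map (m : nat) (k : X * nat) : option X :=
  if k.2 == m then Some k.1 else None.

Lemma insert_inj m : partial_inj (insert_map m).
Proof.
move=> [x n] [x' n'] y; rewrite /insert_map /=.
by case: (n =P m) => // -> [->]; case: (n' =P m) => // -> [->].
Qed.

Definition slice (T : op) m m' : bop (ell X) (ell X) :=
  bcomp (pinj p1 _ (@slice_inj m)) (bcomp T (pinj p1 _ (@insert_inj m'))).

Lemma coef_slice T m m' x x' : coef (slice T m m') x x' = coef T (x, m) (x', m').
Proof.
change (T (pinj p1 _ (@insert_inj m') (delta p1 x')) (x, m) = T (delta p1 (x', m')) (x, m)).
congr (T _ _); apply: ellp_ext => -[y n]; rewrite pinj_single deltaE /insert_map /= xpair_eqE.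
case: (n =P m') => /= [_|_]; last by rewrite andbF.
by rewrite andbT; congr (if _ then _ else _); apply/eqP/eqP => [[]|->].
Qed.

(** T is the finite sum over m, m' < N of its (m, m') block tensored with the matrix unit at (m,
    m'); each block inherits finite propagation. *)
Lemma corner_op_span T : corner_op T -> lin_span tensors T.
Proof.
move=> [r [N h]].
have -> : T = \sum_(m < N) \sum_(m' < N) tens (slice T m m') (rk1 p1 (delta p1 (m : nat)) (m' : nat)).
  apply: coef_ext => -[x m] [x' m']; rewrite opcoef_sum.
  transitivity (\sum_(i < N) \sum_(j < N)
      if (m == i) && (m' == j) then coef T (x, m) (x', m') else 0); last first.
    apply: eq_bigr => i _; rewrite opcoef_sum; apply: eq_bigr => j _.
    rewrite tens_coef coef_slice coef_rk1.
    case: (m =P i) => [->|_]; case: (m' =P j) => [->|_]; rewrite ?mulr1 ?mulr0//.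
  have [T0|/h[_ /= mN m'N]] := eqVneq (coef T (x, m) (x', m')) 0.
    by rewrite T0 big1// => i _; rewrite big1// => j _; rewrite if_same.
  rewrite (bigD1 (Ordinal mN))//= [X in _ + X]big1 => [|i]; last first.
    rewrite -val_eqE /= eq_sym => /negbTE ne.
    by rewrite big1// => j _; rewrite ne.
  rewrite addr0 (bigD1 (Ordinal m'N))//= !eqxx big1 ?addr0// => j.
  by rewrite -val_eqE /= eq_sym => /negbTE ->.
have sum_span n (F : 'I_n -> op) : (forall i, lin_span tensors (F i)) ->
    lin_span tensors (\sum_(i < n) F i).
  move=> hF; elim: (index_enum _) => [|i s ih]; first by rewrite big_nil; exact: lin_span0.
  by rewrite big_cons -[F i]scale1r; exact: lin_span_lin.
apply: (@sum_span N) => m; apply: (@sum_span N) => m'; apply: lin_span_mem; apply: tensors_tens.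
  apply: subset_bop_closure; apply/CuP; exists r => x x'; rewrite coef_slice.
  by move=> /h[].
by apply: finite_matrix_Mbar; exact: finite_matrix_rk1.
Qed.

Lemma alg_tensor_roe_like :
  roe_like (alg_tensor (Bu p1 X) (Mbar_infty p1)) fst (fun x => (x, 0%N)).
Proof.
apply: corner_roe_like.
- exact: alg_tensor_subalgebra.
- exact: closure_norm_closed.
- exact: tight_alg_tensor.
- by move=> T /corner_op_span; exact: subset_bop_closure.
Qed.

End stable_uniform_roe.

(** * From operator-valued matrices over X to scalar matrices over X x S *)

Section unfolding.
Variables (R : realType) (p : R) (p1 : 1 <= p) (X S : choiceType).
Local Notation ell I := (ellp p1 I R[i]^o).
Local Notation V := (ellp p1 X (ell S)).
Local Notation op := (bop (ell (X * S)%type) (ell (X * S)%type)).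

Definition fold_op (T : op) : bop V V :=
  conj_op (curry_op p1 X S _) (uncurry_op p1 X S _) T.

Definition unfold_op (T : bop V V) : op :=
  conj_op (uncurry_op p1 X S _) (curry_op p1 X S _) T.

Let cK : cancel (curry_op p1 X S R[i]^o) (uncurry_op p1 X S _).
Proof. exact: curry_opK. Qed.
Let uK : cancel (uncurry_op p1 X S R[i]^o) (curry_op p1 X S _).
Proof. exact: uncurry_opK. Qed.
Let ci : isometric (curry_op p1 X S R[i]^o).
Proof. by move=> v; exact: curry_norm. Qed.
Let ui : isometric (uncurry_op p1 X S R[i]^o).
Proof. by move=> v; exact: uncurry_norm. Qed.

(** Rigidity is proved for algebras on scalar l^p spaces; this is the isometric copy of [A] on l^p(X
    x S) to which it applies. *)
Definition unfolded (A : set (bop V V)) : set op := [set T | A (fold_op T)].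

Lemma unfold_opK : cancel unfold_op fold_op. Proof. exact: conj_opK. Qed.

Lemma opnorm_fold T : opnorm (fold_op T) = opnorm T.
Proof. exact: opnorm_conj. Qed.

Lemma unfolded_subalgebra A : is_subalgebra A -> is_subalgebra (unfolded A).
Proof.
move=> [A0 Alin Acomp]; rewrite /unfolded; split=> /=.
- suff -> : fold_op 0 = 0 by [].
  by rewrite /fold_op /conj_op bcomp0l bcomp0r.
- by move=> c T T' AT AT'; rewrite /fold_op (conj_opP _ _ c); exact: Alin.
- by move=> T T' AT AT'; rewrite /fold_op (conj_opM cK); exact: Acomp.
Qed.

Lemma unfolded_norm_closed A : norm_closed A -> norm_closed (unfolded A).
Proof.
move=> cA T h; apply: cA => e /h[T' AT' lt]; exists (fold_op T') => //.
by rewrite /fold_op -conj_opB (opnorm_conj cK uK ci).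
Qed.

Lemma unfolded_iso A : isometrically_isomorphic (unfolded A) A.
Proof.
apply: (isometrically_isomorphic_conj cK uK ci) => // T AT.
by rewrite /unfolded/= [fold_op _]unfold_opK.
Qed.

Lemma iso_unfolded A : isometrically_isomorphic A (unfolded A).
Proof.
apply: (isometrically_isomorphic_conj uK cK ui) => // T AT.
by rewrite /unfolded/= [fold_op _]unfold_opK.
Qed.

Lemma coef_entry_fold T x y s t : coef (entry (fold_op T) x y) s t = coef T (x, s) (y, t).
Proof. by rewrite /coef -uncurry_single. Qed.

Lemma entry_fold_eq0 T x y : (forall s t, coef T (x, s) (y, t) = 0) ->
  entry (fold_op T) x y = 0.
Proof. by move=> h; apply: coef_ext => s t; rewrite coef_entry_fold h. Qed.

Lemma entry_fold_ne0 T x y s t : coef T (x, s) (y, t) != 0 -> entry (fold_op T) x y != 0.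
Proof. by apply: contra_neq => e; rewrite -coef_entry_fold e. Qed.

End unfolding.

Lemma isometrically_isomorphic_unfolded (R : realType) (p : R) (p1 : 1 <= p)
    (X S Y S' : choiceType)
    (A : set (bop (ellp p1 X (ellp p1 S R[i]^o)) (ellp p1 X (ellp p1 S R[i]^o))))
    (B : set (bop (ellp p1 Y (ellp p1 S' R[i]^o)) (ellp p1 Y (ellp p1 S' R[i]^o)))) :
  isometrically_isomorphic A B ->
  isometrically_isomorphic (unfolded A) (unfolded B).
Proof.
move=> iso; apply: isometrically_isomorphic_trans (unfolded_iso A) _.
exact: isometrically_isomorphic_trans iso (iso_unfolded B).
Qed.

Section large_coefficients.
Import mathcomp.finmap.finmap.
Variables (R : realType) (p : R) (p1 : 1 <= p) (I : choiceType).
Local Notation ell I := (ellp p1 I R[i]^o).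

Lemma ellp_large_finite (v : ell I) (e : R) : 0 < e ->
  finite_set [set i | e <= rnorm (v i : R[i]^o)].
Proof.
move=> e0; have [s [us lt]] := ellp_approx v e0.
apply: (@sub_finite_set _ _ [set` s]); last exact: finite_seq.
move=> i /= le; apply: contraT => si.
have := le_lt_trans (ellp_coord (v - \sum_(i <- s) single p1 i (v i)) i) lt.
rewrite ellpDE ellpNE ellp_sumE big1_seq => [|j /andP[_ js]].
  by rewrite oppr0 addr0 ltNge le.
by rewrite singleE; case: (i =P j) => // ij; rewrite ij js in si.
Qed.

(** The images K delta_i have a finite e/2-net. If the i-th diagonal coefficient is at least e, the
    net point near K delta_i has i-th coordinate at least e/2, and each vector has finitely many
    such coordinates. *)
Lemma compact_operator_diag (K : bop (ell I) (ell I)) (e : R) : 0 < e ->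
  compact_operator K -> finite_set [set i | e <= rnorm (coef K i i : R[i]^o)].
Proof.
move=> e0; rewrite /compact_operator precompactE compact_cover => h.
have e2 : 0 < e / 2 by rewrite divr_gt0.
have e2C : 0 < (e / 2)%:C by rewrite ltcR.
have [||D _ hD] := h (ell I) setT (fun c => ball c (e / 2)%:C).
- by move=> c _; exact: ball_open.
- by move=> v _; exists v => //; exact: ballxx.
pose G (c : ell I) := [set i | e / 2 <= rnorm (c i : R[i]^o)].
have sub : [set i | e <= rnorm (coef K i i : R[i]^o)] `<=` \bigcup_(c in [set` D]) G c.
  move=> i /= le.
  have [|c Dc] := hD (K (delta p1 i)).
    apply: subset_closure; exists (delta p1 i) => //=.
    by rewrite rnormE rnorm_delta.
  rewrite -ball_normE /= rnormE ltcR => lt; exists c => //; rewrite /G /=.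
  rewrite leNgt; apply/negP => cl.
  have := le_lt_trans (ellp_coord (c - K (delta p1 i)) i) lt.
  rewrite ellpDE ellpNE => lt2.
  move: le; apply/negP; rewrite -ltNge /coef -/(delta p1 i).
  rewrite -[K _ i](subrK (c i)) (le_lt_trans (@rnormD R R[i]^o _ _))// (splitr e) ltrD//.
  by rewrite -(@rnormN R R[i]^o) opprB.
apply: sub_finite_set sub _; apply: bigcup_finite; first exact: finite_fset.
by move=> c _; exact: ellp_large_finite.
Qed.

End large_coefficients.

(** * Roe-type algebras *)

Section roe_type.
Variables (R : realType) (p : R) (p1 : 1 <= p) (X : metricType R) (s : option nat).
Local Notation ell I := (ellp p1 I R[i]^o).
Local Notation F := (fibre s).
Local Notation op := (bop (ell (X * F)%type) (ell (X * F)%type)).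

Definition fibre_base : F :=
  match s return fibre s with Some n => ord0 | None => 0%N end.
Local Notation f0 := fibre_base.

Variable A : set (bop (ellp p1 X (ell F)) (ellp p1 X (ell F))).
Hypothesis rA : roe_type A.

(** When the row level depends on the point of X alone, every entry (x, y) has range in the line of
    delta_(t x). The rank is then at most 1, and every algebraic Roe-type algebra contains the
    operator. *)
Lemma roe_simple_mem (T : op) (r : R) (t : X -> F) :
  (forall k l, coef T k l != 0 -> mdist k.1 l.1 <= r /\ k.2 = t k.1) -> unfolded A T.
Proof.
move=> h; have [A0 [sA _ contains] AE] := rA.
rewrite /unfolded /= AE; apply: subset_bop_closure; apply: contains.
  apply/finite_propagationP; exists r => x y; apply: contra_neqP => /negP d.
  apply: entry_fold_eq0 => m n; apply/eqP/negPn/negP => /h[/= dr _].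
  by rewrite dr in d.
exists 1%N => x y; exists (fun=> delta p1 (t x)) => _ [v _ <-].
exists (fun=> entry (fold_op T) x y v (t x)) => //.
rewrite big_ord1; apply: ellp_ext => m; rewrite ellpZE deltaE.
case: (m =P t x) => [->|mt]; first by rewrite scale_one.
rewrite scaler0; apply/esym.
apply: (bop_single_eq0 (T := bcomp (eval_op p1 _ m) (entry (fold_op T) x y))) => n.
change (entry (fold_op T) x y (single p1 n (v n)) m = 0).
rewrite bop_coef coef_entry_fold; suff -> : coef T (x, m) (y, n) = 0 by rewrite mulr0.
by apply/eqP/negPn/negP => /h[_ /= /mt].
Qed.

Lemma roe_type_roe_like : roe_like (unfolded A) fst (fun x => (x, f0)).
Proof.
have [A0 [sA lA contains] AE] := rA.
have approx (T : op) (e : R) : 0 < e -> unfolded A T ->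
    exists2 S : op, A0 (fold_op S) & opnorm (T - S) < e.
  move=> e0; rewrite /unfolded /= AE => /bop_closureP /(_ e e0)[S AS lt].
  exists (unfold_op S); first by rewrite unfold_opK.
  by rewrite -opnorm_fold /fold_op conj_opB -/(fold_op _) -/(fold_op _) unfold_opK.
have move_mem (t : X -> F) : unfolded A (pinj p1 R[i]^o (@move_map_inj X F f0 t)).
  apply: (@roe_simple_mem _ 0 t) => -[x m] [x' m']; rewrite coef_pinj /move_map /=.
  case: (m =P t x) => [->|_]; last by rewrite eqxx.
  case: (_ =P Some (x', m')) => [[<- _] _|_]; last by rewrite eqxx.
  by rewrite mdistxx.
split=> //.
- split.
  + by apply: unfolded_subalgebra; rewrite AE; exact: closure_subalgebra.
  + by apply: unfolded_norm_closed; rewrite AE; exact: closure_norm_closed.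
  + move=> [x m] [y n]; apply: (@roe_simple_mem _ (mdist x y) (fun=> m)) => k l.
    rewrite coef_rk1.
    by case: (k =P _) => [->|_]; case: (l =P _) => [->|_]; rewrite ?eqxx.
- move=> r h hi hr; exists (pinj p1 R[i]^o (@lift_map_inj X F f0 h hi)).
    apply: (@roe_simple_mem _ r (fun=> f0)) => -[x m] [x' m']; rewrite coef_pinj /lift_map /=.
    case: (m =P f0) => [->|_]; last by rewrite eqxx.
    case e : (h x) => [y|]; last by rewrite eqxx.
    case: (_ =P Some (x', m')) => [[<- _] _|_]; last by rewrite eqxx.
    by split=> //; exact: hr.
  by move=> x x' hx; rewrite coef_pinj /lift_map /= eqxx hx /= eqxx rnorm1.
- move=> T /(approx _ _ ltr01)[S AS lt].
  have [_ /finite_propagationP[r hr]] := lA _ AS.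
  exists r => -[x m] [y n] le; apply: hr; apply: entry_fold_ne0.
  exact: large_coef_approx lt le.
- move=> T AT; split=> [x|t tx _].
    (* An approximation within 1/2 keeps diagonal coefficients of modulus at least 1 above 1/2, and
       its diagonal entries are compact. *)
    have h2 : 0 < 2^-1 :> R by rewrite invr_gt0.
    have [S AS lt] := approx _ _ h2 AT.
    have [lc _] := lA _ AS; have fin := compact_operator_diag h2 (lc x x).
    apply: (@sub_finite_set _ _ ((fun m => (x, m)) @`
      [set m | 2^-1 <= rnorm (coef (entry (fold_op S) x x) m m : R[i]^o)])).
      move=> [y m] /= [-> le]; exists m => //=; rewrite coef_entry_fold.
      rewrite leNgt; apply/negP => Sl; move: le; apply/negP; rewrite -ltNge.
      rewrite -(subrK (coef S (x, m) (x, m)) (coef T (x, m) (x, m))).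
      rewrite (le_lt_trans (@rnormD R R[i]^o _ _))// (splitr 1) ltrD// ?mul1r//.
      by rewrite -opcoefB (le_lt_trans (coef_le _ _ _))// mul1r.
    exact: finite_image.
  pose t2 x := (t x).2.
  have tE x : t x = (x, t2 x) by rewrite /t2 -{2}(tx x) -surjective_pairing.
  exists (pinj p1 R[i]^o (@move_map_inj X F f0 t2)); first exact: move_mem.
  by move=> x; rewrite coef_pinj /move_map tE /= eqxx eqxx rnorm1.
Qed.

End roe_type.

(** * Enlarging finite rank idempotents *)

Section finite_rank_idempotents.
Variables (R : realType) (p : R) (p1 : 1 <= p) (I : choiceType).
Local Notation E := (ellp p1 I R[i]^o).
Local Notation dual := (bop E R[i]^o).

Lemma rank1_linear (v : E) (c : dual) : linear (fun w => c w *: v).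
Proof. by move=> a u w; rewrite bopD bopZ scalerDl scalerA. Qed.

Lemma rank1_bounded (v : E) (c : dual) (w : E) :
  rnorm (c w *: v) <= opnorm c * rnorm v * rnorm w.
Proof.
rewrite rnormZ mulrAC ler_wpM2r ?rnorm_ge0//; exact: (opnormP c w).
Qed.

Definition rank1 (v : E) (c : dual) : bop E E :=
  mkbop (@rank1_linear v c) (@rank1_bounded v c).

Lemma rank1E v c w : rank1 v c w = c w *: v. Proof. by []. Qed.

(** Q is the sum of the v_k ⊗ c_k over the listed pairs and fixes every v_k, so it is idempotent
    with range spanned by the v_k. The list gives direct access to vectors and functionals. *)
Definition dual_pair_rep (s : seq (E * dual)) (Q : bop E E) : Prop :=
  (forall v, Q v = \sum_(x <- s) x.2 v *: x.1) /\ (forall x, x \in s -> Q x.1 = x.1).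

Definition finite_rank_idem (Q : bop E E) : Prop := exists s, dual_pair_rep s Q.

Lemma finite_rank_idem0 : finite_rank_idem 0.
Proof. by exists [::]; split=> [v|//]; rewrite big_nil. Qed.

Lemma finite_rank_idemK Q : finite_rank_idem Q -> bcomp Q Q = Q.
Proof.
move=> [s [sE Qs]]; apply: bop_ext => v /=.
rewrite [X in Q X]sE bop_sumr sE; apply: eq_big_seq => x xs.
by rewrite bopZ Qs.
Qed.

(** The hypotheses make [rank1 v c] an idempotent orthogonal to Q. *)
Lemma finite_rank_idem_step Q v (c : dual) : finite_rank_idem Q -> Q v = 0 ->
  bcomp c Q = 0 -> c v = (1 : R[i]^o) -> finite_rank_idem (Q + rank1 v c).
Proof.
move=> [s [sE Qs]] Qv cQ cv; exists ((v, c) :: s); split=> [w|x].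
  by rewrite big_cons bopDE rank1E addrC sE.
rewrite inE => /orP[/eqP->|xs]; rewrite bopDE rank1E.
  by rewrite [(v, c).1]/= Qv add0r cv scale1r.
rewrite (Qs _ xs); have -> : c x.1 = 0.
  by rewrite -(Qs _ xs); exact: (congr1 (fun S : dual => S x.1) cQ).
by rewrite scale0r addr0.
Qed.

Definition absorbs (Q T : bop E E) : Prop := bcomp Q T = T /\ bcomp T Q = T.

Lemma absorbs_trans Q Q' T : absorbs Q' Q -> absorbs Q T -> absorbs Q' T.
Proof.
move=> [h1 h2] [h3 h4]; split.
  by rewrite -h3; apply: bop_ext => v; exact: (congr1 (fun S : bop E E => S (T v)) h1).
rewrite -[RHS]h4 -h2 -[in LHS]h4.
by apply: bop_ext.
Qed.

(** If w = v - Q v is nonzero, some coordinate of w is nonzero. That coordinate functional composed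
    with 1 - Q, normalised, takes the value 1 at w and vanishes on the range of Q, so no extension
    theorem for functionals enters. *)
Lemma absorb_vector Q v : finite_rank_idem Q ->
  exists Q', [/\ finite_rank_idem Q', absorbs Q' Q & Q' v = v].
Proof.
move=> fQ; have QQ w : Q (Q w) = Q w.
  exact: (congr1 (fun S : bop E E => S w) (finite_rank_idemK fQ)).
have [e|ne] := eqVneq (Q v) v.
  by exists Q; split=> //; split; exact: finite_rank_idemK.
pose w := v - Q v.
have [i wi] : exists i, w i != 0.
  apply: contrapT => /forallNP h; move/eqP: ne; apply; apply/esym/eqP.
  rewrite -subr_eq0; apply/eqP/ellp_ext => i.
  by apply/eqP/negPn/negP; exact: h.
pose a : R[i] := w i; have an : a != 0 by [].
pose c : dual := a^-1 *: (eval_op p1 _ i - bcomp (eval_op p1 _ i) Q).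
have cE u : c u = a^-1 * (u i - Q u i) by [].
have Qw : Q w = 0 by rewrite bopB QQ subrr.
have cQ : bcomp c Q = 0.
  apply: bop_ext => u; change (c (Q u) = 0).
  by rewrite cE QQ subrr mulr0.
have cv : c v = 1 by rewrite cE -/w; exact: mulVf.
have cw : c w = 1 by rewrite bopB cv (_ : c (Q v) = 0) ?subr0// cE QQ subrr mulr0.
exists (Q + rank1 w c); split.
- exact: finite_rank_idem_step.
- split; apply: bop_ext => u.
    change (Q (Q u) + c (Q u) *: w = Q u).
    by rewrite QQ (_ : c (Q u) = 0) ?scale0r ?addr0// cE QQ subrr mulr0.
  change (Q (Q u + c u *: w) = Q u).
  by rewrite bopD QQ bopZ Qw scaler0 addr0.
- by rewrite bopDE rank1E cv scale1r addrC subrK.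
Qed.

(** Dual to the previous step: the functional c - c Q is given, and a vector killed by Q is chosen
    on which it equals 1. *)
Lemma absorb_functional Q (c : dual) : finite_rank_idem Q ->
  exists Q', [/\ finite_rank_idem Q', absorbs Q' Q & bcomp c Q' = c].
Proof.
move=> fQ; have QQ w : Q (Q w) = Q w.
  exact: (congr1 (fun S : bop E E => S w) (finite_rank_idemK fQ)).
have [e|ne] := eqVneq (bcomp c Q) c.
  by exists Q; split=> //; split; exact: finite_rank_idemK.
pose c1 : dual := c - bcomp c Q.
have c1E u : c1 u = c u - c (Q u) by [].
have c1Q u : c1 (Q u) = 0 by rewrite c1E QQ subrr.
have [v c1v] : exists v, c1 v != 0.
  apply: contrapT => /forallNP h; move/eqP: ne; apply; apply/esym/eqP.
  rewrite -subr_eq0; apply/eqP/bop_ext => u.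
  by apply/eqP/negPn/negP; exact: h.
pose a : R[i] := c1 v; have an : a != 0 by [].
pose w := a^-1 *: (v - Q v).
have Qw : Q w = 0 by rewrite bopZ bopB QQ subrr scaler0.
have c1w : c1 w = 1.
  by rewrite bopZ bopB c1Q subr0; exact: mulVf.
have cw : c w = 1 by rewrite -c1w c1E Qw bop0 subr0.
have c1Q0 : bcomp c1 Q = 0 by apply: bop_ext => u; exact: c1Q.
exists (Q + rank1 w c1); split.
- exact: finite_rank_idem_step.
- split; apply: bop_ext => u.
    change (Q (Q u) + c1 (Q u) *: w = Q u).
    by rewrite QQ c1Q scale0r addr0.
  change (Q (Q u + c1 u *: w) = Q u).
  by rewrite bopD QQ bopZ Qw scaler0 addr0.
- apply: bop_ext => u; change (c (Q u + c1 u *: w) = c u).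
  rewrite bopD bopZ cw scale_one c1E.
  by rewrite addrC subrK.
Qed.

Lemma absorb_vectors Q (s : seq E) : finite_rank_idem Q ->
  exists Q', [/\ finite_rank_idem Q', absorbs Q' Q & forall v, v \in s -> Q' v = v].
Proof.
move=> fQ; elim: s => [|v s [Q1 [f1 a1 h1]]].
  by exists Q; split=> //; split; exact: finite_rank_idemK.
have [Q2 [f2 a2 h2]] := absorb_vector v f1.
exists Q2; split=> // [|w]; first exact: absorbs_trans a2 a1.
rewrite inE => /orP[/eqP->//|ws].
by rewrite -(h1 _ ws); exact: (congr1 (fun S : bop E E => S w) a2.1).
Qed.

Lemma absorb_functionals Q (s : seq dual) : finite_rank_idem Q ->
  exists Q', [/\ finite_rank_idem Q', absorbs Q' Q & forall c, c \in s -> bcomp c Q' = c].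
Proof.
move=> fQ; elim: s => [|c s [Q1 [f1 a1 h1]]].
  by exists Q; split=> //; split; exact: finite_rank_idemK.
have [Q2 [f2 a2 h2]] := absorb_functional c f1.
exists Q2; split=> // [|d]; first exact: absorbs_trans a2 a1.
rewrite inE => /orP[/eqP->//|ds].
rewrite -{1}(h1 _ ds) -[RHS](h1 _ ds); apply: bop_ext => v /=.
by congr (d _); exact: (congr1 (fun S : bop E E => S v) a2.2).
Qed.

(** Absorbing vectors that span a space containing the range of T gives Q1 T = T. Writing Q1 as the
    sum of v_k ⊗ c_k then gives T as the sum of v_k ⊗ (c_k T), so it remains to absorb the finitely
    many functionals c_k T. *)
Lemma absorb_operator Q T n : finite_rank_idem Q -> rank_le T n ->
  exists Q', [/\ finite_rank_idem Q', absorbs Q' Q & absorbs Q' T].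
Proof.
move=> fQ [e he].
have [Q1 [f1 a1 h1]] := absorb_vectors [seq e i | i <- enum 'I_n] fQ.
have Q1T v : Q1 (T v) = T v.
  have [a _ <-] : span_fam e (T v) by apply: he; exists v.
  rewrite bop_sumr; apply: eq_bigr => i _; rewrite bopZ h1//.
  by apply/mapP; exists i; rewrite // mem_enum.
have [s [sE _]] := f1.
have [Q2 [f2 a2 h2]] := absorb_functionals [seq bcomp x.2 T | x <- s] f1.
exists Q2; split=> //; first exact: absorbs_trans a2 a1.
split; apply: bop_ext => v /=.
  by rewrite -{1}Q1T; rewrite -[RHS]Q1T; exact: (congr1 (fun S : bop E E => S (T v)) a2.1).
rewrite -Q1T -[RHS]Q1T !sE; apply: eq_big_seq => x xs; congr (_ *: _).
have /h2 e2 : bcomp x.2 T \in [seq bcomp x.2 T | x <- s] by apply/mapP; exists x.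
exact: (congr1 (fun S : dual => S v) e2).
Qed.

Lemma absorb_operators (s : seq (bop E E)) :
  (forall T, T \in s -> exists n, rank_le T n) ->
  exists Q, finite_rank_idem Q /\ forall T, T \in s -> absorbs Q T.
Proof.
elim: s => [_|T s ih h]; first by exists 0; split=> //; exact: finite_rank_idem0.
have [Q [fQ hQ]] : exists Q, finite_rank_idem Q /\ forall T, T \in s -> absorbs Q T.
  by apply: ih => S Ss; apply: h; rewrite inE Ss orbT.
have [n hn] := h T (mem_head _ _).
have [Q' [f' a' h']] := absorb_operator fQ hn.
exists Q'; split=> // S; rewrite inE => /orP[/eqP->//|/hQ]; exact: absorbs_trans.
Qed.

Lemma finite_rank_idem_rank Q : finite_rank_idem Q -> exists n (e : 'I_n -> E),
  range Q = span_fam e.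
Proof.
move=> [s [sE Qs]].
exists (size s), (fun i => (tnth (in_tuple s) i).1).
have tn (f : E * dual -> R[i]) : \sum_(x <- s) f x *: x.1 =
    \sum_(i < size s) f (tnth (in_tuple s) i) *: (tnth (in_tuple s) i).1 :> E.
  by rewrite (big_tnth _ _ s).
apply/seteqP; split=> [_ [v _ <-]|_ [a _ <-]].
  by exists (fun i => (tnth (in_tuple s) i).2 v) => //; rewrite sE (tn (fun x => x.2 v)).
exists (\sum_i a i *: (tnth (in_tuple s) i).1) => //.
rewrite bop_sumr; apply: eq_bigr => i _; rewrite bopZ Qs//.
exact: mem_tnth.
Qed.

End finite_rank_idempotents.

(** * The algebra of operators compressed to a finite-dimensional corner *)

Section stable_algebra.
Variables (R : realType) (p : R) (p1 : 1 <= p).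
Local Notation ell I := (ellp p1 I R[i]^o).

Lemma rank_le_rk1 (I : choiceType) (i j : I) : rank_le (rk1 p1 (delta p1 i) j) 1.
Proof.
exists (fun=> delta p1 i) => _ [v _ <-]; exists (fun=> v j) => //.
by rewrite big_ord1.
Qed.

Lemma rank_le_range (E F G : normedModType R[i]) (S : bop F G) (T : bop E F) n :
  rank_le T n -> rank_le (bcomp S T) n.
Proof.
move=> [e he]; exists (fun i => S (e i)) => _ [v _ <-].
have [a _ aE] : span_fam e (T v) by apply: he; exists v.
by exists a => //; rewrite /= -aE bop_sumr; apply: eq_bigr => i _; rewrite bopZ.
Qed.

Lemma rank_le_source (E F G : normedModType R[i]) (S : bop F G) (T : bop E F) n :
  rank_le S n -> rank_le (bcomp S T) n.
Proof. by move=> [e he]; exists e => _ [v _ <-]; apply: he; exists (T v). Qed.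

Lemma ellp_nat_tail (v : ell nat) (e : R) : 0 < e ->
  exists N, forall m, (N <= m)%N -> rnorm (v m : R[i]^o) < e.
Proof.
move=> e0; have /finite_seqP[s hs] := ellp_large_finite v e0.
exists (\max_(i <- s) i).+1 => m Nm; rewrite ltNge; apply/negP => le.
have ms : m \in s by have : [set` s] m by rewrite -hs.
by move: Nm; rewrite ltnNge (leq_bigmax_seq m)//.
Qed.

Lemma finite_rank_idem_tail (Q : bop (ell nat) (ell nat)) (e : R) :
  finite_rank_idem Q -> 0 < e ->
  exists N, forall m, (N <= m)%N -> forall u, rnorm (Q u m : R[i]^o) <= e * rnorm u.
Proof.
move=> [s [sE _]] e0.
suff [N hN] : exists N, forall m, (N <= m)%N -> forall u,
    rnorm ((\sum_(x <- s) x.2 u *: x.1) m : R[i]^o) <= e * rnorm u.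
  by exists N => m Nm u; rewrite sE hN.
elim: s e e0 {sE} => [|[v c] s ih] e e0.
  by exists 0%N => m _ u; rewrite big_nil [X in rnorm X]/(0 : R[i]^o) rnorm0 mulr_ge0 ?rnorm_ge0 ?ltW.
have e2 : 0 < e / 2 by rewrite divr_gt0.
have [N hN] := ih _ e2.
have c1 : 0 < opnorm c + 1 by rewrite ltr_wpDl// opnorm_ge0.
have [N' hN'] := ellp_nat_tail v (divr_gt0 e2 c1).
exists (maxn N N') => m; rewrite geq_max => /andP[Nm N'm] u.
rewrite big_cons ellpDE (le_trans (rnormD _ _))// (splitr e) mulrDl lerD//; last exact: hN.
rewrite ellpZE rnormZ [(v, c).2]/= [(v, c).1]/=.
have -> : complex.Re `|c u| = rnorm (c u : R[i]^o) by [].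
apply: le_trans (_ : opnorm c * rnorm u * (e / 2 / (opnorm c + 1)) <= _).
  by apply: ler_pM; rewrite ?rnorm_ge0 ?opnormP// ltW// hN'.
rewrite mulrAC ler_wpM2r ?rnorm_ge0// mulrA ler_pdivrMr// mulrC.
by rewrite ler_wpM2l ?lerDl// ltW.
Qed.

Section over_space.
Variable X : metricType R.
Local Notation V := (ellp p1 X (ell nat)).

Definition compressed_by (P : bop (ell nat) (ell nat)) (T : bop V V) : Prop :=
  forall x y, entry T x y = bcomp P (bcomp (entry T x y) P).

Lemma compressed_byP P T : compressed_by P T <->
  bcomp (pointwise_op p1 X P) (bcomp T (pointwise_op p1 X P)) = T.
Proof.
split=> [h|h x y].
  apply: bop_single_ext => y e; apply: ellp_ext => x.
  change (P (T (pointwise_op p1 X P (single p1 y e)) x) = entry T x y e).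
  by rewrite pointwise_single [in RHS]h.
apply: bop_ext => e; rewrite -{1}h.
change (P (T (pointwise_op p1 X P (single p1 y e)) x) = P (entry T x y (P e))).
by rewrite pointwise_single.
Qed.

Lemma pointwise_bcomp (P Q : bop (ell nat) (ell nat)) :
  bcomp (pointwise_op p1 X P) (pointwise_op p1 X Q) = pointwise_op p1 X (bcomp P Q).
Proof. by apply: bop_ext => v; apply: ellp_ext. Qed.

Lemma compressed_by_absorbs P Q T : absorbs Q P -> compressed_by P T -> compressed_by Q T.
Proof.
move=> [h1 h2] h x y; rewrite h; apply: bop_ext => e /=.
have /= -> := congr1 (fun S : bop (ell nat) (ell nat) => S e) h2.
by have /= -> := congr1 (fun S : bop (ell nat) (ell nat) => S (entry T x y (P e))) h1.
Qed.

(** The idempotent in the definition is replaced by one with an explicit list of vectors and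
    functionals, which can be enlarged later. *)
Lemma CsP T : Cs p1 X T <-> finite_propagation T /\
  exists2 P, finite_rank_idem P & compressed_by P T.
Proof.
split=> [[fT [ET [P [[n [e ->]] PP rP h]]]]|[fT [P fP h]]]; split=> //.
  have [|Q [fQ hQ]] := @absorb_operators R p p1 nat [:: P].
    by move=> S; rewrite inE => /eqP->; exists n; exists e; rewrite rP.
  by exists Q => //; apply: compressed_by_absorbs h; apply: hQ; rewrite inE.
have [n [e re]] := finite_rank_idem_rank fP.
exists (range P), P; split=> //; last exact: finite_rank_idemK.
by exists n, e.
Qed.

(** Two operators come with idempotents that may differ in range and kernel; a third one absorbing
    both compresses their sums and products. *)
Lemma Cs_subalgebra : is_subalgebra (Cs p1 X).
Proof.
have common P P' : finite_rank_idem P -> finite_rank_idem P' ->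
    exists Q : bop (ell nat) (ell nat), [/\ finite_rank_idem Q, absorbs Q P & absorbs Q P'].
  move=> fP fP'; have [|Q [fQ hQ]] := @absorb_operators R p p1 nat [:: P; P'].
    move=> S; rewrite !inE => /orP[]/eqP->.
      by have [n [e re]] := finite_rank_idem_rank fP; exists n, e; rewrite re.
    by have [n [e re]] := finite_rank_idem_rank fP'; exists n, e; rewrite re.
  by exists Q; split=> //; apply: hQ; rewrite !inE eqxx ?orbT.
split.
- apply/CsP; split; first exact: finite_propagation0.
  exists 0; first exact: finite_rank_idem0.
  by move=> x y; rewrite bcomp0l; exact: bop_ext.
- move=> c S T /CsP[fS [P fP hS]] /CsP[fT [P' fP' hT]]; apply/CsP.
  split; first exact: finite_propagation_lin.
  have [Q [fQ aP aP']] := common P P' fP fP'; exists Q => //.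
  move=> x y; rewrite entryP {1}(compressed_by_absorbs aP hS) {1}(compressed_by_absorbs aP' hT).
  by rewrite bcompDl bcompZl bcompDr bcompZr.
- move=> S T /CsP[fS [P fP hS]] /CsP[fT [P' fP' hT]]; apply/CsP.
  split; first exact: finite_propagation_comp.
  have [Q [fQ aP aP']] := common P P' fP fP'; exists Q => //.
  have /compressed_byP eS := compressed_by_absorbs aP hS.
  have /compressed_byP eT := compressed_by_absorbs aP' hT.
  have DD v : pointwise_op p1 X Q (pointwise_op p1 X Q v) = pointwise_op p1 X Q v.
    have e : bcomp (pointwise_op p1 X Q) (pointwise_op p1 X Q) = pointwise_op p1 X Q.
      by rewrite pointwise_bcomp finite_rank_idemK.
    exact: (congr1 (fun A : bop V V => A v) e).
  set D := pointwise_op p1 X Q in DD eS eT.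
  have eSv v : D (S (D v)) = S v := congr1 (fun A : bop V V => A v) eS.
  have eTv v : D (T (D v)) = T v := congr1 (fun A : bop V V => A v) eT.
  have DS v : D (S v) = S v by rewrite -[in LHS]eSv DD eSv.
  have TD v : T (D v) = T v by rewrite -[in LHS]eTv DD eTv.
  apply/compressed_byP; apply: bop_ext => v.
  by change (D (S (T (D v))) = S (T v)); rewrite DS TD.
Qed.

(** Q absorbs the first N diagonal matrix units. It therefore fixes delta_m and leaves the m-th
    coordinate of every vector unchanged for m < N, which is all that a matrix supported there
    sees. *)
Lemma corner_absorb (N : nat) : exists2 Q : bop (ell nat) (ell nat), finite_rank_idem Q &
  forall K : bop (ell nat) (ell nat),
    (forall i j, coef K i j != 0 -> (i < N)%N /\ (j < N)%N) -> absorbs Q K.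
Proof.
have [|Q [fQ hQ]] := @absorb_operators R p p1 nat
    [seq rk1 p1 (delta p1 m) m | m <- iota 0 N].
  by move=> T /mapP[m _ ->]; exists 1%N; exact: rank_le_rk1.
exists Q => // K hK.
have hm m : (m < N)%N -> absorbs Q (rk1 p1 (delta p1 m) m).
  by move=> mN; apply: hQ; apply/mapP; exists m; rewrite // mem_iota.
have Qd m : (m < N)%N -> Q (delta p1 m) = delta p1 m.
  move=> /hm[h _].
  have : Q (delta p1 m m *: delta p1 m) = delta p1 m m *: delta p1 m :=
    congr1 (fun S : bop (ell nat) (ell nat) => S (delta p1 m)) h.
  by rewrite deltaE eqxx scale1r.
have Qc m u : (m < N)%N -> Q u m = u m.
  move=> /hm[_ h].
  have : (Q u m *: delta p1 m) m = (u m *: delta p1 m) m :=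
    congr1 (fun S : bop (ell nat) (ell nat) => S u m) h.
  by rewrite !ellpZE deltaE eqxx !scale_one.
have KE v : K v = \sum_(j <- iota 0 N) v j *: K (delta p1 j).
  apply: bop_finite_support; first exact: iota_uniq.
  move=> j; rewrite mem_iota add0n /= => jN; apply: ellp_ext => i.
  by apply/eqP/negPn/negP => /hK[_ jN']; rewrite jN' in jN.
split; apply: bop_ext => v /=.
  rewrite KE bop_sumr; apply: eq_big_seq => j _; rewrite bopZ; congr (_ *: _).
  have -> : K (delta p1 j) = \sum_(i <- iota 0 N) coef K i j *: delta p1 i.
    apply: ellp_ext => k; rewrite ellp_sumE.
    have [kN|Nk] := ltnP k N.
      rewrite (bigD1_seq k) ?iota_uniq ?mem_iota// big1 => [|i ik].
        by rewrite [RHS]addr0 ellpZE deltaE eqxx scale_one.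
      by rewrite ellpZE deltaE eq_sym (negbTE ik) scaler0.
    rewrite big1_seq => [|i /andP[_]].
      by apply/eqP/negPn/negP => /hK[]; rewrite ltnNge Nk.
    rewrite mem_iota add0n ellpZE deltaE => /andP[_ iN].
    by case: (k =P i) => [ki|]; rewrite ?scaler0//; move: iN; rewrite -ki ltnNge Nk.
  rewrite bop_sumr; apply: eq_big_seq => i; rewrite mem_iota add0n /= => iN.
  by rewrite bopZ Qd.
rewrite !KE; apply: eq_big_seq => j; rewrite mem_iota add0n /= => jN.
by rewrite Qc.
Qed.

Lemma corner_op_Cs (T : bop (ell (X * nat)%type) (ell (X * nat)%type)) :
  corner_op T -> Cs p1 X (fold_op T).
Proof.
move=> [r [N h]]; apply/CsP; split.
  apply/finite_propagationP; exists r => x y; apply: contra_neqP => /negP d.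
  apply: entry_fold_eq0 => m n; apply/eqP/negPn/negP => /h[/= dr _ _].
  by rewrite dr in d.
have [Q fQ hQ] := corner_absorb N; exists Q => // x y.
have [|h1 h2] := hQ (entry (fold_op T) x y).
  by move=> i j; rewrite coef_entry_fold => /h[].
by rewrite h2 h1.
Qed.

(** Every entry begins with the same factor P, whose rows far out are uniformly small because its
    range is spanned by finitely many l^p vectors. This bounds the row level independently of x and
    y. *)
Lemma tight_Cs (T : bop (ell (X * nat)%type) (ell (X * nat)%type)) :
  Cs p1 X (fold_op T) -> tight T.
Proof.
move=> /CsP[/finite_propagationP[r hr] [P fP hP]] e e0.
have c1 : 0 < opnorm (fold_op T) * opnorm P + 1.
  by rewrite ltr_wpDl// mulr_ge0// opnorm_ge0.
have e2 : 0 < e / 2 by rewrite divr_gt0.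
have [N hN] := finite_rank_idem_tail fP (divr_gt0 e2 c1).
exists r, N => -[x m] [y n] /= le; split.
  apply: hr; apply: (entry_fold_ne0 (s := m) (t := n)); apply/eqP => T0.
  by move: le; rewrite T0 rnorm0 leNgt e0.
rewrite ltnNge; apply/negP => Nm; move: le; apply/negP; rewrite -ltNge.
rewrite -coef_entry_fold /coef hP /=.
apply: le_lt_trans (hN m Nm _) _.
have : rnorm (entry (fold_op T) x y (P (delta p1 n))) <= opnorm (fold_op T) * opnorm P.
  apply: le_trans (rnorm_entry _ _ _ _) _; rewrite ler_wpM2l ?opnorm_ge0// opnorm_ub//.
  by rewrite rnorm_delta.
move=> h; apply: (@le_lt_trans _ _ (e / 2)); last by rewrite [ltRHS](splitr e) ltrDl.
rewrite mulrAC ler_pdivrMr// ler_wpM2l ?(ltW e2)//.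
by rewrite (le_trans h)// lerDl.
Qed.

Lemma tight_Bs (T : bop (ell (X * nat)%type) (ell (X * nat)%type)) :
  unfolded (Bs p1 X) T -> tight T.
Proof.
rewrite /unfolded /= => /bop_closureP h; apply: tight_norm_closed => e /h[S CS lt].
exists (unfold_op S); first by apply: tight_Cs; rewrite unfold_opK.
by rewrite -opnorm_fold /fold_op conj_opB -/(fold_op _) -/(fold_op _) unfold_opK.
Qed.

Lemma Bs_roe_like : roe_like (unfolded (Bs p1 X)) fst (fun x => (x, 0%N)).
Proof.
apply: corner_roe_like.
- by apply: unfolded_subalgebra; exact: closure_subalgebra Cs_subalgebra.
- by apply: unfolded_norm_closed; exact: closure_norm_closed.
- exact: tight_Bs.
- by move=> T /corner_op_Cs h; exact: subset_bop_closure.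
Qed.

End over_space.
End stable_algebra.

(** * Isomorphisms from coarse equivalences *)

Section glueing.
Variables (X Y Z : eqType).

(* If FX z and FY z enumerate the fibres over z of maps a : X -> Z and b : Y -> Z,
   then (x, n) has position n * #|fibre| + rank x in the block FX z x nat, and is
   sent to the element of FY z x nat with the same position. *)
Definition glue_map (a : X -> Z) (FX : Z -> seq X) (FY : Z -> seq Y) (d : X -> Y)
    (k : X * nat) : Y * nat :=
  let z := a k.1 in
  let m := (k.2 * size (FX z) + index k.1 (FX z))%N in
  (nth (d k.1) (FY z) (m %% size (FY z)), (m %/ size (FY z))%N).

End glueing.

Section glueing_theory.
Variables (X Y Z : eqType).
Variables (a : X -> Z) (b : Y -> Z) (FX : Z -> seq X) (FY : Z -> seq Y).
Variables (dXY : X -> Y) (dYX : Y -> X).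
Hypotheses (uX : forall z, uniq (FX z)) (uY : forall z, uniq (FY z)).
Hypotheses (memX : forall x z, (x \in FX z) = (a x == z)).
Hypotheses (memY : forall y z, (y \in FY z) = (b y == z)).
Hypotheses (FXY : forall x, (0 < size (FY (a x)))%N).

Lemma glue_base k : b (glue_map a FX FY dXY k).1 = a k.1.
Proof. by apply/eqP; rewrite -memY mem_nth// ltn_mod. Qed.

Lemma glue_position k y m : glue_map a FX FY dXY k = (y, m) ->
  (m * size (FY (a k.1)) + index y (FY (a k.1)) =
   k.2 * size (FX (a k.1)) + index k.1 (FX (a k.1)))%N.
Proof. by move=> [<- <-]; rewrite index_uniq ?ltn_mod// -divn_eq. Qed.

(** Both directions refer to the same position in the block, and division with remainder by the
    fibre size recovers rank and level. *)
Lemma glueK : cancel (glue_map a FX FY dXY) (glue_map b FY FX dYX).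
Proof.
move=> [x n]; case e : (glue_map a FX FY dXY (x, n)) => [y m].
have by_ : b y = a x by rewrite -(glue_base (x, n)) e.
have /= pos := glue_position e.
have ix : (index x (FX (a x)) < size (FX (a x)))%N by rewrite index_mem memX.
have sx : (0 < size (FX (a x)))%N by exact: leq_ltn_trans ix.
rewrite /glue_map /= by_ pos; congr (_, _).
  by rewrite modnMDl modn_small// nth_index// memX.
by rewrite divnMDl// divn_small// addn0.
Qed.

End glueing_theory.

(** * The finitely many maps on the second factor *)

Section position_operators.
Variables (R : realType) (p : R) (p1 : 1 <= p).
Local Notation ell I := (ellp p1 I R[i]^o).

(** The part of the glueing bijection joining fixed points x and y. Here [jx] is the size of the
    fibre of x and [ix] the rank of x in it; [jy.+1] is the size of the fibre of y, written as a
    successor so as to be positive, and [iy] is the rank of y. *)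
Definition position_map (q : nat * nat * (nat * nat)) (m : nat) : option nat :=
  let: (jx, ix, (jy, iy)) := q in
  let t := (m * jy.+1 + iy)%N in if (t %% jx)%N == ix then Some (t %/ jx)%N else None.

Lemma position_map_inj q : partial_inj (position_map q).
Proof.
case: q => [[jx ix] [jy iy]] m m' n; rewrite /position_map.
case: eqP => // e [en]; case: eqP => // e' [en'].
have : (m * jy.+1 + iy = m' * jy.+1 + iy)%N.
  by rewrite (divn_eq (m * jy.+1 + iy) jx) (divn_eq (m' * jy.+1 + iy) jx) e e' en en'.
by move=> /addIn /eqP; rewrite eqn_pmul2r// => /eqP.
Qed.

Definition position_op q : bop (ell nat) (ell nat) := pinj p1 R[i]^o (@position_map_inj q).

Definition position_params (K : nat) : seq (nat * nat * (nat * nat)) :=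
  [seq (u, v) | u <- [seq (j, i) | j <- iota 0 K.+1, i <- iota 0 K.+1],
                v <- [seq (j, i) | j <- iota 0 K.+1, i <- iota 0 K.+1]].

Lemma mem_position_params K j i j' i' : (j <= K)%N -> (i <= K)%N -> (j' <= K)%N ->
  (i' <= K)%N -> (j, i, (j', i')) \in position_params K.
Proof.
move=> jK iK jK' iK'; apply: allpairs_f; first by apply: allpairs_f; rewrite mem_iota.
by apply: allpairs_f; rewrite mem_iota.
Qed.

Lemma position_op_le q : opnorm (position_op q) <= 1.
Proof. by apply: opnorm_le => v; apply: le_trans; exact: pinj_le. Qed.

Lemma position_op_bounded q N : exists M, forall i k, coef (position_op q) i k != 0 ->
  ((k < N)%N -> (i < M)%N) /\ ((i < N)%N -> (k < M)%N).
Proof.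
case: q => [[jx ix] [jy iy]].
(* The first summand bounds the row when the column is below N, the second the column when the row
   is below N. *)
exists ((N * jx + ix).+1 + (N * jy.+1 + iy).+1)%N => i k.
rewrite coef_pinj; case: (_ =P Some k) => [|_]; last by rewrite eqxx.
rewrite /position_map; case: eqP => // e [en] _; split=> lt.
  rewrite ltn_addr// ltnS.
  have : (i <= i * jy.+1 + iy)%N by rewrite (leq_trans _ (leq_addr _ _))// leq_pmulr.
  move=> /leq_trans; apply; rewrite (divn_eq (i * jy.+1 + iy) jx) e en leq_add2r.
  by rewrite leq_mul2r (ltnW lt) orbT.
rewrite ltn_addl// ltnS -en (leq_trans (leq_div _ _))// leq_add2r.
by rewrite leq_mul2r (ltnW lt) orbT.
Qed.

Lemma finite_matrix_position q q' T : finite_matrix T ->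
  finite_matrix (bcomp (position_op q) (bcomp T (position_op q'))).
Proof.
move=> [N hN].
have [M hM] := position_op_bounded q N; have [M' hM'] := position_op_bounded q' N.
exists (maxn M M') => i j /coef_bcomp_ne0[k [/hM[kM _] /coef_bcomp_ne0[l [/hN[kN lN] /hM'[_ jM]]]]].
by rewrite !leq_max (kM kN) (jM lN) orbT.
Qed.

Lemma Mbar_position q q' T : Mbar_infty p1 T ->
  Mbar_infty p1 (bcomp (position_op q) (bcomp T (position_op q'))).
Proof.
rewrite Mbar_inftyE => /bop_closureP h; apply/bop_closureP => e e0.
have [S FS lt] := h e e0.
exists (bcomp (position_op q) (bcomp S (position_op q'))).
  exact: finite_matrix_position.
apply: le_lt_trans lt.
have -> : bcomp (position_op q) (bcomp T (position_op q')) -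
    bcomp (position_op q) (bcomp S (position_op q')) =
    bcomp (position_op q) (bcomp (T - S) (position_op q')).
  by rewrite (bcompBl T S) bcompBr.
apply: le_trans (opnorm_bcomp _ _) _; rewrite -[leRHS]mul1r.
apply: ler_pM; [exact: opnorm_ge0|exact: opnorm_ge0|exact: position_op_le|].
apply: le_trans (opnorm_bcomp _ _) _; rewrite -[leRHS]mulr1.
by apply: ler_wpM2l; [exact: opnorm_ge0|exact: position_op_le].
Qed.

End position_operators.

Section rank_sums.
Variables (R : realType).
Implicit Types E F : normedModType R[i].

Lemma rank_leD E F (S T : bop E F) n m : rank_le S n -> rank_le T m ->
  rank_le (S + T) (n + m).
Proof.
move=> [e he] [f hf].
exists (fun i => match fintype.split i with inl j => e j | inr j => f j end).
move=> _ [v _ <-]; rewrite bopDE.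
have [a _ <-] : span_fam e (S v) by apply: he; exists v.
have [b _ <-] : span_fam f (T v) by apply: hf; exists v.
exists (fun i => match fintype.split i with inl j => a j | inr j => b j end) => //.
rewrite big_split_ord /=; congr (_ + _); apply: eq_bigr => i _.
  by rewrite (unsplitK (inl i : 'I_n + 'I_m)).
by rewrite (unsplitK (inr i : 'I_n + 'I_m)).
Qed.

Lemma rank_le0 E F n : rank_le (0 : bop E F) n.
Proof.
exists (fun=> 0) => _ [v _ <-]; exists (fun=> 0) => //.
by rewrite big1// => i _; rewrite scaler0.
Qed.

Lemma rank_le_mono E F (T : bop E F) n m : rank_le T n -> (n <= m)%N -> rank_le T m.
Proof. by move=> h /subnKC <-; rewrite -[T]addr0; apply: rank_leD h (rank_le0 _ _ _). Qed.

Lemma rank_le_sum E F (J : eqType) (s : seq J) (T : J -> bop E F) n :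
  (forall j, j \in s -> rank_le (T j) n) -> rank_le (\sum_(j <- s) T j) (size s * n).
Proof.
elim: s => [|j s ih] h; first by rewrite big_nil; exact: rank_le0.
rewrite big_cons mulSn; apply: rank_leD; first by apply: h; rewrite mem_head.
by apply: ih => k ks; apply: h; rewrite inE ks orbT.
Qed.

End rank_sums.

(** * Conjugation by the glueing bijection *)

Section glue_conjugation.
Variables (R : realType) (p : R) (p1 : 1 <= p) (X Y : metricType R) (Z : eqType).
Local Notation ell I := (ellp p1 I R[i]^o).
Variables (a : X -> Z) (b : Y -> Z) (FX : Z -> seq X) (FY : Z -> seq Y).
Variables (dXY : X -> Y) (dYX : Y -> X).
Hypotheses (uX : forall z, uniq (FX z)) (uY : forall z, uniq (FY z)).
Hypotheses (memX : forall x z, (x \in FX z) = (a x == z)).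
Hypotheses (memY : forall y z, (y \in FY z) = (b y == z)).
Hypotheses (FXY : forall x, (0 < size (FY (a x)))%N).
Hypotheses (FYX : forall y, (0 < size (FX (b y)))%N).

Let gK' := glueK dYX dXY uX memY memX FYX.

Definition glue_perm : bop (ell (X * nat)%type) (ell (Y * nat)%type) :=
  perm_op p1 R[i]^o gK'.

Definition glue_op : bop (ellp p1 X (ell nat)) (ellp p1 Y (ell nat)) :=
  bcomp (curry_op p1 Y nat _) (bcomp glue_perm (uncurry_op p1 X nat _)).

Lemma glue_opE w y m : glue_op w y m =
  w (glue_map b FY FX dYX (y, m)).1 (glue_map b FY FX dYX (y, m)).2.
Proof. by []. Qed.

Definition glue_param (x : X) (y : Y) : nat * nat * (nat * nat) :=
  (size (FX (b y)), index x (FX (b y)), ((size (FY (b y))).-1, index y (FY (b y)))).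

(** Only the fibre over b y contributes at y. At level m the remainder of the position singles out
    one x in that fibre, so exactly one summand takes its coordinate from w. *)
Lemma glue_op_sum w y :
  glue_op w y = \sum_(x <- FX (b y)) position_op p1 (glue_param x y) (w x).
Proof.
apply: ellp_ext => m; rewrite glue_opE ellp_sumE /glue_map.
set t := (_ + _)%N; set x0 := nth _ _ _.
have lt : ((t %% size (FX (b y)))%N < size (FX (b y)))%N by rewrite ltn_mod.
have x0F : x0 \in FX (b y) by exact: mem_nth.
have yF : (0 < size (FY (b y)))%N.
  by rewrite (leq_ltn_trans _ (_ : index y (FY (b y)) < _)%N)// index_mem memY.
have pos x : position_map (glue_param x y) m =
    if (t %% size (FX (b y)))%N == index x (FX (b y)) then Some (t %/ size (FX (b y)))%N else None.
  by rewrite /position_map /glue_param prednK.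
rewrite (bigD1_seq x0)// pinjE pos index_uniq// eqxx big1_seq => [|x /andP[xx0 xF]].
  by apply/esym; exact: addr0.
rewrite pinjE pos; case: eqP => // e; move: xx0.
by rewrite /x0 e nth_index ?eqxx.
Qed.

End glue_conjugation.

(* Maps of X and Y to a common set with the same image and uniformly finite
   fibres, such that the correspondence they define is coarse in both directions. *)
Record glueing (R : realType) (X Y : metricType R) := Glueing {
  base : eqType;
  mapl : X -> base;
  mapr : Y -> base;
  fibl : base -> seq X;
  fibr : base -> seq Y;
  dfltl : X -> Y;
  dfltr : Y -> X;
  fibl_uniq : forall z, uniq (fibl z);
  fibr_uniq : forall z, uniq (fibr z);
  mem_fibl : forall x z, (x \in fibl z) = (mapl x == z);
  mem_fibr : forall y z, (y \in fibr z) = (mapr y == z);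
  fibr_mapl : forall x, (0 < size (fibr (mapl x)))%N;
  fibl_mapr : forall y, (0 < size (fibl (mapr y)))%N;
  fib_bound : nat;
  fibl_bound : forall z, (size (fibl z) <= fib_bound)%N;
  fibr_bound : forall z, (size (fibr z) <= fib_bound)%N;
  controll : forall r, exists s, forall x x' y y', mapl x = mapr y -> mapl x' = mapr y' ->
    mdist x x' <= r -> mdist y y' <= s;
  controlr : forall r, exists s, forall y y' x x', mapr y = mapl x -> mapr y' = mapl x' ->
    mdist y y' <= r -> mdist x x' <= s }.

Arguments fibl {R X Y} g z.
Arguments fibr {R X Y} g z.
Arguments fibl_uniq {R X Y} g z.
Arguments fibr_uniq {R X Y} g z.
Arguments mem_fibl {R X Y} g x z.
Arguments mem_fibr {R X Y} g y z.
Arguments fibr_mapl {R X Y} g x.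
Arguments fibl_mapr {R X Y} g y.
Arguments fibl_bound {R X Y} g z.
Arguments fibr_bound {R X Y} g z.

Definition flip (R : realType) (X Y : metricType R) (G : glueing X Y) : glueing Y X :=
  Glueing (dfltr G) (dfltl G) (fibr_uniq G) (fibl_uniq G) (mem_fibr G) (mem_fibl G)
    (fibl_mapr G) (fibr_mapl G) (fibr_bound G) (fibl_bound G) (controlr G) (controll G).

Section glueing_operators.
Variables (R : realType) (p : R) (p1 : 1 <= p).
Local Notation ell I := (ellp p1 I R[i]^o).

Definition gperm (X Y : metricType R) (G : glueing X Y) :=
  glue_perm p1 (dfltl G) (dfltr G) (fibl_uniq G) (mem_fibl G) (mem_fibr G) (fibl_mapr G).

Definition gop (X Y : metricType R) (G : glueing X Y) :
    bop (ellp p1 X (ell nat)) (ellp p1 Y (ell nat)) :=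
  bcomp (curry_op p1 Y nat _) (bcomp (gperm G) (uncurry_op p1 X nat _)).

Definition gparam (X Y : metricType R) (G : glueing X Y) :=
  glue_param (mapr G) (fibl G) (fibr G).

Lemma gop_sum (X Y : metricType R) (G : glueing X Y) w y :
  gop G w y = \sum_(x <- fibl G (mapr G y)) position_op p1 (gparam G x y) (w x).
Proof. exact: glue_op_sum. Qed.

Section one_glueing.
Variables (X Y : metricType R) (G : glueing X Y).

Definition gmap : X * nat -> Y * nat := glue_map (mapl G) (fibl G) (fibr G) (dfltl G).
Definition gmap' : Y * nat -> X * nat := glue_map (mapr G) (fibr G) (fibl G) (dfltr G).

Lemma gmapK : cancel gmap gmap'.
Proof. exact: glueK (fibr_uniq G) (mem_fibl G) (mem_fibr G) (fibr_mapl G). Qed.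
Lemma gmapK' : cancel gmap' gmap.
Proof. exact: glueK (fibl_uniq G) (mem_fibr G) (mem_fibl G) (fibl_mapr G). Qed.

Lemma gpermE w k : gperm G w k = w (gmap' k). Proof. by []. Qed.

Lemma gpermK : cancel (gperm G) (gperm (flip G)).
Proof.
move=> w; apply: ellp_ext => k.
by change (w (gmap' (gmap k)) = w k); rewrite gmapK.
Qed.

Lemma gopK : cancel (gop G) (gop (flip G)).
Proof.
move=> v; apply: ellp_ext => x; apply: ellp_ext => n.
by change (uncurry_op p1 X nat _ v (gmap' (gmap (x, n))) = v x n); rewrite gmapK.
Qed.

Lemma gop_le v : rnorm (gop G v) <= rnorm v.
Proof.
have -> : rnorm (gop G v) = rnorm (gperm G (uncurry_op p1 X nat _ v)) by exact: curry_norm.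
by apply: le_trans (pinj_le _ _) _; rewrite [leLHS]uncurry_norm.
Qed.

Lemma gperm_le v : rnorm (gperm G v) <= rnorm v.
Proof. exact: pinj_le. Qed.

End one_glueing.

Lemma gperm_isometric (X Y : metricType R) (G : glueing X Y) : isometric (gperm G).
Proof. exact: contraction_isometric (gperm_le G) (gperm_le (flip G)) (gpermK G). Qed.

Lemma gop_isometric (X Y : metricType R) (G : glueing X Y) : isometric (gop G).
Proof. exact: contraction_isometric (gop_le G) (gop_le (flip G)) (gopK G). Qed.

Lemma gpermK' (X Y : metricType R) (G : glueing X Y) : cancel (gperm (flip G)) (gperm G).
Proof. by case: G => *; exact: (gpermK (flip (Glueing _ _ _ _ _ _ _ _ _ _ _ _))). Qed.

Section conjugated.
Variables (X Y : metricType R) (G : glueing X Y).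
Local Notation V Z := (ellp p1 Z (ell nat)).

Definition gconj (T : bop (V X) (V X)) : bop (V Y) (V Y) := conj_op (gop G) (gop (flip G)) T.

Lemma gop_single (y : Y) e : gop (flip G) (single p1 y e) =
  \sum_(x <- fibl G (mapr G y)) single p1 x (position_op p1 (gparam (flip G) y x) e).
Proof.
apply: ellp_ext => x; rewrite gop_sum ellp_sumE.
change (\sum_(y' <- fibr G (mapl G x)) position_op p1 (gparam (flip G) y' x) (single p1 y e y') =
  \sum_(x' <- fibl G (mapr G y)) single p1 x' (position_op p1 (gparam (flip G) y x') e) x).
transitivity (if mapl G x == mapr G y then position_op p1 (gparam (flip G) y x) e else 0).
  case: ifPn => [/eqP xy|xy].
    have yF : y \in fibr G (mapl G x) by rewrite mem_fibr xy.
    rewrite (bigD1_seq y) ?fibr_uniq// singleE eqxx big1 => [|y' yy']; first exact: addr0.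
    by rewrite singleE (negbTE yy') bop0.
  rewrite big1_seq// => y' /andP[_]; rewrite mem_fibr singleE => /eqP y'x.
  by case: eqP => [yy'|]; rewrite ?bop0//; move: xy; rewrite -y'x yy' eqxx.
case: ifPn => [xy|xy].
  have xF : x \in fibl G (mapr G y) by rewrite mem_fibl.
  rewrite (bigD1_seq x) ?fibl_uniq// singleE eqxx big1 => [|x' xx'].
    by apply/esym; exact: addr0.
  by rewrite singleE eq_sym (negbTE xx').
rewrite big1_seq// => x' /andP[_]; rewrite mem_fibl singleE => x'y.
by case: eqP => [xx'|]//; move: xy; rewrite xx' x'y.
Qed.

(** Each new entry is a sum of boundedly many old entries, multiplied on both sides by position
    operators with bounded parameters. Preservation of the three algebras is read off from this
    formula. *)
Lemma entry_gconj T y y' : entry (gconj T) y y' =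
  \sum_(x <- fibl G (mapr G y)) \sum_(x' <- fibl G (mapr G y'))
    bcomp (position_op p1 (gparam G x y))
      (bcomp (entry T x x') (position_op p1 (gparam (flip G) y' x'))).
Proof.
apply: bop_ext => e; rewrite bop_sumE.
change (gop G (T (gop (flip G) (single p1 y' e))) y = \sum_(x <- fibl G (mapr G y))
  (\sum_(x' <- fibl G (mapr G y'))
    bcomp (position_op p1 (gparam G x y))
      (bcomp (entry T x x') (position_op p1 (gparam (flip G) y' x')))) e).
rewrite gop_sum; apply: eq_bigr => x _; rewrite bop_sumE gop_single bop_sumr ellp_sumE.
by rewrite bop_sumr.
Qed.

Lemma gconj_finite_propagation T : finite_propagation T -> finite_propagation (gconj T).
Proof.
move=> /finite_propagationP[r hr]; have [s hs] := controll G r.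
apply/finite_propagationP; exists s => y y'; apply: contra_neqP => /negP d.
rewrite entry_gconj big1_seq// => x /andP[_]; rewrite mem_fibl => /eqP xy.
rewrite big1_seq// => x' /andP[_]; rewrite mem_fibl => /eqP xy'.
have [->|ne] := eqVneq (entry T x x') 0; first by rewrite bcomp0l bcomp0r.
by move: d; rewrite (hs _ _ _ _ xy xy' (hr _ _ ne)).
Qed.

Lemma gconj_UC T : UC p1 X T -> UC p1 Y (gconj T).
Proof.
move=> [fT [N hN]]; split; first exact: gconj_finite_propagation.
exists (fib_bound G * (fib_bound G * N))%N => y y'; rewrite entry_gconj.
apply: (@rank_le_mono _ _ _ _
    (size (fibl G (mapr G y)) * (size (fibl G (mapr G y')) * N))%N).
  apply: rank_le_sum => x _; apply: rank_le_sum => x' _.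
  by apply: rank_le_range; apply: rank_le_source.
by rewrite leq_mul ?fibl_bound// leq_mul ?fibl_bound.
Qed.

Lemma gconj_CX T : CX p1 X T -> CX p1 Y (gconj T).
Proof.
move=> [fT hT]; split; first exact: gconj_finite_propagation.
have [M0 Mlin _] := Mbar_infty_subalgebra p1.
have sumM (J : Type) (s : seq J) (F : J -> bop (ell nat) (ell nat)) :
    (forall j, Mbar_infty p1 (F j)) -> Mbar_infty p1 (\sum_(j <- s) F j).
  move=> hF; elim: s => [|j s ih]; first by rewrite big_nil.
  by rewrite big_cons -[F j]scale1r; exact: Mlin.
move=> y y'; rewrite entry_gconj; apply: (@sumM _) => x; apply: (@sumM _) => x'.
exact: Mbar_position.
Qed.

Lemma gparam_mem x y : x \in fibl G (mapr G y) ->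
  gparam G x y \in position_params (fib_bound G).
Proof.
move=> xF; apply: mem_position_params.
- exact: fibl_bound.
- by rewrite (leq_trans (index_size _ _))// fibl_bound.
- by rewrite (leq_trans (leq_pred _))// fibr_bound.
- by rewrite (leq_trans (index_size _ _))// fibr_bound.
Qed.

Lemma gparam_flip_mem x y : gparam (flip G) y x \in position_params (fib_bound G).
Proof.
apply: mem_position_params => /=.
- exact: fibr_bound.
- by rewrite (leq_trans (index_size _ _))// fibr_bound.
- by rewrite (leq_trans (leq_pred _))// fibl_bound.
- by rewrite (leq_trans (index_size _ _))// fibl_bound.
Qed.

(** The position operators v, v' come from one finite list, so a single finite rank idempotent
    absorbs every v P and every P v', and it compresses all entries of the conjugate. *)
Lemma gconj_Cs T : Cs p1 X T -> Cs p1 Y (gconj T).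
Proof.
move=> /CsP[fT [P fP hP]]; apply/CsP; split; first exact: gconj_finite_propagation.
have [n [e re]] := finite_rank_idem_rank fP.
have rP : rank_le P n by exists e; rewrite re.
have [|Q [fQ hQ]] := @absorb_operators R p p1 nat
  ([seq bcomp (position_op p1 q) P | q <- position_params (fib_bound G)] ++
   [seq bcomp P (position_op p1 q) | q <- position_params (fib_bound G)]).
  move=> S; rewrite mem_cat => /orP[]/mapP[q _ ->]; exists n.
    exact: rank_le_range.
  exact: rank_le_source.
exists Q => // y y'; rewrite entry_gconj bcomp_suml bcomp_sumr.
apply: eq_big_seq => x xF; rewrite bcomp_suml bcomp_sumr; apply: eq_big_seq => x' xF'.
set v := position_op p1 _; set v' := position_op p1 _.
have [h1 _] : absorbs Q (bcomp v P).
  by apply: hQ; rewrite mem_cat; apply/orP; left; apply/mapP; eexists; [exact: gparam_mem xF|].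
have [_ h2] : absorbs Q (bcomp P v').
  by apply: hQ; rewrite mem_cat; apply/orP; right; apply/mapP; eexists; [exact: (gparam_flip_mem x' y')|].
rewrite hP; apply: bop_ext => u.
have e1 w : Q (v (P w)) = v (P w) := congr1 (fun S : bop (ell nat) (ell nat) => S w) h1.
have e2 w : P (v' (Q w)) = P (v' w) := congr1 (fun S : bop (ell nat) (ell nat) => S w) h2.
change (v (P (entry T x x' (P (v' u)))) = Q (v (P (entry T x x' (P (v' (Q u))))))).
by rewrite e1 e2.
Qed.

Lemma coef_gperm T k l :
  coef (conj_op (gperm G) (gperm (flip G)) T) k l = coef T (gmap' G k) (gmap' G l).
Proof.
rewrite /coef conj_opE gpermE; congr (T _ _).
apply: ellp_ext => j; change (single p1 l (1 : R[i]^o) (gmap G j) =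
  single p1 (gmap' G l) (1 : R[i]^o) j).
by rewrite !singleE; congr (if _ then _ else _); apply/eqP/eqP => [<-|->];
  rewrite ?gmapK ?gmapK'.
Qed.

Lemma gconj_corner (T : bop (ell (X * nat)%type) (ell (X * nat)%type)) :
  corner_op T -> corner_op (conj_op (gperm G) (gperm (flip G)) T).
Proof.
move=> [r [N h]]; have [s hs] := controll G r.
have bnd k : ((gmap' G k).2 < N)%N -> (k.2 < N * fib_bound G)%N.
  (* The level of [k] is a quotient of a position that is less than (n + 1) times a fibre size,
     where n < N. *)
  rewrite -{2}(gmapK' G k); case: (gmap' G k) => x n /= nN.
  rewrite (leq_ltn_trans (leq_div _ _))//.
  have ix : (index x (fibl G (mapl G x)) < size (fibl G (mapl G x)))%N.
    by rewrite index_mem mem_fibl.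
  apply: (@leq_trans (n.+1 * size (fibl G (mapl G x)))%N).
    by rewrite mulSn addnC ltn_add2r.
  by rewrite leq_mul// fibl_bound.
have basee k : mapl G (gmap' G k).1 = mapr G k.1.
  by apply: glue_base; [exact: mem_fibl|exact: fibl_mapr].
exists s, (N * fib_bound G)%N => k l; rewrite coef_gperm => /h[d kN lN].
by split; [exact: hs (basee k) (basee l) d|exact: bnd|exact: bnd].
Qed.

End conjugated.
End glueing_operators.

(** * Glueings from coarse equivalences *)

Section glueing_of_coarse_equivalence.
Variable R : realType.

Lemma fibre_enumeration (X : metricType R) (Z : eqType) (h : X -> Z) (r : R) :
  bounded_geometry X -> 0 <= r -> (forall x x', h x = h x' -> mdist x x' <= r) ->
  exists (F : Z -> seq X) (N : nat), [/\ forall z, uniq (F z),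
    forall x z, (x \in F z) = (h x == z) & forall z, (size (F z) <= N)%N].
Proof.
move=> bX r0 hr; have [N [L hL]] := bounded_geometry_seq bX r0.
have ex z : exists s : seq X,
    [/\ uniq s, forall x, (x \in s) = (h x == z) & (size s <= N)%N].
  have [[x0 <-]|none] := pselect (exists x, h x = z); last first.
    exists [::]; split=> // x; rewrite in_nil; apply/esym/negbTE/eqP => e.
    by apply: none; exists x.
  have [uL sL mL] := hL x0; exists [seq x <- L x0 | h x == h x0]; split.
  - exact: filter_uniq.
  - move=> x; rewrite mem_filter mL; case: eqP => //= e.
    by rewrite hr.
  - by rewrite size_filter (leq_trans (count_size _ _)).
have [F hF] := choice ex; exists F, N.
by split=> [z|x z|z]; case: (hF z).
Qed.

Lemma uniformly_expansiveP (X Y : metricType R) (f : X -> Y) : uniformly_expansive f ->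
  forall r : R, exists s : R, forall x x', mdist x x' <= r -> mdist (f x) (f x') <= s.
Proof.
move=> uf r; have [|s _ hs] := uf (`|r| + 1); first by rewrite ltr_wpDl.
exists s => x x' d; apply: hs; rewrite (le_trans d)// (le_trans (ler_norm r))// lerDl.
exact: ler01.
Qed.

Lemma mdist_detour (Y : metricType R) (z z' y y' : Y) (s c : R) :
  mdist z y <= c -> mdist z' y' <= c -> mdist z z' <= s -> mdist y y' <= s + (c + c).
Proof.
move=> zy zy' zz.
apply: le_trans (metric_triangle y z y') _; apply: (@le_trans _ _ (c + (s + c))).
  apply: lerD; first by rewrite metric_sym.
  by apply: le_trans (metric_triangle z z' y') _; exact: lerD.
by rewrite addrCA.
Qed.

(** The base is Y, with [f] on the left and on the right a retraction [b] of Y onto the image of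
    [f]: the identity on the image and f (g y) elsewhere. This makes the images equal. The closeness
    constants bound the diameters of the fibres, so bounded geometry bounds their sizes. *)
Lemma coarsely_equivalent_glueing (X Y : metricType R) :
  bounded_geometry X -> bounded_geometry Y -> coarsely_equivalent X Y ->
  exists G : glueing X Y, True.
Proof.
move=> bX bY [f [uf [g [ug [c c0 fg] [c' c'0 gf]]]]].
have retract (y : Y) : exists z, mdist z y <= c /\ (exists x, f x = z) /\
    ((exists x, f x = y) -> z = y).
  have [im|nim] := pselect (exists x, f x = y).
    by exists y; split; [rewrite mdistxx ltW|split].
  exists (f (g y)); split; first exact: fg.
  by split; [exists (g y)|move=> im; exfalso; exact: nim].
have [b hb] := choice retract.
have b_close y : mdist (b y) y <= c by case: (hb y).
have b_im y : exists x, f x = b y by case: (hb y) => _ [].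
have b_id x : b (f x) = f x by case: (hb (f x)) => _ [_]; apply; exists x.
have f_fibre x x' : f x = f x' -> mdist x x' <= c' + c'.
  move=> e; rewrite -[leRHS]add0r.
  apply: (mdist_detour (z := g (f x)) (z' := g (f x'))); [exact: gf|exact: gf|].
  by rewrite e mdistxx.
have b_fibre y y' : b y = b y' -> mdist y y' <= c + c.
  move=> e; rewrite -[leRHS]add0r; apply: mdist_detour (b_close y) (b_close y') _.
  by rewrite e mdistxx.
have c2 : 0 <= c + c by rewrite addr_ge0 ?ltW.
have c'2 : 0 <= c' + c' by rewrite addr_ge0 ?ltW.
have [FX [N [uX memX sX]]] := fibre_enumeration bX c'2 f_fibre.
have [FY [M [uY memY sY]]] := fibre_enumeration bY c2 b_fibre.
have FYf x : (0 < size (FY (f x)))%N.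
  have : f x \in FY (f x) by rewrite memY b_id.
  by case: (FY (f x)).
have FXb y : (0 < size (FX (b y)))%N.
  have [x e] := b_im y; have : x \in FX (b y) by rewrite memX e.
  by case: (FX (b y)).
have cl r : exists s, forall x x' y y', f x = b y -> f x' = b y' ->
    mdist x x' <= r -> mdist y y' <= s.
  have [s hs] := uniformly_expansiveP uf r; exists (s + (c + c)) => x x' y y' e e' d.
  by apply: mdist_detour (b_close y) (b_close y') _; rewrite -e -e' hs.
have cr r : exists s, forall y y' x x', b y = f x -> b y' = f x' ->
    mdist y y' <= r -> mdist x x' <= s.
  have [s hs] := uniformly_expansiveP ug (r + (c + c)).
  exists (s + (c' + c')) => y y' x x' e e' d.
  apply: mdist_detour (gf x) (gf x') _; rewrite /= -e -e'; apply: hs.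
  by apply: mdist_detour d; rewrite metric_sym.
have sX' z : (size (FX z) <= maxn N M)%N by rewrite leq_max sX.
have sY' z : (size (FY z) <= maxn N M)%N by rewrite leq_max sY orbT.
by exists (Glueing f g uX uY memX memY FYf FXb sX' sY' cl cr).
Qed.

End glueing_of_coarse_equivalence.

(** * Isometric isomorphisms induced by glueings and bijections *)

Section stable_isomorphisms.
Variables (R : realType) (p : R) (p1 : 1 <= p).
Local Notation ell I := (ellp p1 I R[i]^o).

Lemma flipK (X Y : metricType R) (G : glueing X Y) : flip (flip G) = G.
Proof. by case: G. Qed.

Lemma gopK' (X Y : metricType R) (G : glueing X Y) : cancel (gop p1 (flip G)) (gop p1 G).
Proof. by rewrite -{2}(flipK G); exact: gopK. Qed.

Lemma glueing_iso
    (A : forall Z : metricType R, set (bop (ellp p1 Z (ell nat)) (ellp p1 Z (ell nat))))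
    (X Y : metricType R) (G : glueing X Y) :
  (forall (Z W : metricType R) (H : glueing Z W) T, A Z T -> A W (gconj H T)) ->
  isometrically_isomorphic (closure (A X)) (closure (A Y)).
Proof.
move=> hA.
apply: (isometrically_isomorphic_conj_closure (@gopK _ _ p1 _ _ G) (gopK' G) (@gop_isometric _ _ p1 _ _ G)).
  exact: hA.
by move=> S AS; have := hA _ _ (flip G) _ AS; rewrite /gconj flipK.
Qed.

Lemma tens_corner_closure (X : metricType R) (a : bop (ell X) (ell X))
    (b : bop (ell nat) (ell nat)) :
  Bu p1 X a -> Mbar_infty p1 b -> closure (@corner_op R p p1 X) (tens a b).
Proof.
move=> /bop_closureP ha; rewrite Mbar_inftyE => /bop_closureP hb.
apply/bop_closureP => e e0; have e2 : 0 < e / 2 by rewrite divr_gt0.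
have b1 : 0 < opnorm b + 1 by rewrite ltr_wpDl// opnorm_ge0.
have [a' /CuP[r hr] lta] := ha _ (divr_gt0 e2 b1).
have a1 : 0 < opnorm a' + 1 by rewrite ltr_wpDl// opnorm_ge0.
have [b' [N hN] ltb] := hb _ (divr_gt0 e2 a1).
exists (tens a' b').
  exists r, N => -[x m] [y n]; rewrite tens_coef mulf_eq0 negb_or => /andP[ane bne].
  by have [mN nN] := hN _ _ bne; split=> //; exact: hr.
have -> : tens a b - tens a' b' = tens (a - a') b + tens a' (b - b').
  by rewrite tensBl tensBr addrA subrK.
apply: le_lt_trans (opnormD _ _) _; rewrite (splitr e); apply: ltr_leD.
  apply: le_lt_trans (opnorm_tens _ _) _.
  move: lta; rewrite ltr_pdivlMr//; apply: le_lt_trans.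
  by apply: ler_wpM2l; [exact: opnorm_ge0|rewrite lerDl].
apply: le_trans (opnorm_tens _ _) _.
move: ltb; rewrite ltr_pdivlMr// => /ltW; apply: le_trans.
by rewrite mulrC; apply: ler_wpM2l; [exact: opnorm_ge0|rewrite lerDl].
Qed.

(** Conjugation by the glueing permutation need not preserve elementary tensors. It does preserve
    corner operators, which are finite sums of elementary tensors and approximate each elementary
    tensor in norm. *)
Lemma alg_tensor_gperm (X Y : metricType R) (G : glueing X Y) T :
  alg_tensor (Bu p1 X) (Mbar_infty p1) T ->
  alg_tensor (Bu p1 Y) (Mbar_infty p1) (conj_op (gperm p1 G) (gperm p1 (flip G)) T).
Proof.
have K := @gpermK _ _ p1 _ _ G; have K' := @gpermK' _ _ p1 _ _ G.
have iG := @gperm_isometric _ _ p1 _ _ G.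
have [[A0 Alin _] cA _] : matrix_unit_algebra (alg_tensor (Bu p1 Y) (Mbar_infty p1)).
  by case: (alg_tensor_roe_like p1 Y).
pose P := [set T | alg_tensor (Bu p1 Y) (Mbar_infty p1)
                     (conj_op (gperm p1 G) (gperm p1 (flip G)) T)].
apply: (@norm_closed_closure _ _ _ _ P).
  move=> S h; apply: cA => e /h[S' PS' lt]; exists (conj_op (gperm p1 G) (gperm p1 (flip G)) S') => //.
  by rewrite -conj_opB (opnorm_conj K K' iG).
apply: lin_span_ind.
- rewrite /P /=; suff -> : conj_op (gperm p1 G) (gperm p1 (flip G)) 0 = 0 by [].
  by rewrite /conj_op bcomp0l bcomp0r.
- by move=> c u v Pu Pv; rewrite /P /= conj_opP; exact: Alin.
move=> S [a [b [Ba Mb /is_op_tensor_unique ->]]].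
have : closure (@corner_op R p p1 Y) (conj_op (gperm p1 G) (gperm p1 (flip G)) (tens a b)).
  by apply: (conj_closure K K' iG (@gconj_corner _ _ p1 _ _ G)); exact: tens_corner_closure.
apply: norm_closed_closure => // T0 /corner_op_span; exact: subset_bop_closure.
Qed.

Lemma glueing_stable_iso (X Y : metricType R) (G : glueing X Y) :
  isometrically_isomorphic (alg_tensor (Bu p1 X) (Mbar_infty p1))
    (alg_tensor (Bu p1 Y) (Mbar_infty p1)).
Proof.
apply: (isometrically_isomorphic_conj (@gpermK _ _ p1 _ _ G) (@gpermK' _ _ p1 _ _ G) (@gperm_isometric _ _ p1 _ _ G)).
  exact: alg_tensor_gperm.
by move=> S AS; have := @alg_tensor_gperm _ _ (flip G) S AS; rewrite flipK.
Qed.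

Lemma bijective_coarse_equivalence_iso (X Y : metricType R) :
  bijectively_coarsely_equivalent X Y -> isometrically_isomorphic (Bu p1 X) (Bu p1 Y).
Proof.
move=> [f [[uf [g [ug _ [c c0 gf]]]] [f' fK f'K]]].
have coef_conj (Z W : metricType R) (s : Z -> W) (s' : W -> Z) (sK : cancel s s')
    (sK' : cancel s' s) (T : bop (ell Z) (ell Z)) y y' :
    coef (conj_op (perm_op p1 R[i]^o sK') (perm_op p1 R[i]^o sK) T) y y' = coef T (s' y) (s' y').
  by rewrite /coef conj_opE perm_opE (perm_op_single p1 sK').
have contr (Z W : metricType R) (s : Z -> W) (s' : W -> Z) (sK' : cancel s' s) v :
    rnorm (perm_op p1 R[i]^o sK' v) <= rnorm v by exact: pinj_le.
have K : cancel (perm_op p1 R[i]^o f'K) (perm_op p1 R[i]^o fK) by exact: perm_opK.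
have K' : cancel (perm_op p1 R[i]^o fK) (perm_op p1 R[i]^o f'K) by exact: perm_opK.
apply: (isometrically_isomorphic_conj_closure K K'
  (contraction_isometric (contr _ _ _ _ _) (contr _ _ _ _ _) K)).
- move=> T /CuP[r hr]; have [s hs] := uniformly_expansiveP uf r.
  apply/CuP; exists s => y y'; rewrite coef_conj => /hr /hs.
  by rewrite !f'K.
(* The inverse bijection [f'] may differ from [g]; distances in X are controlled through [g] because
   [g \o f] is close to the identity. *)
- move=> T /CuP[r hr]; have [s hs] := uniformly_expansiveP ug r.
  apply/CuP; exists (s + (c + c)) => x x'; rewrite coef_conj => /hr /hs d.
  exact: mdist_detour (gf x) (gf x') d.
Qed.

End stable_isomorphisms.

Theorem theorem1p7 (R : realType) (p : R) (p1 : 1 <= p) (p2 : p != 2)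
    (X Y : metricType R)
    (hX : bounded_geometry X) (hY : bounded_geometry Y) :
  [/\ (bijectively_coarsely_equivalent X Y <->
        isometrically_isomorphic (Bu p1 X) (Bu p1 Y)),
      (coarsely_equivalent X Y <->
        isometrically_isomorphic (alg_tensor (Bu p1 X) (Mbar_infty p1))
                                 (alg_tensor (Bu p1 Y) (Mbar_infty p1))) &
      [/\ forall (s t : option nat)
             (A : set (bop (ellp p1 X (ellp p1 (fibre s) R[i]^o))
                           (ellp p1 X (ellp p1 (fibre s) R[i]^o))))
             (B : set (bop (ellp p1 Y (ellp p1 (fibre t) R[i]^o))
                           (ellp p1 Y (ellp p1 (fibre t) R[i]^o)))),
             roe_type A -> roe_type B -> isometrically_isomorphic A B ->
             coarsely_equivalent X Y,
          isometrically_isomorphic (Bs p1 X) (Bs p1 Y) ->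
            coarsely_equivalent X Y &
          coarsely_equivalent X Y ->
            [/\ isometrically_isomorphic (UB p1 X) (UB p1 Y),
                isometrically_isomorphic (BX p1 X) (BX p1 Y) &
                isometrically_isomorphic (Bs p1 X) (Bs p1 Y)]]].
Proof.
split; [split|split|split].
- exact: bijective_coarse_equivalence_iso.
- apply: (uniform_roe_like_rigid p2 hX hY).
  + exact: Bu_matrix_unit_algebra.
  + exact: Bu_has_translations.
  + exact: Bu_coarsely_controlled.
  + exact: Bu_matrix_unit_algebra.
  + exact: Bu_has_translations.
  + exact: Bu_coarsely_controlled.
- by move=> /(coarsely_equivalent_glueing hX hY)[G _]; exact: glueing_stable_iso G.
- exact: (roe_like_rigid p2 hX hY (alg_tensor_roe_like p1 X) (alg_tensor_roe_like p1 Y)).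
- move=> s t A B rA rB /isometrically_isomorphic_unfolded.
  exact: (roe_like_rigid p2 hX hY (roe_type_roe_like rA) (roe_type_roe_like rB)).
- move=> /isometrically_isomorphic_unfolded.
  exact: (roe_like_rigid p2 hX hY (Bs_roe_like p1 X) (Bs_roe_like p1 Y)).
- move=> /(coarsely_equivalent_glueing hX hY)[G _]; split.
  + by apply: (glueing_iso (A := fun Z => UC p1 Z) G); exact: gconj_UC.
  + by apply: (glueing_iso (A := fun Z => CX p1 Z) G); exact: gconj_CX.
  + by apply: (glueing_iso (A := fun Z => Cs p1 Z) G); exact: gconj_Cs.
Qed.
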